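(* For each $r\in(0,\infty)$ and any $\varepsilon>0$, $$\lim_{n\to\infty}P_n^r\{\Gamma\in\Pi_n: d_{\mathcal T}(\tilde\Gamma_n,\gamma^* )\le\varepsilon\}=1 .$$
   Context: A convex lattice polygonal line $\Gamma$ is a piecewise linear path in the plane with finitely many edges, starting at the origin $0=(0,0)$, with vertices in $\mathbb Z_+^2$ ($\mathbb Z_+=\{0,1,2,\dots\}$), such that the inclination angle of its consecutive edges strictly increases and stays in $[0,\pi/2]$. For $n=(n_1,n_2)\in\mathbb Z_+^2$, $\Pi_n$ is the (finite) set of convex lattice polygonal lines whose right endpoint is $n$. For $0<r<\infty$ and $k\in\mathbb Z_+$ put $b_k^r=\binom{r+k-1}{k}=\frac{r(r+1)\cdots(r+k-1)}{k!}$ (with $b_0^r=1$). For $\Gamma\in\Pi_n$ put $b^r(\Gamma)=\prod_{e_i\in\Gamma}b_{k_i}^r$, the product being over all edges $e_i$ of $\Gamma$, where $k_i$ is the number of lattice points on $e_i$ except its left endpoint. The probability measure $P_n^r$ on $\Pi_n$ is $P_n^r(\Gamma)=b^r(\Gamma)/\sum_{\Gamma'\in\Pi_n}b^r(\Gamma')$. The limit $n=(n_1,n_2)\to\infty$ means $n_1,n_2\to\infty$ in such a way that $0<c_1\le n_2/n_1\le c_2<\infty$ for some constants $c_1,c_2$. Scaling: $S_n(x_1,x_2)=(x_1/n_1,x_2/n_2)$ and $\tilde\Gamma_n=S_n(\Gamma)$. For $t\in[0,\infty]$, $\tilde\xi_n(t)$ denotes the right endpoint of the part of $\tilde\Gamma_n$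 where the tangent slope (wherever it exists) does not exceed $t$ (the origin if there is no such part). The limit curve $\gamma^*$ is the parabola arc $\sqrt{1-x_1}+\sqrt{x_2}=1$, $0\le x_1,x_2\le1$, with tangential parameterization $g^*(t)=\left(\frac{t^2+2t}{(1+t)^2},\frac{t^2}{(1+t)^2}\right)$, $0\le t\le\infty$ (with $g^*(\infty)=(1,1)$). The tangential distance is $d_{\mathcal T}(\tilde\Gamma_n,\gamma^* )=\sup_{0\le t\le\infty}|\tilde\xi_n(t)-g^*(t)|$, where $|\cdot|$ is the Euclidean norm on $\mathbb R^2$. *)

(* Defs.v *)
From HB Require Import structures.
From mathcomp Require Import finmap all_boot all_order all_algebra.
From mathcomp Require Import all_classical all_reals all_analysis.
From mathcomp Require Import zify ring.

Set Implicit Arguments.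
Unset Strict Implicit.
Unset Printing Implicit Defensive.

Import Order.TTheory GRing.Theory Num.Theory.

Local Open Scope classical_set_scope.
Local Open Scope ring_scope.

Section Geometry.
Context {R : realType}.
Implicit Types (v : R * R) (e : (R * R) * (R * R)) (t : \bar R).

Definition enorm v : R := Num.sqrt (v.1 ^+ 2 + v.2 ^+ 2).

(* A polygonal line issued from the origin is the list of its successive
   vertices, the origin omitted; an edge is the pair (left endpoint, right
   endpoint). *)
Definition edges (s : seq (R * R)) : seq ((R * R) * (R * R)) :=
  zip (0 :: s) s.

Definition edge_vec e : R * R := e.2 - e.1.

(* The angle from the positive x_1-axis to v != 0, normalized to lie in
   [-pi/2, 3pi/2[. *)
Definition angle v : R :=
  if 0 < v.1 then atan (v.2 / v.1)
  else if v.1 == 0 then Num.sg v.2 * (pi / 2)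
  else atan (v.2 / v.1) + pi.

Definition slope v : \bar R :=
  if v.1 == 0 then +oo%E else (v.2 / v.1)%:E.

Definition gstar t : R * R :=
  match t with
  | t%:E => ((t ^+ 2 + 2 * t) / (1 + t) ^+ 2, t ^+ 2 / (1 + t) ^+ 2)
  | +oo%E => (1, 1)
  | -oo%E => 0 (* irrelevant: only 0 <= t is used *)
  end.

End Geometry.

Section LatticeLines.
Context (R : realType).
Implicit Types (n p : nat * nat) (G : seq (nat * nat)).

Definition embed p : R * R := (p.1%:R, p.2%:R).

Definition lattice_edges G := edges (map embed G).

Definition convex_line G : bool :=
  let vs := [seq edge_vec e | e <- lattice_edges G] in
  [&& all (fun v => v != 0) vs,
      all (fun v => 0 <= angle v <= pi / 2) vs &
      sorted (fun v w => angle v < angle w) vs].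

Definition Pi n : set (seq (nat * nat)) :=
  [set G | convex_line G /\ last (0%N, 0%N) G = n].

Definition lattice_points (e : (R * R) * (R * R)) : set (nat * nat) :=
  [set p | exists2 s : R, 0 < s <= 1 &
     embed p = (e.1.1 + s * (e.2.1 - e.1.1), e.1.2 + s * (e.2.2 - e.1.2))].

Definition num_points e : nat := #|` fset_set (lattice_points e)|.

Definition bcoef (r : R) (k : nat) : R :=
  (\prod_(i < k) (r + i%:R)) / (k`!)%:R.

Definition weight (r : R) G : R :=
  \prod_(e <- lattice_edges G) bcoef r (num_points e).

Definition prob (r : R) n (A : set (seq (nat * nat))) : R :=
  (\sum_(G \in Pi n `&` A) weight r G) / (\sum_(G \in Pi n) weight r G).

Definition scale n (x : R * R) : R * R := (x.1 / n.1%:R, x.2 / n.2%:R).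

Definition scaled_line n G : seq (R * R) := [seq scale n (embed p) | p <- G].

Definition xi n G (t : \bar R) : R * R :=
  last 0 [seq e.2 | e <- edges (scaled_line n G) & (slope (edge_vec e) <= t)%E].

Definition tangential_dist n G : \bar R :=
  ereal_sup [set (enorm (xi n G t - gstar t))%:E | t in [set t | (0 <= t)%E]].

Definition to_infty (c1 c2 : R) : set_system (nat * nat) :=
  within [set n | c1 <= n.2%:R / n.1%:R <= c2] (filter_prod \oo \oo).

(* finite_Pi and finite_lattice_points guarantee that the sums in prob and the cardinal in
   num_points are genuine: \sum_(_ \in _) and fset_set return default values
   on infinite supports. *)

Lemma angle_itv_ge0 (v : R * R) :
  0 <= angle v <= pi / 2 -> (0 <= v.1) && (0 <= v.2).
Proof.
case: v => x y; rewrite /angle /=.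
have pi2 : 0 < pi / 2 :> R by rewrite divr_gt0 ?pi_gt0.
case: ltrgtP => [x0|x0|_] /andP[a0 a1] /=.
- case: (leP 0 y) => // y0; have := @lt_atan R (y / x) 0.
  rewrite atan0 pmulr_llt0 ?invr_gt0 // => /(_ y0).
  by rewrite ltNge a0.
- have := ltr_leD (atan_gtNpi2 (y / x)) (lexx (pi : R)).
  have -> : - (pi / 2) + pi = pi / 2 :> R by rewrite {2}(splitr pi) addKr.
  by rewrite ltNge a1.
- by move: a0; rewrite pmulr_lge0 // sgr_ge0.
Qed.

Lemma edges_bound (u : nat * nat) G :
  all (fun v => (v != 0) && (0 <= angle v <= pi / 2))
    [seq edge_vec e | e <- zip (embed u :: map embed G) (map embed G)] ->
  let l := last u G in
  [/\ (u.1 <= l.1)%N, (u.2 <= l.2)%N,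
      (size G + (u.1 + u.2) <= l.1 + l.2)%N &
      all (fun p => (p.1 <= l.1) && (p.2 <= l.2))%N G].
Proof.
elim: G u => [|w G IH] u /=; first by rewrite add0n.
case/andP => /andP[vn0 /angle_itv_ge0]; rewrite /edge_vec /= !subr_ge0 !ler_nat.
case/andP => uw1 uw2 /IH[h1 h2 h3 h4].
have uw : (u.1 + u.2 < w.1 + w.2)%N.
  rewrite ltn_neqAle leq_add // andbT; apply: contra vn0.
  case: u w uw1 uw2 {IH h1 h2 h3 h4} => [u1 u2] [w1 w2] /= uw1 uw2 /eqP E.
  have -> : u1 = w1 by lia.
  have -> : u2 = w2 by lia.
  by rewrite /edge_vec subrr.
rewrite (leq_trans uw1 h1) (leq_trans uw2 h2) h1 h2 h4; split=> //; lia.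
Qed.

Lemma finite_Pi n : finite_set (Pi n).
Proof.
pose B := `I_n.1.+1 `*` `I_n.2.+1.
have finB : finite_set B by apply: finite_setX; exact: finite_II.
pose L k : set (seq (nat * nat)) :=
  [set G | (size G <= k)%N /\ forall p, p \in G -> B p].
have finL k : finite_set (L k).
  elim: k => [|k IH].
    apply: (@sub_finite_set _ _ [set [::]]) => //.
    by move=> [|? ?] [] //=.
  apply: (@sub_finite_set _ _
    ([set [::]] `|` [set x.1 :: x.2 | x in B `*` L k])).
    move=> [|p G] [] /= sG GB; [by left | right].
    exists (p, G) => //; split=> /=; first by apply: GB; rewrite mem_head.
    by split=> // q qG; apply: GB; rewrite in_cons qG orbT.
  rewrite finite_setU; split=> //.
  by apply: finite_image; exact: finite_setX.
apply: sub_finite_set (finL (n.1 + n.2)%N) => G [/and3P[G1 G2 _] Gn].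
have := @edges_bound (0%N, 0%N) G; rewrite Gn all_predI.
case; first by apply/andP; split.
rewrite /= !addn0 => _ _ sG /allP GB; split=> // p /GB /andP[p1 p2].
by split; rewrite /= ltnS.
Qed.

Lemma finite_lattice_points (e : (R * R) * (R * R)) :
  finite_set (lattice_points e).
Proof.
pose M (i j : R) : R := `|i| + `|j|.
pose N i j := Num.bound (M i j).
have bd (i j s : R) (k : nat) :
    0 < s <= 1 -> k%:R = i + s * (j - i) -> (k < N i j)%N.
  move=> /andP[s0 s1] E; rewrite -(ltr_nat R).
  apply: le_lt_trans (archi_boundP _); last by rewrite addr_ge0.
  have -> : k%:R = (1 - s) * i + s * j by rewrite E; ring.
  apply: lerD; apply: le_trans (ler_norm _) _; rewrite normrM ger0_norm ?(ltW s0) ?subr_ge0 //.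
    by apply: ler_piMl => //; rewrite gerBl ltW.
  exact: ler_piMl.
apply: (@sub_finite_set _ _ (`I_(N e.1.1 e.2.1) `*` `I_(N e.1.2 e.2.2))).
  by move=> p [s s01 [E1 E2]]; split=> /=; apply: bd s01 _.
by apply: finite_setX; exact: finite_II.
Qed.

End LatticeLines.

(* Main.v *)
Require Import Defs.
From mathcomp Require Import all_boot all_order all_algebra.
From mathcomp Require Import all_classical all_reals all_analysis.
From mathcomp Require Import zify ring lra.

(** A convex lattice line is determined by the multiplicity nu x with which it
    uses each primitive direction x, a pair of coprime numbers; its weight is
    the product over x of bcoef r (nu x), and its endpoint and the points
    xi n G t are sums of multiples nu x * x over all directions, respectively
    over those of scaled slope at most t (line_surj, sum_weight, xi_line).
    After an exponential tilt by exp (- (a x_1 + b x_2)) the multiplicities are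
    independent, and the partition function of a set of directions is the
    product of the factors (1 - exp (- (a x_1 + b x_2)))^(- r) (sum_tilted).
    The logarithm of this product is r times the sum of
    exp (- (a y_1 + b y_2)) / gcd (y_1, y_2) over the lattice points y of a
    sector; inverting the gcd by a divisor sum, it is asymptotic to
    kappa / (a b) times the share of the sector in the integral of
    exp (- u_1 - u_2) over the quadrant (wsum_share, prod_zfac_asymp).

    Let a n_1 = b n_2 = s with s^3 = kappa n_1 n_2. Tilting the directions
    below slope t by (p a, q b) and the others by (a, b) bounds the weight of
    the lines for which (p - 1) xi_1 + (q - 1) xi_2 <= m by
      exp (s (2 + m + t / (p (p + q t)) + 1 / (1 + t) + o(1)))
    (sum_deviation_le). The point of the limit curve at t is minus the gradient
    of t / (p (p + q t)) at (1, 1). Hence, for (p, q) close to (1, 1), this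
    exponent is 3 s minus a positive multiple of s as soon as the half plane
    that m describes misses that point (quadratic_gain_1, quadratic_gain_2).

    On the other hand the weight of all lines ending at n is at least
    exp (s (3 - o(1))) (partition_function_ge). Tilted slightly more than by
    (a, b), a line typically ends just below n, again by exponential bounds;
    edges along the two axes then move its endpoint to n exactly, which
    changes the weight by a polynomial factor only. So the
    probability of a macroscopic deviation at a given t decays exponentially
    in s. As xi n G t is monotone in t, finitely many values of t
    control the tangential distance (grid_bound, tangential_dist_le). *)

Set Implicit Arguments.
Unset Strict Implicit.
Unset Printing Implicit Defensive.

Import Order.TTheory GRing.Theory Num.Theory.
Import numFieldNormedType.Exports.

Local Open Scope classical_set_scope.
Local Open Scope ring_scope.

(** * The binomial series *)

Section BinomialSeries.
Context {R : realType}.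
Implicit Types (r z c : R) (p q : {poly R}).

Lemma bcoef0 r : bcoef r 0 = 1.
Proof. by rewrite /bcoef big_ord0 fact0 divr1. Qed.

Lemma bcoefS r k : k.+1%:R * bcoef r k.+1 = (r + k%:R) * bcoef r k.
Proof.
rewrite /bcoef big_ord_recr /= factS natrM invfM.
have gen (a b p c : R) : a != 0 -> a * (p * c * (a^-1 * b)) = c * (p * b).
  by move=> a0; rewrite mulrCA mulVKf // -mulrA mulrCA.
by rewrite gen // pnatr_eq0.
Qed.

Lemma bcoef_gt0 r k : 0 < r -> 0 < bcoef r k.
Proof.
move=> r0; rewrite divr_gt0 ?ltr0n ?fact_gt0 // prodr_gt0 // => i _.
by rewrite ltr_wpDr.
Qed.

(** The sequence k b_k is nondecreasing and starts from b_1 = r. *)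
Lemma bcoef_ge r k : 0 < r -> Num.min r 1 / k.+1%:R <= bcoef r k.
Proof.
move=> r0; case: k => [|k]; first by rewrite bcoef0 divr1 ge_min lexx orbT.
have H j : r <= j.+1%:R * bcoef r j.+1.
  elim: j => [|j IH]; first by rewrite bcoefS bcoef0 addr0 mulr1.
  rewrite bcoefS; apply: le_trans IH _.
  by apply: ler_wpM2r; [rewrite ltW ?bcoef_gt0|rewrite lerDr ltW].
rewrite ler_pdivrMr ?ltr0n // mulrC.
have h1 : Num.min r 1 <= r by rewrite ge_min lexx.
apply: (le_trans h1); apply: le_trans (H k) _.
by apply: ler_wpM2r; [rewrite ltW ?bcoef_gt0|rewrite ler_nat].
Qed.

(** Partial sum of the binomial series of (1 - z)^(- r). *)
Definition bpoly r K : {poly R} := \poly_(k < K.+1) bcoef r k.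

(** Partial sum of the series of - ln (1 - z); its constant term is
    0 because 0^-1 = 0. *)
Definition lpoly M : {poly R} := \poly_(k < M.+1) (k%:R^-1).

Lemma bpolyE r K z : (bpoly r K).[z] = \sum_(k < K.+1) bcoef r k * z ^+ k.
Proof. by rewrite horner_poly. Qed.

Lemma lpolyE M z : (lpoly M).[z] = \sum_(1 <= k < M.+1) z ^+ k / k%:R.
Proof.
rewrite horner_poly -(big_mkord xpredT (fun k => k%:R^-1 * z ^+ k)).
rewrite big_ltn // invr0 mul0r add0r.
by apply: eq_bigr => i _; rewrite mulrC.
Qed.

Lemma bpolyS r K : bpoly r K.+1 = bpoly r K + (bcoef r K.+1) *: 'X^(K.+1).
Proof. by rewrite /bpoly !poly_def big_ord_recr. Qed.

Lemma lpolyS M : lpoly M.+1 = lpoly M + (M.+1%:R^-1) *: 'X^(M.+1).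
Proof. by rewrite /lpoly !poly_def big_ord_recr. Qed.

(** The binomial series solves (1 - z) f' = r f; the last term is the
    error due to the truncation. *)
Lemma bpoly_deriv r K z :
  (1 - z) * (bpoly r K)^`().[z] =
  r * (bpoly r K).[z] - (r + K%:R) * bcoef r K * z ^+ K.
Proof.
elim: K => [|K IH].
  have -> : bpoly r 0 = 1%:P.
    apply/polyP => i; rewrite coef_poly coefC; case: i => [|i] //=.
    by rewrite bcoef0.
  by rewrite bcoef0 derivC !(hornerD, hornerZ, hornerXn, hornerC); ring.
rewrite bpolyS derivD derivZ derivXn /=.
have -> : 'X^K *+ K.+1 = K.+1%:R *: 'X^K :> {poly R} by rewrite scaler_nat.
move: (bcoefS r K) IH; move: (bcoef r K) (bcoef r K.+1) => b b' E IH.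
rewrite !(hornerD, hornerZ, hornerXn, hornerC) mulrDr IH exprS -[K.+1]addn1 natrD in E *.
by rewrite -E; ring.
Qed.

Lemma lpoly_deriv M z : (1 - z) * (lpoly M)^`().[z] = 1 - z ^+ M.
Proof.
elim: M => [|M IH].
  have -> : lpoly 0 = 0%:P.
    apply/polyP => i; rewrite coef_poly coefC; case: i => [|i] //=.
    by rewrite invr0.
  by rewrite derivC !(hornerD, hornerZ, hornerXn, hornerC) expr0 subrr mulr0.
rewrite lpolyS derivD derivZ derivXn !(hornerD, hornerZ, hornerXn, hornerC) mulrDr IH /=.
have -> : 'X^M *+ M.+1 = M.+1%:R *: 'X^M :> {poly R} by rewrite scaler_nat.
rewrite !(hornerD, hornerZ, hornerXn, hornerC) exprS mulrA mulVf ?pnatr_eq0 //; ring.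
Qed.

Lemma bpoly_gt0 r K z : 0 < r -> 0 <= z -> 0 < (bpoly r K).[z].
Proof.
move=> r0 z0; rewrite bpolyE big_ord_recl /= bcoef0 expr0 mulr1.
rewrite ltr_wpDr // sumr_ge0 // => i _.
by rewrite mulr_ge0 ?exprn_ge0 // ltW // bcoef_gt0.
Qed.

Lemma is_derive_horner p z : is_derive z 1 (horner p) (p^`()).[z].
Proof.
by apply: DeriveDef; [exact: derivable_horner|rewrite -derive1E -derivE].
Qed.

Lemma is_derive_tilt p q z :
  is_derive z 1 (fun z => p.[z] * expR (- q.[z]))
    ((p^`().[z] - p.[z] * q^`().[z]) * expR (- q.[z])).
Proof.
have h1 := is_derive_horner p z.
have h2 : is_derive z 1 (fun z => - q.[z]) (- q^`().[z]).
  by apply: is_deriveN; exact: is_derive_horner.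
have h3 := is_derive1_comp (is_derive_expR _) h2.
apply: (is_derive_eq (is_deriveM h1 h3)).
rewrite /GRing.scale /=; ring.
Qed.

Lemma le_of_derive_ge0 (f df : R -> R) z : 0 <= z ->
  (forall y : R, is_derive y 1 f (df y)) ->
  (forall y : R, 0 <= y <= z -> 0 <= df y) -> f 0 <= f z.
Proof.
move=> z0 fd dfge.
have cf : {within `[0, z], continuous f}.
  by apply: derivable_within_continuous => y _; apply: ex_derive.
have [c cz E] := MVT_segment z0 (fun y _ => fd y) cf.
rewrite -subr_ge0 E subr0 mulr_ge0 // dfge //.
Qed.

(** The logarithmic derivative of the partial sum is at most
    r / (1 - z), and that of exp (r l_M) falls short of this by
    r z^M / (1 - z). *)
Lemma bpoly_le r K M z : 0 < r -> 0 <= z < 1 ->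
  (bpoly r K).[z] <=
  expR (r * (lpoly M).[z] + r * z ^+ M.+1 / (1 - z)).
Proof.
move=> r0 /andP[z0 z1]; have z1' : 0 < 1 - z by rewrite subr_gt0.
pose c := r / (1 - z); pose q := r *: lpoly M + c *: 'X^(M.+1).
have c0 : 0 < c by rewrite divr_gt0.
pose f y := - ((bpoly r K).[y] * expR (- q.[y])).
have fd (y : R) : is_derive y 1 f
    (- (((bpoly r K)^`().[y] - (bpoly r K).[y] * q^`().[y]) * expR (- q.[y]))).
  by apply: is_deriveN; exact: is_derive_tilt.
have := le_of_derive_ge0 z0 fd; rewrite /f lerN2 => H.
have {H} : (bpoly r K).[z] * expR (- q.[z]) <= (bpoly r K).[0] * expR (- q.[0]).
  apply: H => y /andP[y0 yz]; have y1 : 0 < 1 - y by lra.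
  rewrite -mulNr; apply: mulr_ge0; last exact: expR_ge0.
  rewrite -(pmulr_rge0 _ y1) mulrN mulrBr bpoly_deriv [(1 - y) * (_ * q^`().[y])]mulrCA.
  have -> : (1 - y) * q^`().[y] =
      r * (1 - y ^+ M) + (1 - y) * c * M.+1%:R * y ^+ M.
    rewrite /q derivD !derivZ derivXn !(hornerD, hornerZ, hornerXn, hornerC) mulrDr.
    have -> : 'X^M *+ M.+1 = M.+1%:R *: 'X^M :> {poly R} by rewrite scaler_nat.
    by rewrite !(hornerD, hornerZ, hornerXn, hornerC) /= -(lpoly_deriv M y); ring.
  set P := (bpoly r K).[y]; have P0 : 0 < P by apply: bpoly_gt0.
  have yM : 0 <= y ^+ M by rewrite exprn_ge0.
  have t1 : 0 <= (r + K%:R) * bcoef r K * y ^+ K.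
    have bK := ltW (bcoef_gt0 K r0).
    by move: (bcoef r K) bK => b bK; rewrite !mulr_ge0 ?exprn_ge0 ?addr_ge0 // ltW.
  have t2 : r <= (1 - y) * c * M.+1%:R.
    have h : r <= (1 - y) * c.
      rewrite /c mulrA ler_pdivlMr //; nra.
    by apply: (le_trans h); rewrite ler_peMr ?ler1n // mulr_ge0 // ltW.
  have t3 : 0 <= P * y ^+ M * ((1 - y) * c * M.+1%:R - r).
    by rewrite !mulr_ge0 ?subr_ge0 // ltW.
  move: t1 t3; set A := (r + K%:R) * _ * _; set B := (1 - y) * c * _.
  nra.
have -> : (bpoly r K).[0] = 1.
  rewrite bpolyE big_ord_recl /= bcoef0 expr0 mulr1 big1 ?addr0 // => i _.
  by rewrite expr0n mulr0.
have -> : q.[0] = 0.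
  rewrite /q !(hornerD, hornerZ, hornerXn, hornerC) lpolyE expr0n mulr0
    addr0 big_nat_cond big1 ?mulr0 // => i.
  by rewrite andbT => /andP[i0 _]; rewrite expr0n eqn0Ngt i0 mul0r.
rewrite oppr0 expR0 mulr1 expRN ler_pdivrMr ?expR_gt0 // mul1r.
by rewrite /q !(hornerD, hornerZ, hornerXn, hornerC) /c mulrAC.
Qed.

(** A suitable multiple of z^(K + 1) makes up for the truncation
    error in the differential equation: added to the right-hand side it gives a
    nondecreasing function, of value 1 at 0. *)
Lemma bpoly_ge_error r K M z : 0 < r -> 0 <= z < 1 ->
  1 - (r + 1) / (1 - z) * bcoef r K * z ^+ K.+1 <=
  (bpoly r K).[z] * expR (- (r * (lpoly M).[z])).
Proof.
move=> r0 /andP[z0 z1]; have z1' : 0 < 1 - z by rewrite subr_gt0.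
pose C := (r + 1) / (1 - z).
have C0 : 0 < C by rewrite divr_gt0 // addr_gt0.
have b0 := bcoef_gt0 K r0.
pose q := r *: lpoly M.
pose g := (C * bcoef r K) *: 'X^(K.+1) : {poly R}.
pose f y := (bpoly r K).[y] * expR (- q.[y]) + g.[y].
have fd (y : R) : is_derive y 1 f
    ((((bpoly r K)^`().[y] - (bpoly r K).[y] * q^`().[y]) * expR (- q.[y]))
     + g^`().[y]).
  exact: is_deriveD (is_derive_tilt _ _ _) (is_derive_horner _ _).
have {fd} : f 0 <= f z.
  apply: (le_of_derive_ge0 z0 fd) => y /andP[y0 yz]; have y1 : 0 < 1 - y by lra.
  rewrite -(pmulr_rge0 _ y1) mulrDr mulrA mulrBr bpoly_deriv [(1 - y) * (_ * q^`().[y])]mulrCA.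
  have -> : (1 - y) * q^`().[y] = r * (1 - y ^+ M).
    by rewrite /q derivZ !(hornerD, hornerZ, hornerXn, hornerC) -(lpoly_deriv M y); ring.
  have -> : g^`().[y] = C * bcoef r K * K.+1%:R * y ^+ K.
    rewrite /g !derivZ derivXn !(hornerD, hornerZ, hornerXn, hornerC).
    have -> : 'X^K *+ K.+1 = K.+1%:R *: 'X^K :> {poly R} by rewrite scaler_nat.
    by rewrite !(hornerD, hornerZ, hornerXn, hornerC); ring.
  set P := (bpoly r K).[y]; have P0 : 0 < P by apply: bpoly_gt0.
  have -> : r * P - (r + K%:R) * bcoef r K * y ^+ K - P * (r * (1 - y ^+ M)) =
    r * P * y ^+ M - (r + K%:R) * bcoef r K * y ^+ K by ring.
  set B := bcoef r K * y ^+ K.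
  have B0 : 0 <= B by rewrite mulr_ge0 ?exprn_ge0 // ltW.
  have e0 := expR_ge0 (- q.[y]).
  have e1 : expR (- q.[y]) <= 1.
    rewrite expR_le1 oppr_le0 /q !(hornerD, hornerZ, hornerXn, hornerC) mulr_ge0 ?(ltW r0) //.
    by rewrite lpolyE sumr_ge0 // => i _; rewrite divr_ge0 ?exprn_ge0.
  have t1 : 0 <= r * P * y ^+ M * expR (- q.[y]).
    by rewrite !mulr_ge0 ?exprn_ge0 // ltW.
  have t2 : (r + K%:R) * B * expR (- q.[y]) <= (r + K%:R) * B.
    by rewrite ler_piMr // mulr_ge0 // addr_ge0 // ltW.
  have t3 : (r + K%:R) <= (1 - y) * C * K.+1%:R.
    have h : r + 1 <= (1 - y) * C.
      rewrite /C mulrA ler_pdivlMr //; nra.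
    apply: (@le_trans _ _ ((r + 1) * K.+1%:R)); last by rewrite ler_wpM2r.
    by rewrite -[K.+1]addn1 natrD; have : 0 <= K%:R :> R by []; nra.
  have t4 : (r + K%:R) * B <= (1 - y) * C * K.+1%:R * B by rewrite ler_wpM2r.
  rewrite -[_ * bcoef r K * y ^+ K]mulrA -/B mulrBl.
  have -> : (1 - y) * (C * bcoef r K * K.+1%:R * y ^+ K) =
    (1 - y) * C * K.+1%:R * B by rewrite /B; ring.
  by move: t1 t2 t4; lra.
have -> : f 0 = 1.
  rewrite /f /g /q !(hornerD, hornerZ, hornerXn, hornerC) expr0n /=
    mulr0 addr0 bpolyE big_ord_recl /=.
  rewrite bcoef0 expr0 mulr1 big1 ?addr0 => [|i _]; last by rewrite expr0n mulr0.
  rewrite lpolyE big_nat_cond big1 ?mulr0 ?oppr0 ?expR0 ?mulr1 // => i.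
  by rewrite andbT => /andP[i0 _]; rewrite expr0n eqn0Ngt i0 mul0r.
by rewrite /f /q /g !(hornerD, hornerZ, hornerXn, hornerC) -/C; lra.
Qed.

(** The error above decays geometrically in K, because the partial
    sums are bounded at a point strictly between z and 1. *)
Lemma bpoly_ge r M z e : 0 < r -> 0 <= z < 1 -> 0 < e ->
  exists K0, forall K, (K0 <= K)%N ->
  (1 - e) * expR (r * (lpoly M).[z]) <= (bpoly r K).[z].
Proof.
move=> r0 /andP[z0 z1] e0; pose w := (z + 1) / 2.
have [zw w1] : z < w /\ w < 1 by rewrite /w; split; lra.
have w0 : 0 < w by lra.
pose B := expR (r * w / (1 - w)).
have bB K : bcoef r K * w ^+ K <= B.
  have /(_ r K 0%N w r0) := bpoly_le; rewrite (ltW w0) w1 => /(_ isT).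
  have -> : (lpoly 0).[w] = 0 by rewrite lpolyE big_nil.
  rewrite mulr0 add0r expr1 -/B; apply: le_trans.
  rewrite bpolyE big_ord_recr /= lerDr sumr_ge0 // => i _.
  by rewrite mulr_ge0 ?exprn_ge0 ?ltW // bcoef_gt0.
have zw0 : 0 <= z / w by rewrite divr_ge0 // ltW.
have zw1 : z / w < 1 by rewrite ltr_pdivrMr // mul1r.
pose C := (r + 1) / (1 - z).
have C0 : 0 < C by rewrite divr_gt0 ?subr_gt0 // ltr_wpDl // ltW.
have B0 : 0 < B := expR_gt0 _.
have /cvgrPdist_le/(_ (e / (C * B))) : (z / w) ^+ K @[K --> \oo] --> (0 : R).
  by apply: cvg_expr; rewrite ger0_norm.
rewrite (divr_gt0 e0 (mulr_gt0 C0 B0)) => /(_ isT) [K0 _ HK].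
exists K0 => K /HK; rewrite /= sub0r normrN ger0_norm ?exprn_ge0 // => h.
have /(_ r K M z r0) := bpoly_ge_error; rewrite z0 z1 => /(_ isT).
rewrite expRN ler_pdivlMr ?expR_gt0 //; apply: le_trans.
apply: ler_wpM2r; first exact: expR_ge0.
rewrite lerD2l lerN2 -/C.
have -> : C * bcoef r K * z ^+ K.+1 =
    C * (bcoef r K * w ^+ K) * (z / w) ^+ K * z.
  have wK : w ^+ K != 0 by rewrite expf_neq0 // gt_eqF.
  have gen (c b u v x : R) : u != 0 -> c * b * (x * v) = c * (b * u) * (v / u) * x.
    by move=> u0; field.
  by rewrite (expr_div_n z w) exprS (gen _ _ _ _ _ wK).
apply: (@le_trans _ _ (C * B * (z / w) ^+ K)).
  apply: (@le_trans _ _ (C * (bcoef r K * w ^+ K) * (z / w) ^+ K)).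
    apply: ler_piMr; last exact: ltW.
    have := ltW (bcoef_gt0 K r0); move: (bcoef r K) => b b0.
    have wK := exprn_ge0 K (ltW w0).
    by rewrite (mulr_ge0 (mulr_ge0 (ltW C0) (mulr_ge0 b0 wK))) ?exprn_ge0.
  by rewrite ler_wpM2r ?exprn_ge0 // ler_wpM2l // ltW.
by rewrite mulrC -ler_pdivlMr //; exact: mulr_gt0.
Qed.

End BinomialSeries.

(** * The reciprocal as a divisor sum *)

Section InverseDivisorSum.
Context {R : realType}.

Lemma big_nat_dvd (V : nmodType) k N (F : nat -> V) : (0 < k)%N ->
  \sum_(1 <= i < N.+1 | (k %| i)%N) F i =
  \sum_(1 <= i < (N %/ k).+1) F (k * i)%N.
Proof.
move=> k0; elim: N => [|N IH]; first by rewrite div0n !big_nil.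
rewrite big_mkcond big_nat_recr //= -big_mkcond IH divnS //.
case: ifP => kN; last by rewrite addr0.
rewrite [in RHS]big_nat_recr //=; congr (_ + F _).
have /dvdnP[j E] := kN.
move: (divnS N k0); rewrite kN add1n E mulnK // => <-.
by rewrite mulnC.
Qed.

(** The Dirichlet convolution of the Moebius function with the function
    d -> 1 / d. *)
Definition icoef (d : nat) : R := (\prod_(p <- primes d) (1 - p%:R)) / d%:R.

Lemma icoef1 : icoef 1 = 1.
Proof. by rewrite /icoef big_nil divr1. Qed.

Lemma icoef_norm d : `|icoef d| <= 1.
Proof.
case: (posnP d) => [->|d0]; first by rewrite /icoef invr0 mulr0 normr0.
rewrite /icoef normrM normfV normr_nat ler_pdivrMr ?ltr0n // mul1r.
rewrite {2}(prod_prime_decomp d0) natr_prod.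
have -> : primes d = unzip1 (prime_decomp d) by [].
rewrite big_map normr_prod 2!big_seq; apply: ler_prod => -[p e] /=.
move=> /mem_prime_decomp[pp e0 _]; rewrite normr_ge0 /=.
have p1 := prime_gt1 pp.
rewrite ler0_norm; last by rewrite subr_le0 ler1n ltnW.
apply: (@le_trans _ _ p%:R); first by rewrite opprB gerBl.
by rewrite ler_nat -{1}(expn1 p) leq_pexp2l // ltnW.
Qed.

Lemma icoef_pfactor p a e : prime p -> (0 < a)%N -> (0 < e)%N -> coprime p e ->
  icoef (p ^ a * e) = (1 - p%:R) / (p ^ a)%:R * icoef e.
Proof.
move=> pp a0 e0 cpe; rewrite /icoef.
have -> : \prod_(p0 <- primes (p ^ a * e)) (1 - p0%:R) =
    \prod_(p0 <- p :: primes e) (1 - p0%:R) :> R.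
  apply: perm_big; apply: uniq_perm; rewrite ?primes_uniq //=.
    rewrite primes_uniq andbT mem_primes pp e0 /=.
    by rewrite -prime_coprime.
  move=> x; rewrite primesM ?expn_gt0 ?(prime_gt0 pp) // primesX //.
  by rewrite primes_prime // !inE.
rewrite big_cons natrM invfM; ring.
Qed.

(** The divisors of p^a m that are new with respect to
    p^(a - 1) m are the p^a e with e a divisor of m. *)
Lemma dvdn_pfactor_split p a m d : prime p -> (0 < a)%N -> coprime p m ->
  (0 < d)%N -> (0 < m)%N ->
  (d %| p ^ a * m)%N && ~~ (d %| p ^ a.-1 * m)%N =
  (p ^ a %| d)%N && (d %/ p ^ a %| m)%N.
Proof.
move=> pp a0 cpm d0 m0; have p0 := prime_gt0 pp.
have pa0 b : (0 < p ^ b)%N by rewrite expn_gt0 p0.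
apply/idP/idP => [/andP[h1 h2]|/andP[/dvdnP[e ->]]].
  have h : (p ^ a %| d)%N.
    rewrite pfactor_dvdn // leqNgt; apply: contra h2 => h.
    rewrite -(partnC p d0) Gauss_dvd ?coprime_partC //.
    apply/andP; split.
      by rewrite p_part dvdn_mulr // dvdn_exp2l //; lia.
    have h3 : ((d`_p^')%N %| p ^ a * m)%N by apply: dvdn_trans (dvdn_part _ _) h1.
    rewrite dvdn_mull // -(@Gauss_dvdr _ (p ^ a) m) //.
    rewrite coprime_sym coprimeXl // prime_coprime //.
    by apply/negP => h4; have := p'natE ((d`_p^')%N) pp; rewrite part_pnat h4.
  by rewrite h dvdn_divLR // mulnC.
rewrite mulnK // => em; rewrite [(e * _)%N]mulnC dvdn_mul //=.
apply/negP; rewrite -{1}(prednK a0) expnSr -mulnA dvdn_pmul2l // => h.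
have : (p %| m)%N by apply: dvdn_trans h; exact: dvdn_mulr.
by apply/negP; rewrite -prime_coprime.
Qed.

(** Induction on n, splitting off the full power p^a of a prime: the
    divisors of n / p contribute p / n, and the others (1 - p) / p^a times the
    sum for n / p^a. *)
Lemma sum_icoef n N : (0 < n <= N)%N ->
  \sum_(1 <= d < N.+1 | (d %| n)%N) icoef d = n%:R^-1.
Proof.
elim/ltn_ind: n N => n IH N /andP[n0 nN].
case: (ltnP 1 n) => [n1|n1]; last first.
  have -> : n = 1%N by apply/eqP; rewrite eqn_leq n1.
  rewrite big_ltn_cond //=; last by rewrite ltnS (leq_trans n0).
  rewrite icoef1 big_nat_cond big1 ?addr0 ?invr1 //.
  by move=> i /andP[/andP[i1 _]]; rewrite dvdn1 => /eqP E; rewrite E in i1.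
pose p := pdiv n; have pp : prime p := pdiv_prime n1.
have p0 := prime_gt0 pp.
pose a := logn p n; pose m := (n`_p^')%N.
have a0 : (0 < a)%N by rewrite logn_gt0 mem_primes pp n0 pdiv_dvd.
have m0 : (0 < m)%N by rewrite part_gt0.
have nE : n = (p ^ a * m)%N by rewrite -[LHS](partnC p n0) p_part.
have cpm : coprime p m.
  rewrite prime_coprime //; apply/negP => h.
  by have := p'natE m pp; rewrite part_pnat h.
have pa0 b : (0 < p ^ b)%N by rewrite expn_gt0 p0.
have pan : (p ^ a.-1 * m < n)%N.
  by rewrite [ltnRHS]nE ltn_pmul2r // ltn_exp2l ?prime_gt1 // prednK.
have mn : (m < n)%N.
  by rewrite [ltnRHS]nE -{1}(mul1n m) ltn_pmul2r // -(expn0 p) ltn_exp2l ?prime_gt1.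
rewrite (bigID (fun d => d %| p ^ a.-1 * m)%N) /=.
have -> : \sum_(1 <= d < N.+1 | (d %| n)%N && (d %| p ^ a.-1 * m)%N) icoef d =
    (p ^ a.-1 * m)%:R^-1.
  rewrite -(IH _ pan N); last by rewrite muln_gt0 pa0 m0 ltnW // (leq_trans pan).
  apply: eq_bigl => d; case: (boolP (d %| p ^ a.-1 * m)%N); last by rewrite andbF.
  move=> h; rewrite andbT nE (dvdn_trans h) // dvdn_mul // dvdn_exp2l //.
  exact: leq_pred.
have -> : \sum_(1 <= d < N.+1 | (d %| n)%N && ~~ (d %| p ^ a.-1 * m)%N) icoef d =
    (1 - p%:R) / (p ^ a)%:R * m%:R^-1.
  rewrite [LHS]big_nat_cond.
  under eq_bigl => d.
    have -> : (0 < d < N.+1)%N && ((d %| n)%N && ~~ (d %| p ^ a.-1 * m)%N) =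
      (0 < d < N.+1)%N && ((p ^ a %| d)%N && (d %/ p ^ a %| m)%N).
      case: (boolP (0 < d < N.+1)%N) => //= /andP[d0 _].
      by rewrite nE dvdn_pfactor_split.
    over.
  rewrite -big_nat_cond big_mkcondr big_nat_dvd // -(IH _ mn (N %/ p ^ a)%N); last first.
    by rewrite m0 leq_divRL // mulnC -nE.
  rewrite mulr_sumr [RHS]big_mkcond !big_nat.
  apply: eq_bigr => e /andP[e0 _]; rewrite mulKn //; case: ifP => // em.
  rewrite icoef_pfactor //; apply: coprime_dvdr em _.
  exact: cpm.
have pE : (p ^ a)%:R = p%:R * (p ^ a.-1)%:R :> R.
  by rewrite -natrM -expnS prednK.
have nE' : n%:R = p%:R * (p ^ a.-1)%:R * m%:R :> R by rewrite -pE -natrM -nE.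
rewrite nE' natrM pE !invfM.
have : p%:R != 0 :> R by rewrite pnatr_eq0 -lt0n.
move: (p%:R : R) ((p ^ a.-1)%:R^-1 : R) (m%:R^-1 : R) => x y z x0.
by field.
Qed.

Lemma sum_inv_sqr_le D N : (0 < D)%N ->
  \sum_(D.+1 <= d < N.+1) (d%:R ^- 2) <= D%:R^-1 :> R.
Proof.
move=> D0; case: (leqP D N) => [DN|ND]; last by rewrite big_geq ?invr_ge0 // ltnW.
suff : \sum_(D.+1 <= d < N.+1) (d%:R ^- 2) <= D%:R^-1 - N%:R^-1 :> R.
  by move=> h; apply: (le_trans h); rewrite gerBl invr_ge0.
elim: N DN => [|N IH DN]; first by rewrite leqNgt D0.
move: DN; rewrite leq_eqVlt => /orP[/eqP<-|]; first by rewrite big_geq ?subrr.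
rewrite ltnS => DN; rewrite big_nat_recr //=.
have N0 : (0 < N)%N by apply: leq_trans DN.
apply: (le_trans (lerD (IH DN) (lexx _))).
have x0 : 0 < N%:R :> R by rewrite ltr0n.
rewrite -[N.+1]addn1 natrD; move: (N%:R : R) x0 => x x0.
rewrite -subr_ge0.
have -> : D%:R^-1 - (x + 1)^-1 - (D%:R^-1 - x^-1 + (x + 1) ^- 2) =
    x^-1 * (x + 1) ^- 2.
  by move: (D%:R^-1 : R) => y; field; rewrite !gt_eqF // ltr_wpDr.
by rewrite mulr_ge0 // ?exprn_ge0 invr_ge0 ?exprn_ge0 ?addr_ge0 // ltW.
Qed.

Definition icoef_sum N : R := \sum_(1 <= d < N.+1) icoef d / d%:R ^+ 2.


Lemma icoef_sum_dist M N : (0 < M <= N)%N ->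
  `|icoef_sum N - icoef_sum M| <= M%:R^-1.
Proof.
move=> /andP[M0 MN]; rewrite /icoef_sum (big_cat_nat _ (n := M.+1)) //=.
rewrite addrAC subrr add0r; apply: le_trans (sum_inv_sqr_le N M0).
apply: le_trans (ler_norm_sum _ _ _) _; apply: ler_sum => d _.
rewrite normrM [X in _ * X]ger0_norm ?invr_ge0 ?exprn_ge0 //.
by rewrite ler_piMl ?icoef_norm // invr_ge0 exprn_ge0.
Qed.

(** The intervals of center icoef_sum M and radius 1 / M meet; their
    common point is zeta(3) / zeta(2), and the interval for M = 2 is positive. *)
Lemma icoef_sum_lim : exists2 k0 : R, 0 < k0 &
  forall M, (0 < M)%N -> `|k0 - icoef_sum M| <= M%:R^-1.
Proof.
pose E := [set icoef_sum N - N%:R^-1 | N in [set N | (0 < N)%N]].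
have ub M : (0 < M)%N -> ubound E (icoef_sum M + M%:R^-1).
  move=> M0 _ [N /= N0 <-]; case: (leqP M N) => MN.
    have := icoef_sum_dist (N := N) (M := M); rewrite M0 MN => /(_ isT).
    have : 0 <= N%:R^-1 :> R by rewrite invr_ge0.
    by rewrite ler_norml => ? /andP[]; lra.
  have := icoef_sum_dist (N := M) (M := N); rewrite N0 (ltnW MN) => /(_ isT).
  have : 0 <= M%:R^-1 :> R by rewrite invr_ge0.
  by rewrite ler_norml => ? /andP[]; lra.
have E0 : E !=set0 by exists (icoef_sum 1 - 1%:R^-1), 1%N.
have lb M : (0 < M)%N -> icoef_sum M - M%:R^-1 <= sup E.
  move=> M0; apply: ub_le_sup; last by exists M.
  by exists (icoef_sum 1 + 1%:R^-1); exact: ub.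
exists (sup E) => [|M M0].
  apply: lt_le_trans (lb 2%N isT).
  have -> : icoef_sum 2 = 1 + icoef 2 / 2%:R ^+ 2.
    by rewrite /icoef_sum big_ltn // big_nat1 icoef1 expr1n divr1.
  have := icoef_norm 2; rewrite ler_norml => /andP[h _].
  have -> : 1 + icoef 2 / 2%:R ^+ 2 - 2%:R^-1 = 2^-1 + icoef 2 / 4 :> R by field.
  lra.
rewrite ler_norml; have h1 := lb _ M0.
have h2 : sup E <= icoef_sum M + M%:R^-1 by apply: ge_sup => //; exact: ub.
by apply/andP; split; lra.
Qed.

End InverseDivisorSum.

(** * Exponential sums over the lattice points of a sector *)

Section LatticeSums.
Context {R : realType}.
Implicit Types (a b q e : R) (N : nat).

Lemma sum_expR_le b N : 0 < b ->
  b * (\sum_(1 <= j < N.+1) expR (- (b * j%:R))) <= 1 - expR (- (b * N%:R)).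
Proof.
move=> b0; elim: N => [|N IH].
  by rewrite big_nil !mulr0 oppr0 expR0 subrr.
rewrite big_nat_recr //= mulrDr; apply: le_trans (lerD IH (lexx _)) _.
have -> : - (b * N%:R) = - (b * N.+1%:R) + b.
  by rewrite -[N.+1]addn1 natrD; ring.
rewrite expRD; have := expR_ge1Dx b; have := expR_gt0 (- (b * N.+1%:R)).
nra.
Qed.

Lemma sum_expR_ge b N : 0 < b ->
  expR (- b) * (1 - expR (- (b * N%:R))) <=
  b * (\sum_(1 <= j < N.+1) expR (- (b * j%:R))).
Proof.
move=> b0; elim: N => [|N IH].
  by rewrite big_nil !mulr0 oppr0 expR0 subrr mulr0.
rewrite big_nat_recr //= [leRHS]mulrDr; apply: (le_trans _ (lerD IH (lexx _))).
have -> : - (b * N.+1%:R) = - (b * N%:R) + - b.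
  by rewrite -[N.+1]addn1 natrD; ring.
rewrite expRD; have := expR_ge1Dx (- b); have := expR_gt0 (- (b * N%:R)).
have := expR_gt0 (- b); set x := expR _; set y := expR _ => x0 y0 h.
have : 0 <= x * y * (b - 1 + x) by rewrite (mulr_ge0 (mulr_ge0 (ltW x0) (ltW y0))) //; lra.
lra.
Qed.

(** The terms kept are an initial segment, so that the sum is at
    most the integral of exp (- y) over [0, Q]. *)
Lemma sum_expR_le_cut b Q N : 0 < b -> 0 <= Q ->
  b * (\sum_(1 <= j < N.+1 | b * j%:R <= Q) expR (- (b * j%:R)))
  <= 1 - expR (- Q).
Proof.
move=> b0 Q0; elim: N => [|N IH].
  by rewrite big_nil mulr0 subr_ge0 expR_le1 oppr_le0.
rewrite big_mkcond big_nat_recr //= -big_mkcond.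
case: ifP => bQ; last by rewrite addr0.
apply: (@le_trans _ _ (1 - expR (- (b * N.+1%:R)))); last first.
  by rewrite lerD2l lerN2 ler_expR lerN2.
apply: le_trans (sum_expR_le N.+1 b0).
rewrite big_nat_recr //= ler_wpM2l ?(ltW b0) // lerD2r big_mkcond.
by apply: ler_sum => i _; case: ifP => // _; rewrite expR_ge0.
Qed.

Definition lsum (P : nat -> nat -> bool) a b N : R :=
  \sum_(1 <= i < N.+1) \sum_(1 <= j < N.+1 | P i j)
     expR (- (a * i%:R + b * j%:R)).

(** The lattice points below the line b x_2 = q a x_1, or above it if c
    is false. The slope q is relative to the coordinates a x_1 and b x_2, so
    that a common factor of a and b does not change the sector. *)
Definition sector q a b (c : bool) (i j : nat) : bool :=
  (b * j%:R <= q * a * i%:R) == c.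

(** The integral of exp (- u_1 - u_2) over the sector u_2 <= q u_1 of
    the quadrant, or over its complement. *)
Definition share q (c : bool) : R := if c then q / (1 + q) else (1 + q)^-1.

Lemma lsumE P a b N : lsum P a b N =
  \sum_(1 <= i < N.+1) expR (- (a * i%:R)) *
    \sum_(1 <= j < N.+1 | P i j) expR (- (b * j%:R)).
Proof.
apply: eq_bigr => i _; rewrite mulr_sumr; apply: eq_bigr => j _.
by rewrite opprD expRD.
Qed.

(** Summation over x_2 leaves the difference of two geometric
    series in x_1, of ratios exp (- a) and exp (- (1 + q) a). *)
Lemma lsum_sector_le q a b N : 0 < q -> 0 < a -> 0 < b ->
  a * b * lsum (fun i j => b * j%:R <= q * a * i%:R) a b N <= q / (1 + q) + a.
Proof.
move=> q0 a0 b0; have q1 : 0 < 1 + q by rewrite addr_gt0.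
rewrite lsumE -mulrA.
apply: (@le_trans _ _ (a * \sum_(1 <= i < N.+1)
    (expR (- (a * i%:R)) - expR (- ((1 + q) * a * i%:R))))).
  rewrite ler_wpM2l ?(ltW a0) // mulr_sumr; apply: ler_sum => i _.
  rewrite mulrCA.
  have -> : expR (- ((1 + q) * a * i%:R)) =
      expR (- (a * i%:R)) * expR (- (q * a * i%:R)).
    by rewrite -expRD; congr expR; ring.
  rewrite -{2}[expR (- (a * _))]mulr1 -mulrBr ler_wpM2l ?expR_ge0 //.
  by apply: sum_expR_le_cut; rewrite // !mulr_ge0 // ltW.
rewrite sumrB mulrBr.
have qa0 : 0 < (1 + q) * a by rewrite mulr_gt0.
have h1 := sum_expR_le N a0; have h2 := sum_expR_ge N qa0.
set S2 := \sum_(1 <= i < _) expR (- ((1 + q) * _ * _)) in h2 *.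
set X := expR (- (a * N%:R)) in h1.
have h3 : expR (- ((1 + q) * a * N%:R)) <= X.
  rewrite ler_expR lerN2 -mulrA ler_peMl ?mulr_ge0 // ?ltW //; lra.
have X0 : 0 <= X by rewrite expR_ge0.
have h4 : a * S2 >= (1 - (1 + q) * a) * (1 - X) / (1 + q).
  rewrite ler_pdivrMr //.
  have -> : a * S2 * (1 + q) = (1 + q) * a * S2 by ring.
  apply: (le_trans _ h2).
  have X1 : X <= 1 by rewrite /X expR_le1 oppr_le0 mulr_ge0 // ltW.
  have e1 := expR_ge1Dx (- ((1 + q) * a)).
  have e0 := expR_ge0 (- ((1 + q) * a)).
  nra.
apply: (le_trans (lerB h1 h4)).
have -> : 1 - X - (1 - (1 + q) * a) * (1 - X) / (1 + q) =
  q / (1 + q) + a - X * (q / (1 + q) + a) by field; rewrite gt_eqF.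
by rewrite gerBl mulr_ge0 // addr_ge0 ?divr_ge0 // ltW.
Qed.

Lemma lsum_swap P a b N :
  lsum P a b N = lsum (fun i j => P j i) b a N.
Proof.
rewrite /lsum; under eq_bigr do rewrite big_mkcond.
rewrite exchange_big /=; apply: eq_bigr => i _; rewrite [RHS]big_mkcond.
by apply: eq_bigr => j _; rewrite addrC.
Qed.

Lemma le_lsum (P Q : nat -> nat -> bool) a b N : (forall i j, P i j -> Q i j) ->
  lsum P a b N <= lsum Q a b N.
Proof.
move=> PQ; apply: ler_sum => i _; rewrite [leLHS]big_mkcond [leRHS]big_mkcond.
apply: ler_sum => j _; case: ifP => [/PQ->//|_]; by case: ifP => // _; rewrite expR_ge0.
Qed.

(** Up to its boundary, the complement of a sector is a sector for
    the exchanged axes. *)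
Lemma lsum_share_le q a b c N : 0 < q -> 0 < a -> 0 < b ->
  a * b * lsum (sector q a b c) a b N <= share q c + (a + b).
Proof.
move=> q0 a0 b0; case: c.
  have := lsum_sector_le N q0 a0 b0.
  have -> : (fun i j : nat => b * j%:R <= q * a * i%:R) = sector q a b true.
    by apply/funext => i; apply/funext => j; rewrite /sector eqb_id.
  by move=> /=; lra.
rewrite lsum_swap [a * b]mulrC.
have qi0 : 0 < q^-1 by rewrite invr_gt0.
have := lsum_sector_le N qi0 b0 a0.
have -> : q^-1 / (1 + q^-1) = (1 + q)^-1.
  by field; rewrite !gt_eqF // addr_gt0.
move=> h; apply: (@le_trans _ _ ((1 + q)^-1 + b)); last by rewrite /=; lra.
apply: le_trans h; rewrite ler_wpM2l // ?mulr_ge0 ?(ltW a0) ?(ltW b0) //.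
apply: le_lsum => i j; rewrite /sector eqbF_neg -ltNge => /ltW.
rewrite -mulrA -ler_pdivlMl // => /le_trans; apply.
by rewrite mulrA.
Qed.

Lemma lsumC (P : nat -> nat -> bool) a b N :
  lsum P a b N + lsum (fun i j => ~~ P i j) a b N = lsum (fun _ _ => true) a b N.
Proof.
rewrite /lsum -big_split /=; apply: eq_bigr => i _.
by rewrite [RHS](bigID (P i)).
Qed.

Lemma lsum_sectorC q a b c N :
  lsum (sector q a b c) a b N + lsum (sector q a b (~~ c)) a b N =
  lsum (fun _ _ => true) a b N.
Proof.
rewrite -(lsumC (sector q a b c)); congr (_ + lsum _ _ _ _).
apply/funext => i; apply/funext => j; rewrite /sector.
by case: (_ <= _); case: c.
Qed.

Lemma lsumT_le a b N : 0 < a -> 0 < b ->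
  a * b * lsum (fun _ _ => true) a b N <= 1.
Proof.
move=> a0 b0; rewrite lsumE -mulr_suml mulrACA.
have h1 := sum_expR_le N a0; have h2 := sum_expR_le N b0.
rewrite -[leRHS](mulr1 1); apply: ler_pM.
- by rewrite mulr_ge0 ?(ltW a0) ?(ltW b0) // sumr_ge0 // => i _; rewrite expR_ge0.
- by rewrite mulr_ge0 ?(ltW a0) ?(ltW b0) // sumr_ge0 // => i _; rewrite expR_ge0.
- by apply: (le_trans h1); rewrite gerBl expR_ge0.
- by apply: (le_trans h2); rewrite gerBl expR_ge0.
Qed.

Lemma expR_decay a e : 0 < a -> 0 < e ->
  exists N0, forall N, (N0 <= N)%N -> expR (- (a * N%:R)) <= e.
Proof.
move=> a0 e0; exists (Num.bound (a * e)^-1) => N h.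
have ae : 0 < a * e by rewrite mulr_gt0.
have h1 : (a * e)^-1 < N%:R.
  apply: lt_le_trans (archi_boundP _) _; first by rewrite invr_ge0 ltW.
  by rewrite ler_nat.
have N0 : 0 < N%:R :> R by apply: lt_trans h1; rewrite invr_gt0.
rewrite expRN -[e]invrK lef_pV2 ?posrE ?invr_gt0 ?expR_gt0 //.
apply: le_trans (expR_ge1Dx _).
have : 1 < N%:R * (a * e) by rewrite -ltr_pdivrMr // div1r.
by rewrite -[e^-1]mul1r ler_pdivrMr //; lra.
Qed.

Lemma lsumT_ge a b e : 0 < a -> 0 < b -> 0 < e -> exists N0, forall N,
  (N0 <= N)%N -> 1 - (a + b) - e <= a * b * lsum (fun _ _ => true) a b N.
Proof.
move=> a0 b0 e0; have e2 : 0 < e / 2 by rewrite divr_gt0.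
have [N1 h1] := expR_decay a0 e2; have [N2 h2] := expR_decay b0 e2.
exists (maxn N1 N2) => N; rewrite geq_max => /andP[/h1 {}h1 /h2 {}h2].
rewrite lsumE -mulr_suml mulrACA.
have {}h1 : 1 - a - e / 2 <= a * (\sum_(1 <= j < N.+1) expR (- (a * j%:R))).
  apply: le_trans (sum_expR_ge N a0).
  have := expR_ge1Dx (- a); have : expR (- a) <= 1 by rewrite expR_le1 oppr_le0 ltW.
  have := expR_ge0 (- (a * N%:R)).
  by move: h1; set x := expR _; set y := expR _; nra.
have {}h2 : 1 - b - e / 2 <= b * (\sum_(1 <= j < N.+1) expR (- (b * j%:R))).
  apply: le_trans (sum_expR_ge N b0).
  have := expR_ge1Dx (- b); have : expR (- b) <= 1 by rewrite expR_le1 oppr_le0 ltW.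
  have := expR_ge0 (- (b * N%:R)).
  by move: h2; set x := expR _; set y := expR _; nra.
have A0 : 0 <= a * (\sum_(1 <= j < N.+1) expR (- (a * j%:R))).
  by rewrite mulr_ge0 ?(ltW a0) ?(ltW b0) // sumr_ge0 // => i _; rewrite expR_ge0.
have B0 : 0 <= b * (\sum_(1 <= j < N.+1) expR (- (b * j%:R))).
  by rewrite mulr_ge0 ?(ltW a0) ?(ltW b0) // sumr_ge0 // => i _; rewrite expR_ge0.
have A1 := sum_expR_le N a0; have B1 := sum_expR_le N b0.
have := expR_ge0 (- (a * N%:R)); have := expR_ge0 (- (b * N%:R)).
move: A0 B0 A1 B1 h1 h2; set A := a * _; set B := b * _.
set x := expR _; set y := expR _ => A0 B0 A1 B1 h1 h2 x0 y0.
have : 0 <= (1 - A) * (1 - B) by rewrite mulr_ge0; lra.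
lra.
Qed.

Lemma share_sum q c : 0 < q -> share q c + share q (~~ c) = 1.
Proof.
by move=> q0; case: c; rewrite /share /=; field; rewrite gt_eqF // addr_gt0.
Qed.

Lemma share_itv q c : 0 < q -> 0 <= share q c <= 1.
Proof.
move=> q0; have : forall c, 0 <= share q c.
  by case; rewrite /share ?divr_ge0 ?invr_ge0 ?addr_ge0 // ltW.
by move=> h; have := h c; have := h (~~ c); have := share_sum c q0; lra.
Qed.

(** The upper bounds for a sector and for its complement add up to the
    asymptotic value of the full sum, so that both are attained. *)
Lemma lsum_share q a b e : 0 < q -> 0 < a -> 0 < b -> 0 < e ->
  exists N0, forall N c, (N0 <= N)%N ->
  `|a * b * lsum (sector q a b c) a b N - share q c| <= 2 * (a + b) + e.
Proof.
move=> q0 a0 b0 e0; have [N0 h] := lsumT_ge a0 b0 e0; exists N0 => N c /h {}h.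
have h1 := lsum_share_le c N q0 a0 b0.
have h2 := lsum_share_le (~~ c) N q0 a0 b0.
have h3 := share_sum c q0.
move: h; rewrite -(lsum_sectorC q a b c) mulrDr => h.
rewrite ler_norml; apply/andP; split; lra.
Qed.

Definition wsum (P : nat -> nat -> bool) a b N : R :=
  \sum_(1 <= i < N.+1) \sum_(1 <= j < N.+1 | P i j)
     expR (- (a * i%:R + b * j%:R)) / (gcdn i j)%:R.

Lemma sector_scale q a b c d i j : (0 < d)%N ->
  sector q a b c (d * i) (d * j) = sector q (d%:R * a) (d%:R * b) c i j.
Proof.
move=> d0; rewrite /sector !natrM; congr (_ == c).
by congr (_ <= _); ring.
Qed.

Lemma sector_homog q a b c k i j : (0 < k)%N ->
  sector q a b c (k * i) (k * j) = sector q a b c i j.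
Proof.
move=> k0; rewrite /sector !natrM; congr (_ == c).
by rewrite !(mulrCA _ k%:R) ler_pM2l // ltr0n.
Qed.

(** The factor 1 / gcd is a sum of icoef d over the common divisors d of
    the coordinates; the points divisible by d form the same sector again,
    dilated by d. *)
Lemma wsumE q a b c N : wsum (sector q a b c) a b N =
  \sum_(1 <= d < N.+1) icoef d *
    lsum (sector q (d%:R * a) (d%:R * b) c) (d%:R * a) (d%:R * b) (N %/ d).
Proof.
pose F d i j : R := if [&& sector q a b c i j, (d %| i)%N & (d %| j)%N] then
   icoef d * expR (- (a * i%:R + b * j%:R)) else 0.
transitivity (\sum_(1 <= i < N.+1) \sum_(1 <= j < N.+1)
    \sum_(1 <= d < N.+1) F d i j).
  rewrite /wsum big_nat [RHS]big_nat; apply: eq_bigr => i /andP[i0 iN].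
  rewrite big_mkcond big_nat [RHS]big_nat; apply: eq_bigr => j /andP[j0 jN].
  rewrite /F; case: ifP => sij; last by rewrite big1.
  have g0 : (0 < gcdn i j <= N)%N.
    by rewrite gcdn_gt0 i0 /= -ltnS (leq_ltn_trans _ iN) // dvdn_leq ?dvdn_gcdl.
  rewrite -(@sum_icoef R _ _ g0) mulrC mulr_suml [LHS]big_mkcond.
  by apply: eq_bigr => d _; rewrite dvdn_gcd.
transitivity (\sum_(1 <= d < N.+1) \sum_(1 <= i < N.+1) \sum_(1 <= j < N.+1)
    F d i j).
  rewrite exchange_big /= [RHS]exchange_big /=.
  under [RHS]eq_bigr do rewrite exchange_big /=.
  rewrite exchange_big /=.
  by apply: eq_bigr => i _; rewrite exchange_big.
rewrite big_nat [RHS]big_nat; apply: eq_bigr => d /andP[d0 dN].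
transitivity (\sum_(1 <= i < N.+1 | (d %| i)%N)
    \sum_(1 <= j < N.+1 | (d %| j)%N)
      if sector q a b c i j then icoef d * expR (- (a * i%:R + b * j%:R)) else 0).
  rewrite [RHS]big_mkcond; apply: eq_bigr => i _; rewrite /F.
  case: ifP => di; last by rewrite big1 // => j _; rewrite andbF.
  rewrite [RHS]big_mkcond; apply: eq_bigr => j _.
  by case: sector => //=; case: ifP.
rewrite big_nat_dvd // /lsum mulr_sumr; apply: eq_bigr => i _.
rewrite big_nat_dvd // mulr_sumr [RHS]big_mkcond; apply: eq_bigr => j _.
rewrite sector_scale //; case: ifP => // _.
by congr (_ * expR (- _)); rewrite !natrM; ring.
Qed.

Lemma lsum_ge0 P a b N : 0 <= lsum P a b N.
Proof.
by apply: sumr_ge0 => i _; apply: sumr_ge0 => j _; rewrite expR_ge0.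
Qed.

(** The divisor d contributes icoef d / d^2 times share q c in the
    limit, and the divisors above D contribute at most 1 / D together. *)
Lemma wsum_share : exists2 k0 : R, 0 < k0 & forall q e, 0 < q -> 0 < e ->
  exists2 delta, 0 < delta & forall a b, 0 < a < delta -> 0 < b < delta ->
  exists N0, forall N c, (N0 <= N)%N ->
  `|a * b * wsum (sector q a b c) a b N - k0 * share q c| <= e.
Proof.
have [k0 k00 k0P] := @icoef_sum_lim R; exists k0 => // q e q0 e0.
pose D := (Num.bound (4 / e)).+1.
have De : 4 / e <= D%:R.
  apply: ltW; apply: lt_le_trans (archi_boundP _) _.
    by rewrite divr_ge0 // ltW.
  by rewrite ler_nat.
have D0 : 0 < D%:R :> R by rewrite ltr0n.
have Di : D%:R^-1 <= e / 4.
  by rewrite -[leRHS]invrK lef_pV2 ?posrE ?invr_gt0 ?divr_gt0 // invf_div.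
(* Below this bound each of the D first divisors is off by at most e / (2 D). *)
pose delta := e / (16 * D%:R ^+ 2).
have delta0 : 0 < delta by rewrite divr_gt0 // mulr_gt0 ?exprn_gt0.
exists delta => // a b /andP[a0 a1] /andP[b0 b1].
pose e' := e / (4 * D%:R); have e'0 : 0 < e' by rewrite divr_gt0 // mulr_gt0.
pose T d N c := (d%:R * a) * (d%:R * b) *
  lsum (sector q (d%:R * a) (d%:R * b) c) (d%:R * a) (d%:R * b) N.
have /choice[f hf] : forall d, exists M, (0 < d)%N -> forall N c, (M <= N)%N ->
    `|T d N c - share q c| <= 2 * (d%:R * a + d%:R * b) + e'.
  move=> d; case: (posnP d) => [|d0]; first by exists 0%N.
  have dR : 0 < d%:R :> R by rewrite ltr0n.
  have [M hM] := lsum_share q0 (mulr_gt0 dR a0) (mulr_gt0 dR b0) e'0.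
  by exists M.
exists (maxn D (\max_(d < D.+1) (d * f d)))%N => N c.
rewrite geq_max => /andP[DN /bigmax_leqP fN].
have T01 d M : (0 < d)%N -> 0 <= T d M c <= 1.
  move=> d0; have dR : 0 < d%:R :> R by rewrite ltr0n.
  have da := mulr_gt0 dR a0; have db := mulr_gt0 dR b0.
  rewrite /T (mulr_ge0 (mulr_ge0 (ltW da) (ltW db)) (lsum_ge0 _ _ _ _)) /=.
  apply: le_trans (lsumT_le M da db).
  by rewrite ler_wpM2l ?(mulr_ge0 (ltW da) (ltW db)) // le_lsum.
have -> : a * b * wsum (sector q a b c) a b N - k0 * share q c =
  \sum_(1 <= d < D.+1) icoef d / d%:R ^+ 2 * (T d (N %/ d)%N c - share q c) +
  (\sum_(D.+1 <= d < N.+1) icoef d / d%:R ^+ 2 * T d (N %/ d)%N c +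
   (icoef_sum D - k0) * share q c).
  rewrite wsumE mulr_sumr.
  have -> : \sum_(1 <= d < N.+1) a * b * (icoef d *
      lsum (sector q (d%:R * a) (d%:R * b) c) (d%:R * a) (d%:R * b) (N %/ d)) =
      \sum_(1 <= d < N.+1) icoef d / d%:R ^+ 2 * T d (N %/ d)%N c.
    rewrite big_nat [RHS]big_nat; apply: eq_bigr => d /andP[d0 _].
    rewrite /T; move: (lsum _ _ _ _) (icoef d) => x y.
    by field; rewrite pnatr_eq0 -lt0n.
  rewrite (big_cat_nat _ (n := D.+1)) //=.
  under [in RHS]eq_bigr do rewrite mulrBr.
  rewrite sumrB -mulr_suml -/(icoef_sum D); ring.
have cn d : `|icoef d / d%:R ^+ 2| <= d%:R ^- 2 :> R.
  rewrite normrM [X in _ * X]ger0_norm ?invr_ge0 ?exprn_ge0 //.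
  by rewrite ler_piMl ?icoef_norm // invr_ge0 exprn_ge0.
apply: le_trans (ler_normD _ _) _.
apply: le_trans (lerD (lexx _) (ler_normD _ _)) _.
have b1' : `|\sum_(1 <= d < D.+1)
    icoef d / d%:R ^+ 2 * (T d (N %/ d)%N c - share q c)| <= e / 2.
  apply: le_trans (ler_norm_sum _ _ _) _.
  apply: (@le_trans _ _ (\sum_(1 <= d < D.+1) (e / (2 * D%:R)))).
    rewrite big_nat [leRHS]big_nat; apply: ler_sum => d /andP[d0 dD].
    rewrite normrM.
    have dR : 1 <= d%:R :> R by rewrite ler1n.
    have c1 : `|icoef d / d%:R ^+ 2| <= 1 :> R.
      apply: le_trans (cn d) _; rewrite invf_le1 ?exprn_ege1 //.
      by rewrite exprn_gt0 // (lt_le_trans _ dR).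
    rewrite -[leRHS]mul1r; apply: ler_pM => //.
    have fd : (f d <= N %/ d)%N.
      rewrite leq_divRL // mulnC.
      exact: (fN (Ordinal dD)).
    apply: le_trans (hf d d0 _ c fd) _.
    have dD' : d%:R <= D%:R :> R by rewrite ler_nat.
    have h : d%:R * a + d%:R * b <= D%:R * (2 * delta).
      rewrite -mulrDr; apply: ler_pM => //; last by lra.
      by rewrite addr_ge0 // ltW.
    have -> : e / (2 * D%:R) = 2 * (D%:R * (2 * delta)) + e'.
      by rewrite /delta /e'; field; rewrite gt_eqF.
    by lra.
  rewrite sumr_const_nat subn1 succnK -[_ *+ D]mulr_natr.
  suff -> : e / (2 * D%:R) * D%:R = e / 2 by [].
  by field; rewrite gt_eqF.
have b2' : `|\sum_(D.+1 <= d < N.+1) icoef d / d%:R ^+ 2 * T d (N %/ d)%N c|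
    <= e / 4.
  apply: le_trans Di; apply: le_trans (sum_inv_sqr_le N (isT : (0 < D)%N)).
  apply: le_trans (ler_norm_sum _ _ _) _.
  rewrite big_nat [leRHS]big_nat; apply: ler_sum => d /andP[d0 _].
  rewrite normrM -[leRHS]mulr1; apply: ler_pM => //.
  have /andP[h1 h2] := T01 d (N %/ d)%N (leq_trans (isT : (0 < D.+1)%N) d0).
  by rewrite ger0_norm.
have b3' : `|(icoef_sum D - k0) * share q c| <= e / 4.
  rewrite normrM distrC; have /andP[s0 s1] := share_itv c q0.
  rewrite (ger0_norm s0) -[leRHS]mulr1; apply: ler_pM => //.
  by apply: le_trans (k0P D _) Di.
lra.
Qed.

End LatticeSums.

(** * Partition functions over coprime pairs *)

Definition prim N := {x : 'I_N.+1 * 'I_N.+1 | coprime x.1 x.2}.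

Definition dir N (x : prim N) : nat * nat := (nat_of_ord (val x).1, nat_of_ord (val x).2).

Arguments dir : simpl never.

Definition offaxis N (x : prim N) : bool := (0 < (dir x).1)%N && (0 < (dir x).2)%N.

Lemma coprime_dir N (x : prim N) : coprime (dir x).1 (dir x).2.
Proof. by case: x. Qed.

Lemma dir_le N (x : prim N) : ((dir x).1 <= N)%N && ((dir x).2 <= N)%N.
Proof. by rewrite -!(ltnS _ N) !ltn_ord. Qed.

Lemma dir_inj N : injective (@dir N).
Proof.
by move=> x y [h1 h2]; apply: val_inj; apply: injective_projections; apply: val_inj.
Qed.

Lemma dirP N i j : coprime i j -> (i <= N)%N -> (j <= N)%N ->
  exists x : prim N, dir x = (i, j).
Proof.
rewrite -!(ltnS _ N) => cij iN jN.
by exists (exist _ (Ordinal iN, Ordinal jN) cij).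
Qed.

Section Products.
Context {R : realType}.
Implicit Types (r a b q e : R) (N K : nat).

Lemma big_nat1_ord (V : nmodType) N L (P : pred nat) (F : nat -> V) : (N <= L)%N ->
  \sum_(1 <= i < N.+1 | P i) F i = \sum_(i < L.+1 | (0 < i <= N)%N && P i) F i.
Proof.
move=> NL; rewrite big_geq_mkord (big_ord_widen_cond L.+1
  (fun i => P i && (0 < i)%N) F) ?ltnS //.
by apply: eq_bigl => i; rewrite ltnS; case: (P i); case: (0 < i)%N; rewrite ?andbT ?andbF.
Qed.

Lemma big_nat1_pair N L (P : nat -> nat -> bool) (F : nat -> nat -> R) : (N <= L)%N ->
  \sum_(1 <= i < N.+1) \sum_(1 <= j < N.+1 | P i j) F i j =
  \sum_(y : 'I_L.+1 * 'I_L.+1 | [&& (0 < y.1 <= N)%N, (0 < y.2 <= N)%N & P y.1 y.2])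
     F y.1 y.2.
Proof.
move=> NL; rewrite (big_nat1_ord _ _ NL).
under eq_bigr do rewrite (big_nat1_ord _ _ NL).
by rewrite pair_big_dep /=; apply: eq_bigl => y; rewrite andbT.
Qed.

(** Every lattice point of the open quadrant is uniquely a multiple k x of a
    primitive one, with k its gcd. *)
Section Multiples.
Variables (N M : nat) (P : nat -> nat -> bool) (F : nat -> nat -> R).
Hypothesis PM : forall k i j, (0 < k)%N -> P (k * i) (k * j) = P i j.
Hypothesis F0 : forall i j, 0 <= F i j.

Let L := (N * M)%N.
Let mulp (u : prim N * 'I_M.+1) : 'I_L.+1 * 'I_L.+1 :=
  (inord (u.2 * (dir u.1).1), inord (u.2 * (dir u.1).2)).
Let A := [set u : prim N * 'I_M.+1 | [&& offaxis u.1, (0 < u.2)%N &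
  P (dir u.1).1 (dir u.1).2]]%SET.

Let mulpE u : ((mulp u).1 = (u.2 * (dir u.1).1)%N :> nat) *
  ((mulp u).2 = (u.2 * (dir u.1).2)%N :> nat).
Proof.
have /andP[h1 h2] := dir_le u.1; have h := ltn_ord u.2.
by rewrite /mulp /= !inordK // ltnS mulnC leq_mul.
Qed.

Let gcd_mulp u : gcdn (mulp u).1 (mulp u).2 = u.2.
Proof. by rewrite !mulpE -muln_gcdr (eqP (coprime_dir _)) muln1. Qed.

Let mulp_inj : {in A &, injective mulp}.
Proof.
move=> u v; rewrite !inE => /and3P[_ u0 _] _ E.
have k : u.2 = v.2 :> nat by rewrite -gcd_mulp E gcd_mulp.
have h1 : (u.2 * (dir u.1).1)%N = (v.2 * (dir v.1).1)%N by rewrite -!mulpE E.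
have h2 : (u.2 * (dir u.1).2)%N = (v.2 * (dir v.1).2)%N by rewrite -!mulpE E.
apply: injective_projections; last exact: val_inj.
apply: dir_inj; apply: injective_projections; apply/eqP.
  by rewrite -(eqn_pmul2l u0) h1 k.
by rewrite -(eqn_pmul2l u0) h2 k.
Qed.

Let G (y : 'I_L.+1 * 'I_L.+1) := F y.1 y.2 / (gcdn y.1 y.2)%:R.

Let sum_mulp :
  \sum_(x : prim N | offaxis x && P (dir x).1 (dir x).2)
     \sum_(1 <= k < M.+1) F (k * (dir x).1) (k * (dir x).2) / k%:R =
  \sum_(y in mulp @: A) G y.
Proof.
rewrite big_imset //=.
under [LHS]eq_bigr do rewrite (big_nat1_ord xpredT _ (leqnn M)).
rewrite pair_big_dep /=; apply: eq_big => [u|u _].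
  by rewrite inE -(ltnS _ M) ltn_ord !andbT -andbA; congr (_ && _); rewrite andbC.
by rewrite /G gcd_mulp !mulpE.
Qed.

Let G0 y : 0 <= G y. Proof. by rewrite divr_ge0. Qed.

Lemma sum_multiples_le L' : (N * M <= L')%N ->
  \sum_(x : prim N | offaxis x && P (dir x).1 (dir x).2)
     \sum_(1 <= k < M.+1) F (k * (dir x).1) (k * (dir x).2) / k%:R <=
  \sum_(1 <= i < L'.+1) \sum_(1 <= j < L'.+1 | P i j) F i j / (gcdn i j)%:R.
Proof.
move=> LL.
apply: (@le_trans _ _ (\sum_(1 <= i < L.+1) \sum_(1 <= j < L.+1 | P i j)
  F i j / (gcdn i j)%:R)); last first.
  rewrite (big_nat1_pair _ _ LL) (big_nat1_pair _ _ (leqnn L')).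
  rewrite big_mkcond [leRHS]big_mkcond; apply: ler_sum => y _.
  case: ifP => [/and3P[/andP[h1 _] /andP[h2 _] ->]|_].
    by rewrite h1 h2 -!(ltnS _ L') !ltn_ord.
  by case: ifP => // _; rewrite divr_ge0.
rewrite sum_mulp (big_nat1_pair _ _ (leqnn L)).
rewrite big_mkcond [leRHS]big_mkcond; apply: ler_sum => y _.
case: ifP => [/imsetP[u]|_]; last by case: ifP => // _; rewrite divr_ge0.
rewrite inE => /and3P[/andP[x1 x2] k0 Pu] ->.
move: (mulpE u); move: (mulp u) => v [h1 h2].
rewrite -!(ltnS _ L) !ltn_ord [X in P X]h1 [X in P _ X]h2 PM // Pu.
by rewrite /G h1 h2 !muln_gt0 x1 x2 k0.
Qed.

Lemma sum_multiples_ge : M = N ->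
  \sum_(1 <= i < N.+1) \sum_(1 <= j < N.+1 | P i j) F i j / (gcdn i j)%:R <=
  \sum_(x : prim N | offaxis x && P (dir x).1 (dir x).2)
     \sum_(1 <= k < M.+1) F (k * (dir x).1) (k * (dir x).2) / k%:R.
Proof.
move=> MN; rewrite sum_mulp.
have NL : (N <= L)%N by rewrite /L MN; nia.
rewrite (big_nat1_pair _ _ NL) big_mkcond [leRHS]big_mkcond.
apply: ler_sum => y _; case: ifP => [|_]; last by case: ifP.
case/and3P => /andP[h1 h1'] /andP[h2 h2'] Py.
case: ifP => // /negP[]; apply/imsetP.
pose g := gcdn y.1 y.2; have g0 : (0 < g)%N by rewrite gcdn_gt0 h1.
have gN : (g <= N)%N by rewrite (leq_trans _ h1') // dvdn_leq // dvdn_gcdl.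
have e1 : (g * (y.1 %/ g))%N = y.1 by rewrite mulnC divnK // dvdn_gcdl.
have e2 : (g * (y.2 %/ g))%N = y.2 by rewrite mulnC divnK // dvdn_gcdr.
have cg : coprime (y.1 %/ g) (y.2 %/ g).
  by rewrite /coprime -(eqn_pmul2l g0) muln_gcdr e1 e2 muln1.
have [x dx] := dirP cg (leq_trans (leq_div _ _) h1') (leq_trans (leq_div _ _) h2').
have gM : (g < M.+1)%N by rewrite MN.
exists (x, Ordinal gM).
  rewrite inE /offaxis dx g0 -(PM _ _ g0) /= e1 e2 Py.
  by rewrite -(ltn_pmul2l g0) muln0 e1 h1 -(ltn_pmul2l g0) muln0 e2 h2.
by apply: injective_projections; apply: val_inj; rewrite [RHS]mulpE dx ?e1 ?e2.
Qed.

End Multiples.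

(** The factor of the direction x in the partition function tilted by
    (a, b), with multiplicities at most K. *)
Definition zfac r K a b N (x : prim N) : R :=
  (bpoly r K).[expR (- (a * (dir x).1%:R + b * (dir x).2%:R))].

Lemma expR_itv a b i j : 0 < a -> 0 < b -> (0 < i)%N ->
  0 <= expR (- (a * i%:R + b * j%:R)) <= expR (- a).
Proof.
move=> a0 b0 i0; rewrite expR_ge0 ler_expR lerN2.
have : 1 <= i%:R :> R by rewrite ler1n.
have : 0 <= j%:R :> R by [].
nra.
Qed.

Lemma lpoly_expR M a b (i j : nat) :
  (lpoly M).[expR (- (a * i%:R + b * j%:R))] =
  \sum_(1 <= k < M.+1) expR (- (a * (k * i)%:R + b * (k * j)%:R)) / k%:R.
Proof.
rewrite lpolyE; apply: eq_bigr => k _; rewrite -expRM_natl.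
by congr (expR _ / _); rewrite !natrM; ring.
Qed.

(** As - ln (1 - exp (- y)) is the sum of exp (- k y) / k over k, the
    logarithm of the product is r times a sum over all multiples k x of
    the primitive x, which is wsum. *)
Lemma prod_zfac_le r q a b c N K e L0 : 0 < r -> 0 < a -> 0 < b -> 0 < e ->
  (forall L, (L0 <= L)%N -> wsum (sector q a b c) a b L <= e) ->
  forall e', 0 < e' ->
  \prod_(x : prim N | offaxis x && sector q a b c (dir x).1 (dir x).2)
     zfac r K a b x <= expR (r * e + e').
Proof.
move=> r0 a0 b0 e0 We e' e'0.
pose C : R := #|{: prim N}|%:R + 1.
have C0 : 0 < C by rewrite ltr_wpDl.
pose z := expR (- a); have z0 : 0 <= z by rewrite expR_ge0.
have z1 : z < 1 by rewrite /z expR_lt1 oppr_lt0.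
have z1' : 0 < 1 - z by rewrite subr_gt0.
have [M hM] := expR_decay a0 (divr_gt0 (mulr_gt0 e'0 z1') (mulr_gt0 r0 C0)).
have {hM} zM : r * z ^+ M.+1 / (1 - z) <= e' / C.
  have := hM M (leqnn M); rewrite mulrC -mulrN expRM_natl -/z => h.
  apply: (@le_trans _ _ (r * z ^+ M / (1 - z))).
    rewrite ler_pM2r ?invr_gt0 // ler_pM2l // exprS ler_piMl ?exprn_ge0 //.
    exact: ltW.
  rewrite ler_pdivrMr // mulrC -ler_pdivlMr //; apply: (le_trans h).
  rewrite le_eqVlt; apply/orP; left; apply/eqP.
  by move: (1 - z) => w; field; rewrite !gt_eqF.
apply: (@le_trans _ _ (\prod_(x : prim N | offaxis x && sector q a b c (dir x).1 (dir x).2)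
   expR (r * (lpoly M).[expR (- (a * (dir x).1%:R + b * (dir x).2%:R))] + e' / C))).
  apply: ler_prod => x /andP[/andP[x1 x2] _].
  have /andP[w0 wz] := expR_itv (dir x).2 a0 b0 x1.
  rewrite ltW ?bpoly_gt0 //=; apply: le_trans (bpoly_le K M r0 _) _.
    by rewrite w0 (le_lt_trans wz).
  rewrite ler_expR lerD2l; apply: le_trans zM.
  rewrite -!mulrA ler_pM2l //; apply: ler_pM; rewrite ?exprn_ge0 //.
  - by rewrite invr_ge0 subr_ge0 (le_trans wz) // ltW.
  - by apply: lerXn2r.
  by rewrite lef_pV2 ?posrE ?subr_gt0 ?(le_lt_trans wz) // lerD2l lerN2.
rewrite -expR_sum ler_expR big_split /= -mulr_sumr; apply: lerD.
  rewrite ler_pM2l //; under eq_bigr do rewrite lpoly_expR.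
  have PM k i j : (0 < k)%N -> sector q a b c (k * i) (k * j) = sector q a b c i j.
    exact: sector_homog.
  pose L := maxn (N * M) L0.
  pose F (i j : nat) := expR (- (a * i%:R + b * j%:R)).
  have F0 i j : 0 <= F i j by exact: expR_ge0.
  apply: (le_trans (sum_multiples_le PM F0 (leq_maxl (N * M) L0))).
  by apply: We; exact: leq_maxr.
rewrite sumr_const -mulr_natr mulrAC ler_pdivrMr // ler_pM2l //.
apply: (@le_trans _ _ #|{: prim N}|%:R); first by rewrite ler_nat max_card.
by rewrite lerDl.
Qed.

Lemma prod_zfac_ge r a b N e : 0 < r -> 0 < a -> 0 < b -> 0 < e ->
  exists K0, forall K, (K0 <= K)%N ->
  expR (r * wsum (fun _ _ => true) a b N - e) <=
  \prod_(x : prim N | offaxis x) zfac r K a b x.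
Proof.
move=> r0 a0 b0 e0.
pose C : R := #|{: prim N}|%:R + 1.
have C0 : 0 < C by rewrite ltr_wpDl.
pose eta := e / C; have eta0 : 0 < eta by rewrite divr_gt0.
have u0 : 0 < 1 - expR (- eta) by rewrite subr_gt0 expR_lt1 oppr_lt0.
have /choice[f hf] : forall x : prim N, exists K0, offaxis x ->
    forall K, (K0 <= K)%N ->
    expR (- eta) * expR (r * (lpoly N).[expR (- (a * (dir x).1%:R + b * (dir x).2%:R))])
    <= zfac r K a b x.
  move=> x; case: (boolP (offaxis x)) => [/andP[x1 x2]|]; last by exists 0%N.
  have /andP[w0 wz] := expR_itv (dir x).2 a0 b0 x1.
  have w1 : expR (- (a * (dir x).1%:R + b * (dir x).2%:R)) < 1.
    by apply: (le_lt_trans wz); rewrite expR_lt1 oppr_lt0.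
  have [|K0 hK] := bpoly_ge N r0 _ u0 (z := expR (- (a * (dir x).1%:R + b * (dir x).2%:R))).
    by rewrite w0 w1.
  by exists K0 => _ K /hK; rewrite opprB addrCA subrr addr0.
exists (\max_(x : prim N) f x)%N => K /bigmax_leqP hK.
apply: (@le_trans _ _ (\prod_(x : prim N | offaxis x)
    expR (- eta + r * (lpoly N).[expR (- (a * (dir x).1%:R + b * (dir x).2%:R))]))); last first.
  apply: ler_prod => x xi; rewrite expR_ge0 /= expRD.
  by apply: hf => //; exact: hK.
rewrite -expR_sum ler_expR big_split /= -mulr_sumr addrC; apply: lerD; last first.
  rewrite sumr_const mulNrn lerN2 -mulr_natr /eta mulrAC ler_pdivrMr // ler_pM2l //.
  apply: (@le_trans _ _ #|{: prim N}|%:R); first by rewrite ler_nat max_card.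
  by rewrite lerDl.
rewrite ler_pM2l //; under eq_bigr do rewrite lpoly_expR.
under [leRHS]eq_bigl do rewrite -[offaxis _]andbT.
apply: (@sum_multiples_ge N N (fun _ _ => true)) => // i j; exact: expR_ge0.
Qed.

(** Together with offaxis_lower this determines kappa, which is
    r zeta(3) / zeta(2). *)
Definition sector_upper r kappa : Prop :=
  forall q e, 0 < q -> 0 < e -> exists2 delta, 0 < delta &
  forall a b, 0 < a < delta -> 0 < b < delta -> forall N K c,
  \prod_(x : prim N | offaxis x && sector q a b c (dir x).1 (dir x).2)
    zfac r K a b x <= expR ((kappa * share q c + e) / (a * b)).

Definition offaxis_lower r kappa : Prop :=
  forall e, 0 < e -> exists2 delta, 0 < delta &
  forall a b, 0 < a < delta -> 0 < b < delta ->
  exists N0, forall N, (N0 <= N)%N -> exists K0, forall K, (K0 <= K)%N ->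
  expR ((kappa - e) / (a * b)) <= \prod_(x : prim N | offaxis x) zfac r K a b x.

Theorem prod_zfac_asymp r : 0 < r -> exists2 kappa : R, 0 < kappa &
  sector_upper r kappa /\ offaxis_lower r kappa.
Proof.
move=> r0; have [k0 k00 H] := @wsum_share R.
exists (r * k0); first exact: mulr_gt0.
split=> [q e q0 e0|e e0].
  have e2 : 0 < e / (2 * r) by rewrite divr_gt0 // mulr_gt0.
  have [delta d0 {}H] := H q _ q0 e2; exists delta => // a b ha hb N K c.
  have [N0 {}H] := H a b ha hb.
  move: ha hb => /andP[a0 _] /andP[b0 _]; have ab0 := mulr_gt0 a0 b0.
  have /andP[s0 _] := share_itv c q0.
  have E0 : 0 < (k0 * share q c + e / (2 * r)) / (a * b).
    by rewrite divr_gt0 // ltr_wpDl // mulr_ge0 // ltW.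
  have e'0 : 0 < e / 2 / (a * b) by rewrite !divr_gt0.
  have -> : (r * k0 * share q c + e) / (a * b) =
      r * ((k0 * share q c + e / (2 * r)) / (a * b)) + e / 2 / (a * b).
    by field; rewrite !gt_eqF.
  apply: (@prod_zfac_le r q a b c N K _ N0) => // L /(H _ c).
  by rewrite ler_norml => /andP[_ h]; rewrite ler_pdivlMr //; lra.
have e2 : 0 < e / (4 * r) by rewrite divr_gt0 // mulr_gt0.
have [delta d0 {}H] := H 1 _ ltr01 e2; exists delta => // a b ha hb.
have [N0 {}H] := H a b ha hb.
move: ha hb => /andP[a0 _] /andP[b0 _]; have ab0 := mulr_gt0 a0 b0.
exists N0 => N hN.
have e'0 : 0 < e / 2 / (a * b) by rewrite !divr_gt0.
have [K0 hK] := prod_zfac_ge N r0 a0 b0 e'0.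
exists K0 => K /hK; apply: le_trans; rewrite ler_expR.
have -> : wsum (fun _ _ => true) a b N =
    wsum (sector 1 a b true) a b N + wsum (sector 1 a b false) a b N.
  rewrite /wsum -big_split /=; apply: eq_bigr => i _.
  rewrite (bigID (sector 1 a b true i)) /=; congr (_ + _).
  by apply: eq_bigl => j; rewrite /sector; case: (_ <= _).
have := H N true hN; have := H N false hN.
have ss : share 1 true + share 1 false = 1 :> R.
  exact: (share_sum true ltr01).
rewrite !ler_norml => /andP[h1 _] /andP[h2 _].
rewrite ler_pdivrMr // mulrBl mulfVK ?gt_eqF //.
move: h1 h2 ss; set W1 := wsum _ _ _ _; set W2 := wsum _ _ _ _.
set s1 := share _ true; set s2 := share _ false => h1 h2 ss.
have h3 : k0 - e / (2 * r) <= a * b * (W1 + W2).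
  have -> : k0 = k0 * (s1 + s2) by rewrite ss mulr1.
  have -> : e / (2 * r) = 2 * (e / (4 * r)) by field; rewrite gt_eqF.
  lra.
have : r * (k0 - e / (2 * r)) <= r * (a * b * (W1 + W2)) by rewrite ler_pM2l.
have -> : r * (k0 - e / (2 * r)) = r * k0 - e / 2 by field; rewrite gt_eqF.
lra.
Qed.

End Products.

(** * Convex lines and their edge vectors *)

Section EdgeVectors.
Context {R : realType}.
Implicit Types (u v w p : nat * nat) (vs G : seq (nat * nat)).

Definition polyline u vs : seq (nat * nat) := scanl +%R u vs.

Definition nslope v : \bar R := slope (embed R v).

Lemma embedD u v : embed R (u + v) = embed R u + embed R v.
Proof. by rewrite /embed /= !natrD. Qed.

Lemma embed0 : embed R 0 = 0.
Proof. by []. Qed.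

Lemma mulrn_pair v k : v *+ k = (v.1 * k, v.2 * k)%N.
Proof.
elim: k => [|k IH]; first by rewrite mulr0n !muln0.
by rewrite mulrSr IH !mulnSr.
Qed.

Lemma embed_eq0 v : (embed R v == 0) = (v == 0).
Proof.
by case: v => i j; rewrite /embed /= /eq_op /= !pnatr_eq0.
Qed.

Lemma edge_vec_polyline u vs :
  [seq edge_vec e | e <- zip (embed R u :: map (embed R) (polyline u vs))
                             (map (embed R) (polyline u vs))] =
  map (embed R) vs.
Proof.
elim: vs u => [|v vs IH] u //=; congr (_ :: _); last exact: IH.
by rewrite /edge_vec /= embedD addrAC subrr add0r.
Qed.

Lemma last_polyline u vs : last u (polyline u vs) = u + \sum_(v <- vs) v.
Proof.
elim: vs u => [|v vs IH] u /=; first by rewrite big_nil addr0.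
by rewrite big_cons IH addrA.
Qed.

Lemma embed_cases v : v != 0 ->
  (v.1 = 0%N /\ (0 < v.2)%N) \/ (0 < v.1)%N.
Proof.
case: v => [[|i] j] /= v0; [left|by right]; split=> //.
by case: j v0.
Qed.

Lemma angle_embed_itv v : v != 0 -> 0 <= angle (embed R v) <= pi / 2.
Proof.
move=> v0; rewrite /angle /embed /=.
have pi0 : 0 < pi / 2 :> R by rewrite divr_gt0 ?pi_gt0.
case: (embed_cases v0) => [[-> v2]|v1].
  by rewrite ltxx eqxx gtr0_sg ?ltr0n // mul1r lexx ltW.
rewrite ltr0n v1 (ltW (atan_ltpi2 _)) andbT -atan0.
case: (posnP v.2) => [->|v2]; first by rewrite mul0r.
by rewrite ltW // lt_atan // divr_gt0 ?ltr0n.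
Qed.

(** On the quadrant the angle is the arc tangent of the slope, the
    vertical direction having slope +oo. *)
Lemma angle_lt_slope v w : v != 0 -> w != 0 ->
  (angle (embed R v) < angle (embed R w)) = (nslope v < nslope w)%E.
Proof.
move=> v0 w0; rewrite /angle /nslope /slope /embed /=.
case: (embed_cases v0) => [[-> v2]|v1]; case: (embed_cases w0) => [[-> w2]|w1].
- by rewrite ltxx eqxx !gtr0_sg ?ltr0n // !ltxx.
- rewrite ltxx eqxx ltr0n w1 gtr0_sg ?ltr0n // mul1r pnatr_eq0 (gtn_eqF w1).
  by rewrite ltNge (ltW (atan_ltpi2 _)) /= ltNge leey.
- rewrite ltxx eqxx ltr0n v1 gtr0_sg ?ltr0n // mul1r pnatr_eq0 (gtn_eqF v1).
  by rewrite atan_ltpi2 ltry.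
- rewrite !ltr0n v1 w1 !pnatr_eq0 (gtn_eqF v1) (gtn_eqF w1) lte_fin.
  exact: (leW_mono (le_mono (@lt_atan R))).
Qed.

Lemma convex_polyline vs : convex_line R (polyline 0 vs) =
  all (fun v => v != 0) vs && sorted <%O (map nslope vs).
Proof.
rewrite /convex_line /lattice_edges /edges -embed0 edge_vec_polyline !all_map.
under eq_all => v /= do rewrite embed_eq0.
case: (boolP (all _ vs)) => //= vs0.
have -> : all (preim (embed R) (fun v : R * R => 0 <= angle v <= pi / 2)) vs.
  by apply/allP => v /(allP vs0) /=; exact: angle_embed_itv.
rewrite !sorted_map /=.
by apply: (eq_in_sorted _ vs0) => v w; exact: angle_lt_slope.
Qed.

Lemma convex_line_polyline G : convex_line R G -> exists vs, G = polyline 0 vs.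
Proof.
case/and3P => _ h _; move: h; rewrite /lattice_edges /edges -embed0.
move: (0 : nat * nat) => u; elim: G u => [|w G IH] u /=; first by exists [::].
case/andP => /angle_itv_ge0; rewrite /edge_vec /= !subr_ge0 !ler_nat.
case/andP => h1 h2 /IH[vs ->].
exists ((w.1 - u.1, w.2 - u.2)%N :: vs); rewrite /polyline /=.
have -> // : u + (w.1 - u.1, w.2 - u.2)%N = w.
by case: u w h1 h2 {IH} => u1 u2 [w1 w2] /= h1 h2; congr pair; exact: subnKC.
Qed.

(** The lattice points of an edge g x with x primitive are the
    j x with 0 < j <= g, relative to the left endpoint. *)
Lemma num_points_embed p v : v != 0 ->
  num_points (embed R p, embed R (p + v)) = gcdn v.1 v.2.
Proof.
move=> v0; rewrite /num_points.
pose g := gcdn v.1 v.2; pose x := (v.1 %/ g, v.2 %/ g)%N.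
have v12 : (0 < v.1)%N || (0 < v.2)%N.
  by case: (embed_cases v0) => [[_ ->]|->//]; rewrite orbT.
have g0 : (0 < g)%N by rewrite gcdn_gt0.
have e1 : (x.1 * g)%N = v.1 by rewrite divnK // dvdn_gcdl.
have e2 : (x.2 * g)%N = v.2 by rewrite divnK // dvdn_gcdr.
have cx : coprime x.1 x.2.
  by rewrite /coprime -(eqn_pmul2r g0) muln_gcdl e1 e2 mul1n.
have x20 : x.1 = 0%N -> x.2 = 1%N.
  by move=> x1; move: cx; rewrite x1 /coprime gcd0n => /eqP.
apply: card_fset_set.
have -> : lattice_points (embed R p, embed R (p + v)) =
    [set p + x *+ j.+1 | j in `I_g].
  apply/seteqP; split=> [z [s /andP[s0 s1]]|_ [j jg <-]].
    rewrite embedD /embed /= ![_ + _%:R - _]addrAC !subrr !add0r => -[z1 z2].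
    have h1 : (p.1 <= z.1)%N.
      by rewrite -(ler_nat R) z1 lerDl mulr_ge0 // ltW.
    have h2 : (p.2 <= z.2)%N.
      by rewrite -(ler_nat R) z2 lerDl mulr_ge0 // ltW.
    pose w := (z.1 - p.1, z.2 - p.2)%N.
    have w1 : w.1%:R = s * v.1%:R :> R by rewrite natrB // z1 addrAC subrr add0r.
    have w2 : w.2%:R = s * v.2%:R :> R by rewrite natrB // z2 addrAC subrr add0r.
    have l1 : (w.1 <= v.1)%N by rewrite -(ler_nat R) w1 ler_piMl.
    have l2 : (w.2 <= v.2)%N by rewrite -(ler_nat R) w2 ler_piMl.
    have cross : (w.1 * x.2 = w.2 * x.1)%N.
      apply/eqP; rewrite -(eqn_pmul2r g0) -!mulnA e1 e2 -(eqr_nat R) !natrM.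
      by rewrite w1 w2; apply/eqP; ring.
    have [j wj] : exists j, w = x *+ j.
      have /dvdnP[j wj1] : (x.1 %| w.1)%N.
        by rewrite -(Gauss_dvdl w.1 cx) cross dvdn_mull.
      case: (posnP x.1) => x1.
        exists w.2; rewrite mulrn_pair x1 (x20 x1) mul0n mul1n.
        by rewrite [LHS]surjective_pairing wj1 x1 muln0.
      exists j; rewrite mulrn_pair [LHS]surjective_pairing wj1 mulnC; congr pair.
      apply/eqP; rewrite -(eqn_pmul2r x1) -cross wj1; apply/eqP; nia.
    have j0 : (0 < j)%N.
      case: j wj => // /(f_equal (fun q => (q.1%:R, q.2%:R) : R * R)) /=.
      rewrite w1 w2 => -[/eqP h /eqP h']; move: h h'.
      rewrite !mulf_eq0 gt_eqF //= !pnatr_eq0 => /eqP h /eqP h'.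
      by rewrite h h' in v12.
    have jg : (j <= g)%N.
      move: l1 l2; rewrite wj mulrn_pair -e1 -e2; move: x20.
      move: (x.1) (x.2) => y1 y2 y20 /=.
      case: (posnP y1) => [/y20 -> _|y10 h _]; last by rewrite -(leq_pmul2l y10).
      by rewrite !mul1n.
    exists j.-1; first by rewrite /= prednK.
    rewrite prednK // -wj; apply: injective_projections => /=.
      exact: subnKC.
    exact: subnKC.
  exists (j.+1%:R / g%:R).
    by rewrite divr_gt0 ?ltr0n //= ler_pdivrMr ?ltr0n // mul1r ler_nat.
  have gR : g%:R != 0 :> R by rewrite pnatr_eq0 -lt0n.
  have E (y z : nat) : (y * g = z)%N ->
      (y * j.+1)%:R = j.+1%:R / g%:R * z%:R :> R.
    move=> <-; rewrite !natrM; move: (j.+1%:R : R) => J; by field.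
  rewrite !embedD mulrn_pair; apply: injective_projections => /=.
    by rewrite [_ + _ - _]addrAC subrr add0r -(E _ _ e1).
  by rewrite [_ + _ - _]addrAC subrr add0r -(E _ _ e2).
have finj : {in `I_g &, injective (fun j => p + x *+ j.+1)}.
  move=> j k _ _; rewrite !mulrn_pair => -[/addnI /eqP h1 /addnI /eqP h2].
  move: h1 h2; rewrite !eqn_mul2l => /orP[/eqP x1|/eqP[]//] /orP[/eqP x2|/eqP[]//].
  by have := x20 x1; rewrite /x /= x2.
rewrite card_eq_sym; apply/card_set_bijP; exists (fun j => p + x *+ j.+1).
by split=> // j jg; exists j.
Qed.
End EdgeVectors.

(** * Lines as multiplicities of primitive directions *)

Section LinesAndMultiplicities.
Context {R : realType}.
Implicit Types (n u v w : nat * nat) (N K : nat).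

Notation nslope := (@nslope R).

Lemma nslope_mulrn v k : (0 < k)%N -> nslope (v *+ k) = nslope v.
Proof.
move=> k0; rewrite /nslope /slope mulrn_pair /embed /= !pnatr_eq0 muln_eq0.
rewrite (gtn_eqF k0) orbF; case: eqP => // v1.
have kR : k%:R != 0 :> R by rewrite pnatr_eq0 -lt0n.
have vR : v.1%:R != 0 :> R by rewrite pnatr_eq0; apply/eqP.
by congr EFin; rewrite !natrM; field; rewrite kR vR.
Qed.

Lemma nslope_dir_inj N (x y : prim N) : nslope (dir x) = nslope (dir y) -> x = y.
Proof.
move=> E; apply: dir_inj; move: E (coprime_dir x) (coprime_dir y).
move: (dir x) (dir y) => [i j] [k l] /=; rewrite /nslope /slope /embed /= !pnatr_eq0.
case: eqP => [->|/eqP i0]; case: eqP => [->|/eqP k0] //.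
  by rewrite /coprime !gcd0n => _ /eqP -> /eqP ->.
move=> [/eqP]; rewrite eqr_div ?pnatr_eq0 // -!natrM eqr_nat => /eqP E cij ckl.
have ik : (i %| k)%N by rewrite -(Gauss_dvdr k cij) E dvdn_mull.
have ki : (k %| i)%N by rewrite -(Gauss_dvdr i ckl) -E dvdn_mull.
have ik' : i = k by apply/eqP; rewrite eqn_dvd ik ki.
congr pair => //; apply/eqP; rewrite -(eqn_pmul2r (m := k)) ?lt0n //.
by rewrite E ik'.
Qed.

Definition dirs N : seq (prim N) :=
  sort (fun x y => nslope (dir x) <= nslope (dir y))%E (enum {: prim N}).

Lemma mem_dirs N (x : prim N) : x \in dirs N.
Proof. by rewrite mem_sort mem_enum. Qed.

Lemma dirs_uniq N : uniq (dirs N).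
Proof. by rewrite sort_uniq enum_uniq. Qed.

Lemma nslope_lt_trans N :
  transitive (fun x y : prim N => nslope (dir x) < nslope (dir y))%E.
Proof. by move=> y x z; exact: lt_trans. Qed.

Lemma dirs_sorted N :
  sorted (fun x y : prim N => nslope (dir x) < nslope (dir y))%E (dirs N).
Proof.
have := @sorted_map _ _ (fun x : prim N => nslope (dir x)) <%O (dirs N).
rewrite /relpre => <-; rewrite lt_sorted_uniq_le map_inj_in_uniq ?dirs_uniq /=.
  by rewrite sorted_map; apply: sort_sorted => x y; exact: le_total.
by move=> x y _ _; exact: nslope_dir_inj.
Qed.

Section Line.
Variables (N K : nat).
Implicit Types (nu : {ffun prim N -> 'I_K.+1}) (x : prim N).

Definition support_dirs nu : seq (prim N) := [seq x <- dirs N | (0 < nu x)%N].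

Definition steps nu : seq (nat * nat) := [seq dir x *+ nu x | x <- support_dirs nu].

(** The directions of positive multiplicity are laid out in order of
    increasing slope. *)
Definition line nu : seq (nat * nat) := polyline 0 (steps nu).

Lemma dir_neq0 x : dir x != 0.
Proof.
have := coprime_dir x; case: (dir x) => i j /= h.
by apply/eqP => -[E1 E2]; rewrite E1 E2 in h.
Qed.

Lemma gcd_dir_mulrn x k : gcdn (dir x *+ k).1 (dir x *+ k).2 = k.
Proof. by rewrite mulrn_pair /= -muln_gcdl (eqP (coprime_dir x)) mul1n. Qed.

Lemma mulrn_dir_neq0 x k : (0 < k)%N -> dir x *+ k != 0.
Proof.
move=> k0; apply: contraTneq k0 => E.
by rewrite -(gcd_dir_mulrn x k) E.
Qed.

Lemma steps_neq0 nu : all (fun v => v != 0) (steps nu).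
Proof.
apply/allP => v /mapP[x]; rewrite mem_filter => /andP[x0 _] ->.
exact: mulrn_dir_neq0.
Qed.

Lemma steps_sorted nu : sorted <%O (map nslope (steps nu)).
Proof.
have -> : map nslope (steps nu) = map (fun x => nslope (dir x)) (support_dirs nu).
  rewrite -map_comp; apply/eq_in_map => x; rewrite mem_filter => /andP[x0 _] /=.
  exact: nslope_mulrn.
rewrite sorted_map; apply: sorted_filter; first exact: nslope_lt_trans.
exact: dirs_sorted.
Qed.

Lemma convex_line_line nu : convex_line R (line nu).
Proof. by rewrite convex_polyline steps_neq0 steps_sorted. Qed.

Lemma sum_support (V : nmodType) nu (P : pred (prim N)) (F : prim N -> V) :
  (forall x, nu x = 0%N :> nat -> F x = 0) ->
  \sum_(x <- support_dirs nu | P x) F x = \sum_(x | P x) F x.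
Proof.
move=> F0; rewrite big_filter_cond big_mkcond [RHS]big_mkcond.
rewrite (perm_big (index_enum (prim N))) /=; last first.
  by rewrite /dirs enumT perm_sort.
apply: eq_bigr => x _; case: (posnP (nu x)) => //= nx.
by rewrite F0 //; case: ifP.
Qed.

Definition endpoint nu : nat * nat := \sum_x dir x *+ nu x.

Lemma last_line nu : last 0 (line nu) = endpoint nu.
Proof.
rewrite last_polyline add0r big_map (@sum_support _ nu xpredT) // => x ->.
by rewrite mulr0n.
Qed.

Lemma weight_polyline (r : R) u vs : all (fun v => v != 0) vs ->
  \prod_(e <- zip (embed R u :: map (embed R) (polyline u vs))
       (map (embed R) (polyline u vs))) bcoef r (num_points e) =
  \prod_(v <- vs) bcoef r (gcdn v.1 v.2).
Proof.
elim: vs u => [|v vs IH] u /=; first by rewrite !big_nil.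
by case/andP => v0 vs0; rewrite !big_cons -(IH (u + v)) // num_points_embed.
Qed.

Lemma weight_line (r : R) nu : weight r (line nu) = \prod_x bcoef r (nu x) :> R.
Proof.
rewrite /weight /lattice_edges /edges -embed0 weight_polyline ?steps_neq0 //.
rewrite big_map; under eq_bigr do rewrite gcd_dir_mulrn.
rewrite big_filter big_mkcond (perm_big (index_enum (prim N))) /=; last first.
  by rewrite /dirs enumT perm_sort.
apply: eq_bigr => x _; case: (posnP (nu x)) => //= ->.
by rewrite bcoef0.
Qed.

Lemma steps_inj : injective steps.
Proof.
have key nu nu' x : steps nu = steps nu' -> (0 < nu x)%N -> nu x = nu' x.
  move=> E x0; have : dir x *+ nu x \in steps nu'.
    by rewrite -E; apply: map_f; rewrite mem_filter x0 mem_dirs.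
  case/mapP => y; rewrite mem_filter => /andP[y0 _] Exy.
  have k : nu x = nu' y.
    by apply: val_inj; rewrite /= -[LHS](gcd_dir_mulrn x) Exy gcd_dir_mulrn.
  suff xy : x = y by rewrite k xy.
  by apply: nslope_dir_inj; rewrite -(nslope_mulrn _ x0) Exy nslope_mulrn.
move=> nu nu' E; apply/ffunP => x; apply: val_inj => /=.
case: (posnP (nu x)) => [nx|/(key _ _ _ E) -> //].
by case: (posnP (nu' x)) => [->//|/(key _ _ _ (esym E)) ->].
Qed.

Lemma polyline_inj u : injective (polyline u).
Proof.
move=> vs; elim: vs u => [|v vs IH] u [|w ws] //=; rewrite /polyline /=.
move=> [/addnI E1 /addnI E2 h].
have vw : v = w by apply: injective_projections.
by subst w; congr cons; apply: IH h.
Qed.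

Lemma line_inj : injective line.
Proof. by move=> nu nu' /polyline_inj /steps_inj. Qed.

(** The multiplicity of x is the gcd of the coordinates of the edge in
    its direction; as slopes increase strictly, there is at most one such
    edge. The default value 0 of nth gives multiplicity 0 if there is none. *)
Lemma line_surj n G : (n.1 <= N)%N -> (n.2 <= N)%N -> (n.1 + n.2 <= K)%N ->
  Pi R n G -> exists nu, G = line nu.
Proof.
move=> n1 n2 nK [cG lG]; have [vs GE] := convex_line_polyline cG.
move: cG lG; rewrite {}GE convex_polyline last_polyline add0r => /andP[vs0 so] tot.
have le v : v \in vs -> (v.1 <= n.1)%N && (v.2 <= n.2)%N.
  move=> vvs; rewrite -tot (big_rem v) //=; by rewrite !leq_addr.
have uv v w : v \in vs -> w \in vs -> nslope v = nslope w -> v = w.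
  move=> vvs wvs E; have tr : transitive (relpre nslope <%O).
    by move=> y x z; exact: lt_trans.
  rewrite sorted_map in so; have mono := sorted_ltn_nth tr 0 so.
  rewrite -(nth_index 0 vvs) -(nth_index 0 wvs); congr nth.
  case: (ltngtP (index v vs) (index w vs)) => // h.
    have := mono (index v vs) (index w vs); rewrite !inE !index_mem.
    by move=> /(_ vvs wvs h); rewrite /= !nth_index // E ltxx.
  have := mono (index w vs) (index v vs); rewrite !inE !index_mem.
  by move=> /(_ wvs vvs h); rewrite /= !nth_index // E ltxx.
pose par x v := v == dir x *+ gcdn v.1 v.2.
pose m x := let v := nth 0 vs (find (par x) vs) in gcdn v.1 v.2.
have mP x : (0 < m x)%N -> dir x *+ m x \in vs.
  rewrite /m; case: (boolP (has (par x) vs)) => h.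
    by move=> _; rewrite -(eqP (nth_find 0 h)) mem_nth // -has_find.
  by rewrite nth_default //; move: h; rewrite has_find -leqNgt.
have mK x : (m x < K.+1)%N.
  rewrite ltnS; case: (posnP (m x)) => [->//|mx].
  have /andP[h1 h2] := le _ (mP _ mx); apply: leq_trans nK.
  have {}h1 : ((dir x).1 * m x <= n.1)%N by move: h1; rewrite mulrn_pair.
  have {}h2 : ((dir x).2 * m x <= n.2)%N by move: h2; rewrite mulrn_pair.
  case: (posnP (dir x).1) => [x1|x1].
    move: (coprime_dir x); rewrite x1 /coprime gcd0n => /eqP E.
    by rewrite E mul1n in h2; rewrite (leq_trans h2) // leq_addl.
  by rewrite (leq_trans _ (leq_addr _ _)) // (leq_trans _ h1) // leq_pmull.
have mV v : v \in vs -> exists2 x, v = dir x *+ m x & (0 < m x)%N.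
  move=> vvs; have v0 := allP vs0 _ vvs.
  pose g := gcdn v.1 v.2.
  have g0 : (0 < g)%N.
    by rewrite gcdn_gt0; case: (embed_cases v0) => [[_ ->]|->//]; rewrite orbT.
  have e1 : (v.1 %/ g * g)%N = v.1 by rewrite divnK // dvdn_gcdl.
  have e2 : (v.2 %/ g * g)%N = v.2 by rewrite divnK // dvdn_gcdr.
  have cx : coprime (v.1 %/ g) (v.2 %/ g).
    by rewrite /coprime -(eqn_pmul2r g0) muln_gcdl e1 e2 mul1n.
  have /andP[l1 l2] := le _ vvs.
  have [x dx] := dirP cx (leq_trans (leq_div _ _) (leq_trans l1 n1))
    (leq_trans (leq_div _ _) (leq_trans l2 n2)).
  have vE : v = dir x *+ g.
    by rewrite mulrn_pair dx /= e1 e2; case: (v).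
  have hx : has (par x) vs by apply/hasP; exists v; rewrite // /par -/g {1}vE.
  set w := nth 0 vs (find (par x) vs).
  have wvs : w \in vs by rewrite mem_nth // -has_find.
  have wE : w = dir x *+ gcdn w.1 w.2 := eqP (nth_find 0 hx).
  have w0 : (0 < gcdn w.1 w.2)%N.
    case: posnP => // E; have := allP vs0 _ wvs.
    by rewrite wE E mulr0n eqxx.
  have vw : v = w by apply: uv => //; rewrite vE wE !nslope_mulrn.
  by exists x; rewrite /m -/w // -wE vw.
exists [ffun x => Ordinal (mK x)]; congr polyline.
set nu := [ffun x => _].
have nuE x : nu x = m x :> nat by rewrite ffunE.
apply: (@irr_sorted_eq_in _ (fun v w => nslope v < nslope w)%E).
- by move=> v w z _ _ _; exact: lt_trans.
- by move=> v _; rewrite /= ltxx.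
- by rewrite sorted_map in so.
- by have := steps_sorted nu; rewrite sorted_map.
move=> v; apply/idP/mapP => [/mV[x -> mx]|[x]].
  have mx' : (0 < nu x)%N by rewrite nuE.
  by exists x; [rewrite mem_filter mem_dirs andbT|rewrite nuE].
rewrite mem_filter => /andP[nx _] ->.
have mx : (0 < m x)%N by rewrite -nuE.
by rewrite nuE; exact: mP.
Qed.

(** Bounds N and K compatible with the endpoint n make the
    multiplicities range over a finite type without losing any line. *)
Lemma sum_weight (r : R) n (A : set (seq (nat * nat))) :
  (n.1 <= N)%N -> (n.2 <= N)%N -> (n.1 + n.2 <= K)%N ->
  \sum_(G \in Pi R n `&` A) weight r G =
  \sum_(nu : {ffun prim N -> 'I_K.+1} | (endpoint nu == n) && `[< A (line nu) >])
    \prod_x bcoef r (nu x) :> R.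
Proof.
move=> n1 n2 nK.
rewrite (reindex_fsbig line
  [set` [pred nu : {ffun prim N -> 'I_K.+1} | (endpoint nu == n) && `[< A (line nu) >]]]).
  rewrite -(@bigfs _ _ _ _ (index_enum {ffun prim N -> 'I_K.+1})) ?index_enum_uniq //.
    by apply: eq_bigr => nu _; rewrite weight_line.
  by move=> nu _; rewrite mem_index_enum.
split.
- move=> nu /= /andP[/eqP tn /asboolP An]; split=> //.
  by split; [exact: convex_line_line|rewrite last_line].
- by move=> nu nu' _ _; exact: line_inj.
- move=> G [PG AG]; have [nu GE] := line_surj n1 n2 nK PG.
  rewrite {}GE in PG AG *; exists nu => //; apply/andP; split; last exact/asboolP.
  by rewrite -last_line; apply/eqP; case: PG.
Qed.

Section Tangent.
Variables (n : nat * nat) (n1 : (0 < n.1)%N) (n2 : (0 < n.2)%N).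

Definition nscale v : R * R := scale n (embed R v).

Lemma nscaleD v w : nscale (v + w) = nscale v + nscale w.
Proof. by rewrite /nscale /scale embedD /= !mulrDl. Qed.

Lemma slope_nscale_le v w : (nslope v <= nslope w)%E ->
  (slope (nscale v) <= slope (nscale w))%E.
Proof.
rewrite /nslope /slope /nscale /scale /embed /=.
have R1 : n.1%:R != 0 :> R by rewrite pnatr_eq0 -lt0n.
have R2 : n.2%:R != 0 :> R by rewrite pnatr_eq0 -lt0n.
rewrite !mulf_eq0 !invr_eq0 (negPf R1) !orbF !pnatr_eq0.
case: eqP => [_|/eqP v0]; case: eqP => [_|/eqP w0] //; rewrite ?leey //.
rewrite !lee_fin => h.
have E (i j : nat) : i != 0%N -> j%:R / n.2%:R / (i%:R / n.1%:R) =
    (j%:R / i%:R) * (n.1%:R / n.2%:R) :> R.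
  move=> i0; have iR : i%:R != 0 :> R by rewrite pnatr_eq0.
  by field; rewrite iR R1 R2.
by rewrite !E // ler_wpM2r // divr_ge0.
Qed.

(** As slopes increase along the line, the edges of scaled slope at
    most t form an initial segment of it. *)
Lemma xi_polyline u vs t : sorted <%O (map nslope vs) ->
  last (nscale u) [seq e.2 | e <- zip (nscale u :: map nscale (polyline u vs))
     (map nscale (polyline u vs)) & (slope (edge_vec e) <= t)%E] =
  nscale (u + \sum_(v <- vs | (slope (nscale v) <= t)%E) v).
Proof.
rewrite sorted_map; elim: vs u => [|v vs IH] u /= so.
  by rewrite big_nil addr0.
rewrite big_cons {1}/edge_vec /= nscaleD addrAC subrr add0r.
case: ifP => vt /=.
  by rewrite -nscaleD IH ?(path_sorted so) // addrA.
have no w : w \in vs -> (slope (nscale w) <= t)%E = false.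
  move=> wvs; apply/negbTE; rewrite -ltNge.
  have tv : (t < slope (nscale v))%E by rewrite ltNge vt.
  apply: (lt_le_trans tv); apply: slope_nscale_le; apply: ltW.
  have tr : transitive (relpre nslope <%O) by move=> a b c; exact: lt_trans.
  by have /allP/(_ w wvs) := order_path_min tr so.
rewrite big_seq_cond big_pred0 ?addr0 => [|w]; last first.
  by case: (boolP (w \in vs)) => // /no ->.
rewrite -nscaleD.
have : all (fun e => ~~ (slope (edge_vec e) <= t)%E)
  (zip (nscale (u + v) :: map nscale (polyline (u + v) vs))
     (map nscale (polyline (u + v) vs))).
  move: (u + v) no {so IH} => {}u.
  elim: vs u => //= w vs IH u no.
  rewrite {1}/edge_vec /= nscaleD addrAC subrr add0r no ?mem_head //=.
  by rewrite -nscaleD; apply: IH => z zvs; apply: no; rewrite inE zvs orbT.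
rewrite all_predC has_filter negbK => /eqP.
rewrite /polyline /= => E.
by rewrite [X in map _ X]E.
Qed.

Definition upto (t : \bar R) (x : prim N) : bool := (slope (nscale (dir x)) <= t)%E.

Lemma xi_line nu t :
  xi n (line nu) t = nscale (\sum_(x | upto t x) dir x *+ nu x).
Proof.
have -> : xi n (line nu) t = last (nscale 0)
    [seq e.2 | e <- zip (nscale 0 :: map nscale (line nu))
     (map nscale (line nu)) & (slope (edge_vec e) <= t)%E].
  rewrite /xi /edges /scaled_line.
  have -> : nscale 0 = 0 by rewrite /nscale /scale embed0 /= !mul0r.
  by [].
rewrite xi_polyline ?steps_sorted // add0r; congr nscale.
rewrite big_map -(@sum_support _ nu (upto t)) => [|x ->]; last by rewrite mulr0n.
rewrite -[LHS]big_filter -[RHS]big_filter; congr bigop.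
apply: eq_in_filter => x; rewrite mem_filter => /andP[x0 _].
rewrite /upto; apply/idP/idP; apply: le_trans; apply: slope_nscale_le.
  by rewrite nslope_mulrn.
by rewrite nslope_mulrn.
Qed.

End Tangent.

End Line.

End LinesAndMultiplicities.

(** * Exponential tilts *)

Section TiltedSums.
Context {R : realType}.
Implicit Types (r a b s t e : R) (n v w : nat * nat) (N K : nat).

Definition lcost a b v : R := a * v.1%:R + b * v.2%:R.

Lemma lcostD a b v w : lcost a b (v + w) = lcost a b v + lcost a b w.
Proof. by rewrite /lcost /= !natrD; ring. Qed.

Lemma lcost_mulrn a b v k : lcost a b (v *+ k) = lcost a b v * k%:R.
Proof. by rewrite mulrn_pair /lcost /= !natrM; ring. Qed.

Lemma lcost_sum a b (I : finType) (P : pred I) (F : I -> nat * nat) :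
  lcost a b (\sum_(i | P i) F i) = \sum_(i | P i) lcost a b (F i).
Proof.
apply: (big_morph (lcost a b)); first exact: lcostD.
by rewrite /lcost /= !mulr0 addr0.
Qed.

Section Fixed.
Variables (N K : nat).
Implicit Types (nu : {ffun prim N -> 'I_K.+1}) (x : prim N).

Definition mweight r nu : R := \prod_x bcoef r (nu x).

Lemma mweight_gt0 r nu : 0 < r -> 0 < mweight r nu.
Proof. by move=> r0; apply: prodr_gt0 => x _; exact: bcoef_gt0. Qed.

Lemma sum_tilted r (gamma : prim N -> R) :
  \sum_nu mweight r nu * expR (- \sum_x gamma x * (nu x)%:R) =
  \prod_x (bpoly r K).[expR (- gamma x)].
Proof.
under [RHS]eq_bigr do rewrite bpolyE.
rewrite (bigA_distr_bigA (fun x (k : 'I_K.+1) =>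
  bcoef r k * expR (- gamma x) ^+ k)).
apply: eq_bigr => nu _; rewrite big_split /=; congr (_ * _).
rewrite -sumrN expR_sum; apply: eq_bigr => x _.
by rewrite -mulNr expRM_natr.
Qed.

(** Markov inequality for the exponential tilt gamma. *)
Lemma sum_tilted_le r (gamma : prim N -> R) (A : pred {ffun prim N -> 'I_K.+1}) C :
  0 < r -> (forall nu, A nu -> \sum_x gamma x * (nu x)%:R <= C) ->
  \sum_(nu | A nu) mweight r nu <=
  expR C * \prod_x (bpoly r K).[expR (- gamma x)].
Proof.
move=> r0 AC; rewrite -sum_tilted mulr_sumr big_mkcond.
apply: ler_sum => nu _; have W0 := ltW (mweight_gt0 nu r0).
case: ifP => [/AC h|_]; last by rewrite mulr_ge0 ?expR_ge0 // mulr_ge0 ?expR_ge0.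
rewrite mulrCA ler_peMr // -expRD -[leLHS]expR0 ler_expR.
by rewrite subr_ge0.
Qed.

Lemma bpoly_expR_le r g : 0 < r -> 0 < g ->
  (bpoly r K).[expR (- g)] <= expR (r / g).
Proof.
move=> r0 g0; set z := expR (- g).
have z0 : 0 < z by exact: expR_gt0.
have z1 : z < 1 by rewrite expR_lt1 oppr_lt0.
have h : 0 <= z < 1 by rewrite z1 ltW.
apply: le_trans (bpoly_le K 0 r0 h) _.
rewrite lpolyE big_nil mulr0 add0r expr1 ler_expR -mulrA ler_pM2l //.
rewrite ler_pdivrMr ?subr_gt0 // mulrC ler_pdivlMr //.
have := expR_ge1Dx g; have : z * expR g = 1.
  by rewrite mulrC expRxMexpNx_1.
by have := expR_gt0 g; nra.
Qed.

(** The coprime pairs on the axes are (1, 0) and (0, 1). *)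
Lemma big_axes (T : Type) (idx : T) (op : Monoid.com_law idx)
    (x1 x2 : prim N) (F : prim N -> T) :
  dir x1 = (1%N, 0%N) -> dir x2 = (0%N, 1%N) ->
  \big[op/idx]_(x | ~~ offaxis x) F x = op (F x1) (F x2).
Proof.
move=> d1 d2; rewrite (bigD1 x1); last by rewrite /offaxis d1.
rewrite (bigD1 x2); last first.
  by rewrite /offaxis d2 /=; apply: contra_eq_neq d2 => ->; rewrite d1.
rewrite big_pred0 ?Monoid.mulm1 // => x; apply/negP => /andP[/andP[xa xx1] xx2].
have := coprime_dir x; move: xa; rewrite /offaxis negb_and -!eqn0Ngt.
case/orP => /eqP xE; rewrite xE /coprime ?gcd0n ?gcdn0 => /eqP yE.
  case/negP: xx2; apply/eqP; apply: dir_inj.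
  by rewrite d2 [LHS]surjective_pairing xE yE.
case/negP: xx1; apply/eqP; apply: dir_inj.
by rewrite d1 [LHS]surjective_pairing xE yE.
Qed.

Lemma axesP : (0 < N)%N -> exists x1 x2 : prim N,
  dir x1 = (1%N, 0%N) /\ dir x2 = (0%N, 1%N).
Proof.
move=> N0.
have [x1 d1] := @dirP N 1 0 isT N0 isT.
by have [x2 d2] := @dirP N 0 1 isT isT N0; exists x1, x2.
Qed.

End Fixed.

(** For a n_1 = b n_2 this says that the scaled slope of x is at most t. *)
Definition below t a b N (x : prim N) : bool :=
  b * (dir x).2%:R <= t * a * (dir x).1%:R.

Section Kappa.
Variables (r kappa : R) (r0 : 0 < r) (kappa0 : 0 < kappa).
Hypothesis kappaU : sector_upper r kappa.

Lemma prod_axes_expR N K (gamma : prim N -> R) g : (0 < N)%N -> 0 < g ->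
  (forall x, ~~ offaxis x -> g <= gamma x) ->
  \prod_(x | ~~ offaxis x) (bpoly r K).[expR (- gamma x)] <= expR (r / g + r / g).
Proof.
move=> N0 g0 gg; have [x1 [x2 [d1 d2]]] := axesP N0.
have le x : ~~ offaxis x -> 0 <= (bpoly r K).[expR (- gamma x)] <= expR (r / g).
  move=> /gg h; have h0 : 0 < gamma x by apply: lt_le_trans h.
  rewrite ltW ?bpoly_gt0 ?expR_ge0 //=.
  apply: le_trans (bpoly_expR_le K r0 h0) _.
  by rewrite ler_expR ler_pM2l // lef_pV2 ?posrE.
rewrite (big_axes _ _ d1 d2) expRD.
have /le/andP[? ?] : ~~ offaxis x1 by rewrite /offaxis d1.
have /le/andP[? ?] : ~~ offaxis x2 by rewrite /offaxis d2.
exact: ler_pM.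
Qed.

Lemma axis_lcost N (x : prim N) a b g : 0 < g -> g <= a -> g <= b ->
  ~~ offaxis x -> g <= lcost a b (dir x).
Proof.
move=> g0 ga gb _; rewrite /lcost.
have := dir_neq0 x; case: (dir x) => i j /= h.
have [i0|j0] : (0 < i)%N \/ (0 < j)%N.
- by case: i h => [|i] h; [right; case: j h|left].
- have : 1 <= i%:R :> R by rewrite ler1n.
  have : 0 <= j%:R :> R by []. nra.
have : 1 <= j%:R :> R by rewrite ler1n.
have : 0 <= i%:R :> R by []. nra.
Qed.

Lemma sector_belowE t a b a' b' c N (x : prim N) : 0 < a -> 0 < b -> 0 < a' ->
  sector (t * b / a) (a * a') (b * b') c (dir x).1 (dir x).2 = (below t a' b' x == c).
Proof.
move=> a0 b0 a'0; rewrite /sector /below; congr (_ == c).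
have -> : t * b / a * (a * a') * (dir x).1%:R = b * (t * a' * (dir x).1%:R).
  by field; rewrite gt_eqF.
by rewrite -mulrA ler_pM2l.
Qed.

(** The directions below slope t are tilted by (a a', b b') and the
    others by (a', b'). Here t / (a (a + b t)) is the integral of
    exp (- a u_1 - b u_2) over the sector u_2 <= t u_1. The two axial
    directions contribute exp (O(1 / a' + 1 / b')), which is negligible. *)
Lemma prod_two_tilts t a b e : 0 < t -> 0 < a -> 0 < b -> 0 < e ->
  exists2 delta, 0 < delta & forall a' b' s, 0 < a' < delta -> 0 < b' < delta ->
  kappa = s * (a' * b') -> forall N K, (0 < N)%N ->
  \prod_(x : prim N) (bpoly r K).[expR (- (if below t a' b' x
       then lcost (a * a') (b * b') (dir x) else lcost a' b' (dir x)))]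
  <= expR (s * (t / (a * (a + b * t)) + (1 + t)^-1 + e)).
Proof.
move=> t0 a0 b0 e0.
have q0 : 0 < t * b / a by rewrite divr_gt0 // mulr_gt0.
have e1 : 0 < e / 4 * kappa * (a * b) by rewrite !mulr_gt0.
have e2 : 0 < e / 4 * kappa by rewrite !mulr_gt0.
have [d1 d10 H1] := kappaU q0 e1.
have [d2 d20 H2] := kappaU t0 e2.
pose m := Num.min 1 (Num.min a b).
have m0 : 0 < m by rewrite !lt_min ltr01 a0 b0.
(* Below d3 an axial factor exp (r / g) is at most exp (s e / 4). *)
pose d3 := kappa * e * m / (4 * r).
have d30 : 0 < d3 by rewrite divr_gt0 // !mulr_gt0.
pose delta := Num.min (Num.min (d1 / a) (d1 / b)) (Num.min d2 d3).
exists delta; first by rewrite !lt_min (divr_gt0 d10 a0) (divr_gt0 d10 b0) d20 d30.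
move=> a' b' s /andP[a'0 a'd] /andP[b'0 b'd] ks N K N0.
have ab'0 : 0 < a' * b' by rewrite mulr_gt0.
have sE : s = kappa / (a' * b') by rewrite ks mulfK // gt_eqF.
move: a'd b'd; rewrite !lt_min => /andP[/andP[a'1 _] /andP[a'2 a'3]].
move=> /andP[/andP[_ b'1] /andP[b'2 b'3]].
set gamma := fun x : prim N => if below t a' b' x
       then lcost (a * a') (b * b') (dir x) else lcost a' b' (dir x).
rewrite (bigID (@offaxis N)) (bigID (@below t a' b' N)) /=.
pose g := m * Num.min a' b'.
have g0 : 0 < g by rewrite mulr_gt0 // lt_min a'0.
have ga (c c' : R) : m <= c -> Num.min a' b' <= c' -> g <= c * c'.
  by move=> mc mc'; apply: ler_pM; rewrite ?(ltW m0) // le_min !ltW.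
have mina : Num.min a' b' <= a' by rewrite ge_min lexx.
have minb : Num.min a' b' <= b' by rewrite ge_min lexx orbT.
have gg x : ~~ offaxis x -> g <= gamma x.
  move=> xi; rewrite /gamma; case: ifP => _; apply: axis_lcost => //.
  - by apply: ga; rewrite ?ge_min ?lexx ?orbT.
  - by apply: ga; rewrite ?ge_min ?lexx ?orbT.
  - by rewrite -[a']mul1r; apply: ga; rewrite ?ge_min ?lexx ?orbT.
  - by rewrite -[b']mul1r; apply: ga; rewrite ?ge_min ?lexx ?orbT.
have P3 := prod_axes_expR K N0 g0 gg.
have h1a : 0 < a * a' < d1 by rewrite mulr_gt0 //= mulrC -ltr_pdivlMr.
have h1b : 0 < b * b' < d1 by rewrite mulr_gt0 //= mulrC -ltr_pdivlMr.
have h2a : 0 < a' < d2 by rewrite a'0.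
have h2b : 0 < b' < d2 by rewrite b'0.
have {H1} := H1 _ _ h1a h1b N K true.
have {H2} := H2 _ _ h2a h2b N K false.
have -> : \prod_(x : prim N | offaxis x && sector t a' b' false (dir x).1 (dir x).2)
   zfac r K a' b' x = \prod_(x | offaxis x && ~~ below t a' b' x)
   (bpoly r K).[expR (- gamma x)].
  apply: eq_big => [x|x /andP[_]]; first by rewrite /sector eqbF_neg.
  by rewrite /sector eqbF_neg /gamma /below => /negbTE ->.
move=> P2.
have -> : \prod_(x : prim N | offaxis x &&
     sector (t * b / a) (a * a') (b * b') true (dir x).1 (dir x).2)
   zfac r K (a * a') (b * b') x =
   \prod_(x | offaxis x && below t a' b' x) (bpoly r K).[expR (- gamma x)].
  apply: eq_big => [x|x /andP[_]]; first by rewrite sector_belowE // eqb_id.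
  by rewrite sector_belowE // eqb_id /gamma => ->.
move=> P1.
have pos (P : pred (prim N)) : 0 <= \prod_(x | P x) (bpoly r K).[expR (- gamma x)].
  by apply: prodr_ge0 => x _; rewrite ltW // bpoly_gt0 // expR_ge0.
apply: le_trans (ler_pM (mulr_ge0 (pos _) (pos _)) (pos _)
  (ler_pM (pos _) (pos _) P1 P2) P3) _.
rewrite -!expRD ler_expR.
have rg : r / g <= e / 4 * s.
  have [i0|i1] : Num.min a' b' = a' \/ Num.min a' b' = b'.
  - by rewrite /Num.min; case: ifP; [left|right].
  - rewrite /g i0 ler_pdivrMr ?mulr_gt0 // sE.
    have -> : e / 4 * (kappa / (a' * b')) * (m * a') = e * kappa * m / 4 / b'.
      by field; rewrite !gt_eqF.
    rewrite ler_pdivlMr // mulrC -ler_pdivlMr //; apply: le_trans (ltW b'3) _.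
    by rewrite /d3 le_eqVlt; apply/orP; left; apply/eqP; field; rewrite gt_eqF.
  rewrite /g i1 ler_pdivrMr ?mulr_gt0 // sE.
  have -> : e / 4 * (kappa / (a' * b')) * (m * b') = e * kappa * m / 4 / a'.
    by field; rewrite !gt_eqF.
  rewrite ler_pdivlMr // mulrC -ler_pdivlMr //; apply: le_trans (ltW a'3) _.
  by rewrite /d3 le_eqVlt; apply/orP; left; apply/eqP; field; rewrite gt_eqF.
have abt : 0 < a + b * t by rewrite addr_gt0 // mulr_gt0.
have -> : (kappa * share (t * b / a) true + e / 4 * kappa * (a * b)) /
    (a * a' * (b * b')) = s * (t / (a * (a + b * t))) + e / 4 * s.
  rewrite /share sE; field.
  by rewrite !gt_eqF // addrC mulrC.
have -> : (kappa * share t false + e / 4 * kappa) / (a' * b') =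
    s * (1 + t)^-1 + e / 4 * s.
  by rewrite /share sE; field; rewrite !gt_eqF // addr_gt0.
lra.
Qed.

End Kappa.

End TiltedSums.

(** * Deviations, and completion by axial edges *)

Section Deviations.
Context {R : realType}.
Implicit Types (a b s t e : R) (n v w : nat * nat) (N K : nat).
Variables (r kappa : R) (r0 : 0 < r) (kappa0 : 0 < kappa).
Hypothesis kappaU : sector_upper r kappa.

(** The tilt (a', b') whose typical endpoint is n: the two costs
    a' n_1 and b' n_2 and the logarithm kappa / (a' b') of the partition
    function all equal s. *)
Definition scaling (delta S s a' b' : R) n : Prop :=
  [/\ (0 < n.1)%N /\ (0 < n.2)%N, a' * n.1%:R = s /\ b' * n.2%:R = s,
      kappa = s * (a' * b'), 0 < a' < delta /\ 0 < b' < delta & S <= s].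

Definition part_below t a' b' N K (nu : {ffun prim N -> 'I_K.+1}) : nat * nat :=
  \sum_(x | below t a' b' x) dir x *+ nu x.

(** The cost of n itself is 2 s, so that on the event summed over
    the line has tilted cost at most s (2 + m). *)
Lemma sum_deviation_le t a b e : 0 < t -> 0 < a -> 0 < b -> 0 < e ->
  exists2 delta, 0 < delta & forall S s a' b' n, scaling delta S s a' b' n ->
  forall N K m, (0 < N)%N ->
  \sum_(nu : {ffun prim N -> 'I_K.+1} | (endpoint nu == n) &&
     ((a - 1) * ((part_below t a' b' nu).1%:R / n.1%:R) +
      (b - 1) * ((part_below t a' b' nu).2%:R / n.2%:R) <= m)) mweight r nu
  <= expR (s * (2 + m + (t / (a * (a + b * t)) + (1 + t)^-1 + e))).
Proof.
move=> t0 a0 b0 e0; have [delta d0 H] := prod_two_tilts r0 kappa0 kappaU t0 a0 b0 e0.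
exists delta => // S s a' b' n [[n1 n2] [s1 s2] ks [ha hb] _] N K m N0.
have {}H := H a' b' s ha hb ks N K N0.
rewrite mulrDr expRD.
apply: le_trans (ler_wpM2l (expR_ge0 _) H).
apply: sum_tilted_le => // nu /andP[/eqP tn hm].
have -> : \sum_x (if below t a' b' x then lcost (a * a') (b * b') (dir x)
    else lcost a' b' (dir x)) * (nu x)%:R =
  lcost a' b' (endpoint nu) + lcost ((a - 1) * a') ((b - 1) * b') (part_below t a' b' nu).
  rewrite /part_below /endpoint !lcost_sum [in X in _ + X]big_mkcond -big_split /=.
  apply: eq_bigr => x _; case: ifP => _; rewrite !lcost_mulrn ?addr0 //.
  by rewrite /lcost; ring.
rewrite tn /lcost s1 s2.
have n1R : 0 < n.1%:R :> R by rewrite ltr0n.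
have n2R : 0 < n.2%:R :> R by rewrite ltr0n.
have s0 : 0 < s by rewrite -s1 mulr_gt0 //; case/andP: ha.
have aE : a' = s / n.1%:R by rewrite -s1 mulfK // gt_eqF.
have bE : b' = s / n.2%:R by rewrite -s2 mulfK // gt_eqF.
move: (part_below _ _ _ _) hm => v; rewrite {1}aE {1}bE => hm.
have -> : s + s + ((a - 1) * (s / n.1%:R) * v.1%:R + (b - 1) * (s / n.2%:R) * v.2%:R)
  = s * (2 + ((a - 1) * (v.1%:R / n.1%:R) + (b - 1) * (v.2%:R / n.2%:R))) by ring.
by rewrite ler_pM2l // lerD2l.
Qed.

Lemma prod_offaxis_le e : 0 < e -> exists2 delta, 0 < delta &
  forall a b, 0 < a < delta -> 0 < b < delta -> forall N K,
  \prod_(x : prim N | offaxis x) zfac r K a b x <= expR ((kappa + e) / (a * b)).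
Proof.
move=> e0; have e2 : 0 < e / 2 by rewrite divr_gt0.
have [delta d0 H] := kappaU ltr01 e2; exists delta => // a b ha hb N K.
rewrite (bigID (fun x : prim N => sector 1 a b true (dir x).1 (dir x).2)).
have pos (P : pred (prim N)) : 0 <= \prod_(x | P x) zfac r K a b x.
  by apply: prodr_ge0 => x _; rewrite ltW // bpoly_gt0 // expR_ge0.
have P2 : \prod_(x : prim N | offaxis x && ~~ sector 1 a b true (dir x).1 (dir x).2)
    zfac r K a b x <= expR ((kappa * share 1 false + e / 2) / (a * b)).
  apply: le_trans (H a b ha hb N K false); rewrite le_eqVlt; apply/orP; left.
  by apply/eqP; apply: eq_bigl => x; rewrite /sector eqb_id eqbF_neg.
apply: le_trans (ler_pM (pos _) (pos _) (H a b ha hb N K true) P2) _.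
rewrite -expRD ler_expR -mulrDl.
have -> : kappa * share 1 true + e / 2 + (kappa * share 1 false + e / 2) =
    kappa * (share 1 true + share 1 (~~ true)) + e by rewrite /=; field.
by rewrite share_sum // mulr1.
Qed.

Section Offaxis.
Variables (N K : nat).
Implicit Types (nu : {ffun prim N -> 'I_K.+1}) (x : prim N).

(** Weight of the multiplicities that vanish on the axes; the axial
    edges are kept for moving the endpoint to n. *)
Definition oweight nu : R :=
  \prod_x (if offaxis x then bcoef r (nu x) else (nu x == 0%N :> nat)%:R).

Lemma oweight_ge0 nu : 0 <= oweight nu.
Proof.
by apply: prodr_ge0 => x _; case: ifP => // _; rewrite ltW // bcoef_gt0.
Qed.

Lemma sum_oweight a b :
  \sum_nu oweight nu * expR (- lcost a b (endpoint nu)) =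
  \prod_(x : prim N | offaxis x) zfac r K a b x.
Proof.
pose F x (k : 'I_K.+1) : R := (if offaxis x then bcoef r k else (k == 0%N :> nat)%:R)
  * expR (- lcost a b (dir x)) ^+ k.
transitivity (\prod_x \sum_k F x k).
  rewrite bigA_distr_bigA; apply: eq_bigr => nu _.
  rewrite big_split; congr (_ * _).
  rewrite /endpoint lcost_sum -sumrN expR_sum; apply: eq_bigr => x _.
  by rewrite lcost_mulrn -mulNr expRM_natr.
rewrite [RHS]big_mkcond; apply: eq_bigr => x _; rewrite /F.
case: ifP => _; first by rewrite /zfac bpolyE.
rewrite big_ord_recl big1 ?addr0 => [|i _]; last by rewrite mul0r.
by rewrite expr0 mulr1.
Qed.

Lemma sum_oweight_le (A : pred {ffun prim N -> 'I_K.+1}) a b a1 b1 D :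
  (forall nu, A nu -> lcost a1 b1 (endpoint nu) + D <= lcost a b (endpoint nu)) ->
  \sum_(nu | A nu) oweight nu * expR (- lcost a b (endpoint nu)) <=
  expR (- D) * \prod_(x : prim N | offaxis x) zfac r K a1 b1 x.
Proof.
move=> AD; rewrite -sum_oweight mulr_sumr big_mkcond; apply: ler_sum => nu _.
have W0 := oweight_ge0 nu; case: ifP => [/AD h|_].
  by rewrite mulrCA ler_wpM2l // -expRD ler_expR; lra.
by rewrite !mulr_ge0 ?expR_ge0.
Qed.

Variables (n : nat * nat) (N0 : (0 < N)%N) (nK : (n.1 + n.2 <= K)%N).

Definition completion nu : {ffun prim N -> 'I_K.+1} :=
  [ffun x => if offaxis x then nu x else
     if (dir x).1 == 0%N then inord (n.2 - (endpoint nu).2)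
     else inord (n.1 - (endpoint nu).1)].

Definition axis_free nu : bool := [forall x, offaxis x || (nu x == 0%N :> nat)].

Lemma completion_axes nu x1 x2 : dir x1 = (1%N, 0%N) -> dir x2 = (0%N, 1%N) ->
  (completion nu x1 = (n.1 - (endpoint nu).1)%N :> nat) *
  (completion nu x2 = (n.2 - (endpoint nu).2)%N :> nat).
Proof.
move=> d1 d2; rewrite !ffunE /offaxis d1 d2 /= !inordK // ltnS.
  by rewrite (leq_trans (leq_subr _ _)) // (leq_trans _ nK) ?leq_addl.
by rewrite (leq_trans (leq_subr _ _)) // (leq_trans _ nK) ?leq_addr.
Qed.

Lemma endpoint_completion nu : axis_free nu ->
  ((endpoint nu).1 <= n.1)%N -> ((endpoint nu).2 <= n.2)%N -> endpoint (completion nu) = n.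
Proof.
move=> /forallP nu0 h1 h2; have [x1 [x2 [d1 d2]]] := axesP N0.
have -> : endpoint (completion nu) =
    \sum_(x | offaxis x) dir x *+ completion nu x +
    \sum_(x | ~~ offaxis x) dir x *+ completion nu x by exact: bigID.
have -> : \sum_(x | offaxis x) dir x *+ completion nu x = endpoint nu.
  rewrite /endpoint big_mkcond; apply: eq_bigr => x _.
  rewrite ffunE; case: (boolP (offaxis x)) => // xo.
  by move: (nu0 x); rewrite (negbTE xo) => /eqP ->; rewrite mulr0n.
rewrite (big_axes _ _ d1 d2) !(completion_axes nu d1 d2) d1 d2.
rewrite !mulrn_pair; apply: injective_projections.
  rewrite -[RHS](subnKC h1); congr addn.
  by rewrite /= mul1n mul0n; exact: addn0.
rewrite -[RHS](subnKC h2); congr addn.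
by rewrite /= mul1n mul0n; exact: add0n.
Qed.

Lemma completion_inj : {in axis_free &, injective completion}.
Proof.
move=> nu nu' /forallP z /forallP z' E; apply/ffunP => x.
have := congr1 (fun f : {ffun prim N -> 'I_K.+1} => f x) E; rewrite !ffunE.
case: (boolP (offaxis x)) => // xo _; apply: val_inj.
move: (z x) (z' x); rewrite (negbTE xo) => /eqP h /eqP h'; exact: etrans h (esym h').
Qed.

(** Axial edges change the weight by two factors bcoef r k, which
    decay at most like 1 / k. *)
Lemma oweight_completion nu :
  (Num.min r 1) ^+ 2 / (n.1.+1%:R * n.2.+1%:R) * oweight nu <=
  mweight r (completion nu).
Proof.
have [x1 [x2 [d1 d2]]] := axesP N0; have c0 : 0 < Num.min r 1 by rewrite lt_min r0 ltr01.
rewrite /mweight (bigID (@offaxis N)) mulrC.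
have le k j : (j <= k)%N -> Num.min r 1 / k.+1%:R <= bcoef r j.
  move=> jk; apply: le_trans (bcoef_ge j r0); rewrite ler_pM2l //.
  by rewrite lef_pV2 ?posrE ?ltr0n // ler_nat.
apply: ler_pM; rewrite ?oweight_ge0 //.
- by rewrite divr_ge0 ?exprn_ge0 ?mulr_ge0 // ltW.
- rewrite /oweight [leRHS]big_mkcond; apply: ler_prod => x _.
  case: ifP => xo; last by rewrite ler0n lern1 leq_b1.
  by rewrite ffunE xo lexx andbT ltW // bcoef_gt0.
rewrite [leRHS](big_axes _ _ d1 d2) !(completion_axes nu d1 d2).
rewrite expr2 invfM mulrACA; apply: ler_pM; rewrite ?divr_ge0 ?(ltW c0) //.
  by apply: le; exact: leq_subr.
by apply: le; exact: leq_subr.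
Qed.

Lemma sum_oweight_completion (A : pred {ffun prim N -> 'I_K.+1}) :
  (forall nu, A nu -> ((endpoint nu).1 <= n.1)%N && ((endpoint nu).2 <= n.2)%N) ->
  (Num.min r 1) ^+ 2 / (n.1.+1%:R * n.2.+1%:R) * \sum_(nu | A nu) oweight nu <=
  \sum_(nu : {ffun prim N -> 'I_K.+1} | endpoint nu == n) mweight r nu.
Proof.
move=> An; pose B := [set nu | A nu & axis_free nu]%SET.
have -> : \sum_(nu | A nu) oweight nu = \sum_(nu in B) oweight nu.
  rewrite [RHS]big_mkcond [LHS]big_mkcond; apply: eq_bigr => nu _.
  rewrite inE; case: (A nu) => //=; case: (boolP (axis_free nu)) => //.
  move=> /forallPn[x]; rewrite negb_or => /andP[xo nx].
  by rewrite /oweight (bigD1 x) //= (negbTE xo) (negbTE nx) mul0r.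
rewrite mulr_sumr.
apply: (@le_trans _ _ (\sum_(nu in B) mweight r (completion nu))).
  by apply: ler_sum => nu _; exact: oweight_completion.
rewrite -(big_imset (mweight r)) /=; last first.
  move=> nu nu'; rewrite !inE => /andP[_ h] /andP[_ h'].
  exact: completion_inj.
rewrite big_mkcond [leRHS]big_mkcond; apply: ler_sum => nu _.
case: ifP => [/imsetP[mu]|_]; last by case: ifP => // _; rewrite ltW // mweight_gt0.
by rewrite inE => /andP[/An /andP[h1 h2] z] ->; rewrite endpoint_completion ?eqxx.
Qed.

End Offaxis.

End Deviations.

(** * The weight of all lines ending at n *)

Section PartitionFunction.
Context {R : realType}.
Implicit Types (a b s t e d : R) (n v w : nat * nat) (N K : nat).

(** This inequality and the next two compare the exponents of the
    events excluded in sum_good_oweight_ge with the exponent of the whole sum,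
    for a tilt enlarged by the factor 1 + d. *)
Lemma gap_coordinate d : 0 < d <= 20^-1 ->
  - d + (1 + d)^-1 + d ^+ 2 <= (1 + d) ^- 2.
Proof.
move=> /andP[d0 d1]; have d1' : 0 < 1 + d by lra.
rewrite -subr_ge0.
have -> : (1 + d) ^- 2 - (- d + (1 + d)^-1 + d ^+ 2) =
    d ^+ 2 * (1 - d - d ^+ 2) / (1 + d) ^+ 2 by field; rewrite gt_eqF.
rewrite divr_ge0 ?exprn_ge0 ?(ltW d1') // mulr_ge0 ?exprn_ge0 ?(ltW d0) //; nra.
Qed.

Lemma gap_total d : 0 < d <= 20^-1 ->
  d * (2 - 12 * d) + (1 + 2 * d) ^- 2 + d ^+ 2 <= (1 + d) ^- 2.
Proof.
move=> /andP[d0 d1]; have d1' : 0 < 1 + d by lra.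
have d2' : 0 < 1 + 2 * d by lra.
rewrite -subr_ge0.
have -> : (1 + d) ^- 2 - (d * (2 - 12 * d) + (1 + 2 * d) ^- 2 + d ^+ 2) =
    d * ((2 + 3 * d) - (2 - 11 * d) * ((1 + d) * (1 + 2 * d)) ^+ 2)
     / ((1 + d) * (1 + 2 * d)) ^+ 2.
  by field; rewrite !gt_eqF.
rewrite divr_ge0 ?exprn_ge0 ?mulr_ge0 ?(ltW d1') ?(ltW d2') ?(ltW d0) //.
have -> : (1 + d) * (1 + 2 * d) = 1 + 3 * d + 2 * d ^+ 2 by ring.
set z := 3 * d + 2 * d ^+ 2.
have z0 : 0 <= z by rewrite /z; nra.
have z1 : z <= 31 / 10 * d by rewrite /z; nra.
have -> : 1 + 3 * d + 2 * d ^+ 2 = 1 + z by rewrite /z; ring.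
have z2 : (1 + z) ^+ 2 <= 1 + 7 * d by nra.
nra.
Qed.

Lemma gap_final d : 0 < d <= 20^-1 ->
  3 - 14 * d <= (1 + d) ^- 2 - d ^+ 2 / 4 + (1 + d) * (2 - 12 * d).
Proof.
move=> /andP[d0 d1]; have d1' : 0 < 1 + d by lra.
have h : 1 - 2 * d <= (1 + d) ^- 2.
  rewrite -[leRHS]mul1r ler_pdivlMr ?exprn_gt0 //; nra.
nra.
Qed.

Variables (r kappa : R) (r0 : 0 < r) (kappa0 : 0 < kappa).
Hypothesis kappaU : sector_upper r kappa.
Hypothesis kappaL : offaxis_lower r kappa.

(** The product n_1 n_2 is s^3 / kappa, hence polynomial in s. *)
Lemma poly_factor_le d : 0 < d -> exists S, forall delta s a b n,
  scaling kappa delta S s a b n ->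
  expR (- (s * d)) <= (Num.min r 1) ^+ 2 / (n.1.+1%:R * n.2.+1%:R) / 4.
Proof.
move=> d0; set c := Num.min r 1; have c0 : 0 < c by rewrite lt_min r0 ltr01.
have M0 : 0 < kappa * c ^+ 2 * d ^+ 4 by rewrite !mulr_gt0 ?exprn_gt0.
(* 384 = 4 * 4 * 24, from n_i + 1 <= 2 n_i, from the factor 4 of the statement
   and from the term of order 4 of the exponential series. *)
exists (384 / (kappa * c ^+ 2 * d ^+ 4)).
move=> delta s a b n [[n1 n2] [s1 s2] ks [/andP[a0 _] /andP[b0 _]] sS].
have n1R : 1 <= n.1%:R :> R by rewrite ler1n.
have n2R : 1 <= n.2%:R :> R by rewrite ler1n.
have s0 : 0 < s by rewrite -s1 mulr_gt0 // (lt_le_trans _ n1R).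
have sd : 0 <= s * d by rewrite mulr_ge0 // ltW.
have N0 : 0 < n.1.+1%:R * n.2.+1%:R :> R by rewrite mulr_gt0 ?ltr0n.
rewrite expRN -mulrA -invfM -[leRHS]invrK invf_div lef_pV2 ?posrE ?expR_gt0 //; last first.
  by rewrite divr_gt0 ?exprn_gt0 // mulr_gt0.
apply: (@le_trans _ _ ((s * d) ^+ 4 / 24)); last first.
  apply: le_trans (expR_ge1Dxn 3 sd).
  by rewrite (_ : 4`!%:R = 24 :> R) // lerDr.
have nn : n.1.+1%:R * n.2.+1%:R <= 4 * (s ^+ 3 / kappa) :> R.
  have -> : s ^+ 3 / kappa = n.1%:R * n.2%:R.
    rewrite ks {1}(_ : s ^+ 3 = s * ((a * n.1%:R) * (b * n.2%:R))).
      by field; rewrite !gt_eqF.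
    by rewrite s1 s2; ring.
  rewrite -[n.1.+1]addn1 -[n.2.+1]addn1 !natrD; nra.
rewrite ler_pdivrMr ?exprn_gt0 //.
have h : 384 <= s * (kappa * c ^+ 2 * d ^+ 4) by rewrite -ler_pdivrMr.
have h2 : 16 * (s ^+ 3 / kappa) <= (s * d) ^+ 4 / 24 * c ^+ 2.
  have -> : (s * d) ^+ 4 / 24 * c ^+ 2 =
      s ^+ 3 / kappa * (s * (kappa * c ^+ 2 * d ^+ 4)) / 24.
    by field; rewrite gt_eqF.
  have : 0 <= s ^+ 3 / kappa by rewrite divr_ge0 ?exprn_ge0 // ltW.
  by nra.
lra.
Qed.

(** Under the tilt (1 + d) (a, b) the typical endpoint is close to
    (1 - 3 d) n. Exponential bounds show that the endpoints that exceed n in a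
    coordinate, and those of cost at most (2 - 12 d) s, carry at most three
    quarters of the tilted sum; on the remaining ones the tilt is known
    up to a factor exp (O(d s)). *)
Lemma sum_good_oweight_ge d : 0 < d <= 20^-1 -> exists2 delta, 0 < delta & exists S,
  forall s a b n, scaling kappa delta S s a b n ->
  exists N0, forall N, (N0 <= N)%N -> exists K0, forall K, (K0 <= K)%N ->
  expR (s * (3 - 14 * d)) / 4 <=
  \sum_(nu : {ffun prim N -> 'I_K.+1} |
    ((endpoint nu).1 <= n.1)%N && ((endpoint nu).2 <= n.2)%N) oweight r nu.
Proof.
move=> hd; have /andP[d0 d1] := hd.
(* The gaps leave room d^2; both errors e1 take half of it, and the other half
   exceeds ln 4 / s. *)
pose e1 := d ^+ 2 / 4; have e10 : 0 < e1 by rewrite divr_gt0 ?exprn_gt0.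
have ke0 : 0 < kappa * e1 by rewrite mulr_gt0.
have [dU dU0 HU] := prod_offaxis_le r0 kappaU ke0.
have [dL dL0 HL] := kappaL ke0.
exists (Num.min dU dL / 2); first by rewrite divr_gt0 // lt_min dU0.
exists (6 / d ^+ 2) => s a b n [[n1 n2] [s1 s2] ks [/andP[a0 ad] /andP[b0 bd]] sS].
have n1R : 0 < n.1%:R :> R by rewrite ltr0n.
have s0 : 0 < s by rewrite -s1 mulr_gt0.
have sE : s = kappa / (a * b) by rewrite ks mulfK // mulf_neq0 ?gt_eqF.
have adU : a < dU / 2 by apply: lt_le_trans ad _; rewrite ler_pM2r // ge_min lexx.
have bdU : b < dU / 2 by apply: lt_le_trans bd _; rewrite ler_pM2r // ge_min lexx.
have adL : a < dL / 2 by apply: lt_le_trans ad _; rewrite ler_pM2r // ge_min lexx orbT.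
have bdL : b < dL / 2 by apply: lt_le_trans bd _; rewrite ler_pM2r // ge_min lexx orbT.
have upper c c' N K : 1 <= c <= 1 + 2 * d -> 1 <= c' <= 1 + 2 * d ->
    \prod_(x : prim N | offaxis x) zfac r K (c * a) (c' * b) x <=
    expR (s * ((c * c')^-1 + e1)).
  move=> /andP[c1 c2] /andP[c1' c2'].
  have h1 : 0 < c * a < dU by apply/andP; split; nra.
  have h2 : 0 < c' * b < dU by apply/andP; split; nra.
  apply: le_trans (HU _ _ h1 h2 N K) _; rewrite ler_expR.
  have cc1 : 1 <= c * c' by nra.
  have -> : (kappa + kappa * e1) / (c * a * (c' * b)) = s * ((c * c')^-1 + e1 * (c * c')^-1).
    by rewrite sE; field; rewrite !gt_eqF // (lt_le_trans ltr01).
  rewrite ler_pM2l // lerD2l ler_piMr ?(ltW e10) // invf_le1 //.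
  exact: lt_le_trans cc1.
have lower : exists N0, forall N, (N0 <= N)%N -> exists K0, forall K, (K0 <= K)%N ->
    expR (s * ((1 + d) ^- 2 - e1)) <=
    \prod_(x : prim N | offaxis x) zfac r K ((1 + d) * a) ((1 + d) * b) x.
  have h1 : 0 < (1 + d) * a < dL by apply/andP; split; nra.
  have h2 : 0 < (1 + d) * b < dL by apply/andP; split; nra.
  have [N0 H] := HL _ _ h1 h2; exists N0 => N /H [K0 {}H]; exists K0 => K /H.
  apply: le_trans; rewrite ler_expR.
  have -> : (kappa - kappa * e1) / ((1 + d) * a * ((1 + d) * b)) =
      s * ((1 + d) ^- 2 - e1 * (1 + d) ^- 2).
    by rewrite sE; field; rewrite !gt_eqF //; lra.
  rewrite ler_pM2l // lerD2l lerN2 ler_piMr ?(ltW e10) //.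
  rewrite invf_le1 ?exprn_gt0 ?exprn_ege1 //; lra.
have [N0 {}lower] := lower; exists N0 => N /lower [K0 {}lower].
exists K0 => K /lower {lower}.
set Z := \prod_(x | _) _ => Zlow.
have e4 : 4 <= expR (s * (d ^+ 2 / 2)).
  apply: le_trans (expR_ge1Dx _).
  have : 6 <= s * d ^+ 2 by rewrite -ler_pdivrMr ?exprn_gt0.
  lra.
have bad_le D x : D + s * (x + e1) + s * (d ^+ 2 / 2) <= s * ((1 + d) ^- 2 - e1) ->
    expR D * expR (s * (x + e1)) <= Z / 4.
  move=> h; rewrite ler_pdivlMr // -expRD.
  apply: le_trans (ler_wpM2l (expR_ge0 _) e4) _.
  by rewrite -expRD; apply: le_trans Zlow; rewrite ler_expR.
pose f (nu : {ffun prim N -> 'I_K.+1}) :=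
  oweight r nu * expR (- lcost ((1 + d) * a) ((1 + d) * b) (endpoint nu)).
have ZE : Z = \sum_nu f nu by rewrite /f sum_oweight.
have c1 : 1 <= 1 + d <= 1 + 2 * d by lra.
have c0 : 1 <= (1 : R) <= 1 + 2 * d by lra.
have c2 : 1 <= 1 + 2 * d <= 1 + 2 * d by lra.
have bad1 : \sum_(nu | (n.1 < (endpoint nu).1)%N) f nu <= Z / 4.
  apply: le_trans (_ : _ <= expR (- (d * s)) * _) _.
    apply: (sum_oweight_le r0 (a1 := 1 * a) (b1 := (1 + d) * b)) => nu /ltnW h.
    have : a * n.1%:R <= a * (endpoint nu).1%:R by rewrite ler_pM2l // ler_nat.
    by rewrite s1 /lcost; nra.
  apply: le_trans (ler_wpM2l (expR_ge0 _) (upper _ _ N K c0 c1)) _.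
  apply: bad_le; rewrite mul1r.
  have := gap_coordinate hd; rewrite -(ler_pM2l s0) /e1; lra.
have bad2 : \sum_(nu | (n.2 < (endpoint nu).2)%N) f nu <= Z / 4.
  apply: le_trans (_ : _ <= expR (- (d * s)) * _) _.
    apply: (sum_oweight_le r0 (a1 := (1 + d) * a) (b1 := 1 * b)) => nu /ltnW h.
    have : b * n.2%:R <= b * (endpoint nu).2%:R by rewrite ler_pM2l // ler_nat.
    by rewrite s2 /lcost; nra.
  apply: le_trans (ler_wpM2l (expR_ge0 _) (upper _ _ N K c1 c0)) _.
  apply: bad_le; rewrite mulr1.
  have := gap_coordinate hd; rewrite -(ler_pM2l s0) /e1; lra.
have bad3 : \sum_(nu | lcost a b (endpoint nu) <= (2 - 12 * d) * s) f nu <= Z / 4.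
  apply: le_trans (_ : _ <= expR (- (- (d * ((2 - 12 * d) * s)))) * _) _.
    apply: (sum_oweight_le r0 (a1 := (1 + 2 * d) * a) (b1 := (1 + 2 * d) * b)) => nu h.
    by move: h; rewrite /lcost; nra.
  apply: le_trans (ler_wpM2l (expR_ge0 _) (upper _ _ N K c2 c2)) _.
  apply: bad_le; rewrite opprK -expr2.
  have := gap_total hd; rewrite -(ler_pM2l s0) /e1; lra.
pose P1 (nu : {ffun prim N -> 'I_K.+1}) := (n.1 < (endpoint nu).1)%N.
pose P2 (nu : {ffun prim N -> 'I_K.+1}) := (n.2 < (endpoint nu).2)%N.
pose P3 (nu : {ffun prim N -> 'I_K.+1}) := lcost a b (endpoint nu) <= (2 - 12 * d) * s.
pose good (nu : {ffun prim N -> 'I_K.+1}) := [&& ~~ P1 nu, ~~ P2 nu & ~~ P3 nu].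
have f0 nu : 0 <= f nu by rewrite mulr_ge0 ?oweight_ge0 ?expR_ge0.
have goodZ : Z / 4 <= \sum_(nu | good nu) f nu.
  have : Z <= \sum_(nu | good nu) f nu + \sum_(nu | P1 nu) f nu +
      \sum_(nu | P2 nu) f nu + \sum_(nu | P3 nu) f nu.
    rewrite ZE [X in _ <= X + _ + _ + _]big_mkcond [X in _ <= _ + X + _ + _]big_mkcond.
    rewrite [X in _ <= _ + _ + X + _]big_mkcond [X in _ <= _ + _ + _ + X]big_mkcond.
    rewrite -!big_split /=; apply: ler_sum => nu _; have := f0 nu; rewrite /good.
    by case: (P1 nu); case: (P2 nu); case: (P3 nu) => /=; lra.
  by move: bad1 bad2 bad3; rewrite -/(P1 _) -/(P2 _); lra.
apply: (@le_trans _ _ (expR ((1 + d) * ((2 - 12 * d) * s)) * \sum_(nu | good nu) f nu)).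
  apply: le_trans (ler_wpM2l (expR_ge0 _) goodZ).
  rewrite mulrA ler_pM2r ?invr_gt0 //.
  apply: le_trans (ler_wpM2l (expR_ge0 _) Zlow).
  rewrite -expRD ler_expR.
  have := gap_final hd; rewrite -(ler_pM2l s0) /e1; lra.
rewrite mulr_sumr [leLHS]big_mkcond [leRHS]big_mkcond; apply: ler_sum => nu _.
have W0 := oweight_ge0 r0 nu.
case: ifP => [/and3P[g1 g2 g3]|_]; last by case: ifP.
rewrite /P1 /P2 -!leqNgt in g1 g2; rewrite g1 g2 /= /f mulrCA ler_piMr // -expRD.
rewrite expR_le1.
move: g3; rewrite /P3 -ltNge /lcost; nra.
Qed.

(** Completion by axial edges turns the lines that end below n
    into distinct lines that end at n. *)
Lemma partition_function_ge e : 0 < e -> exists2 delta, 0 < delta & exists S,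
  forall s a b n, scaling kappa delta S s a b n ->
  expR (s * (3 - e)) <= \sum_(G \in Pi R n) weight r G.
Proof.
move=> e0; pose d := Num.min 20^-1 (e / 15).
have d0 : 0 < d by rewrite lt_min invr_gt0 ltr0n /= divr_gt0.
have hd : 0 < d <= 20^-1 by rewrite d0 ge_min lexx.
have de : 15 * d <= e.
  have : d <= e / 15 by rewrite ge_min lexx orbT.
  lra.
have [delta delta0 [S1 H1]] := sum_good_oweight_ge hd.
have [S2 H2] := poly_factor_le d0.
exists delta => //; exists (Num.max S1 S2) => s a b n [nn ss ks ab].
rewrite ge_max => /andP[sS1 sS2].
have sc1 : scaling kappa delta S1 s a b n by [].
have sc2 : scaling kappa delta S2 s a b n by [].
have h2 := H2 _ _ _ _ _ sc2.
have [N0 {}H1] := H1 s a b n sc1.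
have [K0 {}H1] := H1 (maxn N0 (n.1 + n.2)) (leq_maxl _ _).
have {}H1 := H1 (maxn K0 (n.1 + n.2)) (leq_maxl _ _).
move: H1; set N := maxn N0 _; set K := maxn K0 _ => H1.
have nN : (n.1 + n.2 <= N)%N by exact: leq_maxr.
have nK : (n.1 + n.2 <= K)%N by exact: leq_maxr.
have n1N : (n.1 <= N)%N by apply: leq_trans nN; exact: leq_addr.
have n2N : (n.2 <= N)%N by apply: leq_trans nN; exact: leq_addl.
have [[n1 n2] _] := (nn, ss).
have N00 : (0 < N)%N by apply: leq_trans n1N.
rewrite -[Pi R n]setIT (sum_weight r _ n1N n2N nK).
have -> : \sum_(nu : {ffun prim N -> 'I_K.+1} | (endpoint nu == n) &&
      `[< [set: seq (nat * nat)] (line (R := R) nu) >])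
    \prod_x bcoef r (nu x) =
  \sum_(nu : {ffun prim N -> 'I_K.+1} | endpoint nu == n) mweight r nu.
  by apply: eq_bigl => nu; rewrite asboolT ?andbT.
apply: le_trans (sum_oweight_completion r0 N00 nK (A :=
  fun nu => ((endpoint nu).1 <= n.1)%N && ((endpoint nu).2 <= n.2)%N) _) => //.
apply: le_trans (ler_wpM2l _ H1); last first.
  by rewrite divr_ge0 ?exprn_ge0 ?mulr_ge0 // le_min ltW //= ltr01.
have s0 : 0 < s.
  by case: ss => <- _; rewrite mulr_gt0 ?ltr0n //; case: ab => /andP[].
apply: (@le_trans _ _ (expR (- (s * d)) * expR (s * (3 - 14 * d)))).
  by rewrite -expRD ler_expR; nra.
apply: le_trans (ler_wpM2r (expR_ge0 _) h2) _.
by rewrite le_eqVlt; apply/orP; left; apply/eqP; ring.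
Qed.

End PartitionFunction.

(** * The limit shape *)

Section Limit.
Context {R : realType}.
Implicit Types (a b s t e d : R) (n v w : nat * nat) (N K : nat).

Section Scaling.
Variables (kappa delta S c1 c2 : R).
Hypotheses (kappa0 : 0 < kappa) (delta0 : 0 < delta) (c10 : 0 < c1).

Lemma cube_root (x : R) : 0 < x -> exists2 y, 0 < y & y ^+ 3 = x.
Proof.
move=> x0; exists (expR (ln x / 3)); first exact: expR_gt0.
by rewrite -expRM_natl mulrCA divff ?mulr1 ?pnatr_eq0 // lnK // posrE.
Qed.

Lemma lt_of_cube (x y : R) : 0 <= y -> x ^+ 3 < y ^+ 3 -> x < y.
Proof.
move=> y0; apply: contraTT; rewrite -!leNgt => yx.
by apply: lerXn2r => //; rewrite nnegrE // (le_trans y0).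
Qed.

(** The value of s is the cube root of kappa n_1 n_2. *)
Lemma near_scaling : \forall n \near to_infty c1 c2,
  exists s a b, scaling kappa delta S s a b n.
Proof.
have d30 : 0 < delta ^+ 3 by rewrite exprn_gt0.
pose S' := Num.max S 1.
pose B := 1 + `|kappa * c2 / delta ^+ 3| + `|kappa / (c1 * delta ^+ 3)| + `|S' ^+ 3 / kappa|.
pose M := Num.bound B.
have MB : B < M%:R.
  by apply: archi_boundP; rewrite /B !addr_ge0.
exists ([set i | (M <= i)%N], [set i | (M <= i)%N]).
  by split; exact: nbhs_infty_ge.
case=> n1 n2 [/= Mn1 Mn2] /andP[r1 r2].
have b1 : B < n1%:R by apply: lt_le_trans MB _; rewrite ler_nat.
have b2 : B < n2%:R by apply: lt_le_trans MB _; rewrite ler_nat.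
have := ler_norm (kappa * c2 / delta ^+ 3).
have := ler_norm (kappa / (c1 * delta ^+ 3)).
have := ler_norm (S' ^+ 3 / kappa).
have := normr_ge0 (kappa * c2 / delta ^+ 3).
have := normr_ge0 (kappa / (c1 * delta ^+ 3)).
have := normr_ge0 (S' ^+ 3 / kappa).
rewrite /B in b1 b2 => q1 q2 q3 q4 q5 q6.
have n1R : 1 < n1%:R :> R by lra.
have n2R : 1 < n2%:R :> R by lra.
have n10 : 0 < n1%:R :> R by lra.
have n20 : 0 < n2%:R :> R by lra.
have e1 : kappa * c2 < n1%:R * delta ^+ 3 by rewrite -ltr_pdivrMr //; lra.
have e2 : kappa < n2%:R * (c1 * delta ^+ 3).
  by rewrite -ltr_pdivrMr ?mulr_gt0 //; lra.
have e3 : S' ^+ 3 < n1%:R * kappa by rewrite -ltr_pdivrMr //; lra.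
move: r1 r2; rewrite ler_pdivlMr // ler_pdivrMr // => r1 r2.
have nn0 : 0 < kappa * (n1%:R * n2%:R) by rewrite !mulr_gt0.
have [s s0 s3] := cube_root nn0.
exists s, (s / n1%:R), (s / n2%:R); split=> /=.
- by rewrite -!(ltr_nat R).
- by rewrite !divfK ?gt_eqF.
- have -> : s * (s / n1%:R * (s / n2%:R)) = s ^+ 3 / (n1%:R * n2%:R).
    by field; rewrite !gt_eqF.
  by rewrite s3 mulfK // mulf_neq0 ?gt_eqF.
- rewrite !divr_gt0 //= !ltr_pdivrMr //; split.
    apply: lt_of_cube; first by rewrite mulr_ge0 // ltW.
    rewrite s3 exprMn.
    have h : kappa * (c2 * n1%:R) * n1%:R < n1%:R ^+ 3 * delta ^+ 3.
      have -> : kappa * (c2 * n1%:R) * n1%:R = n1%:R ^+ 2 * (kappa * c2) by ring.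
      by rewrite [n1%:R ^+ 3]exprSr -mulrA ltr_pM2l // exprn_gt0.
    rewrite mulrC in h; rewrite [delta ^+ 3 * _]mulrC; apply: le_lt_trans (_ : _ <= _) h.
    have -> : kappa * (n1%:R * n2%:R) = n1%:R * (kappa * n2%:R) by ring.
    by rewrite !ler_pM2l.
  apply: lt_of_cube; first by rewrite mulr_ge0 // ltW.
  rewrite s3 exprMn.
  have h : n2%:R ^+ 2 * kappa < n2%:R ^+ 2 * (n2%:R * (c1 * delta ^+ 3)).
    by rewrite ltr_pM2l // exprn_gt0.
  have h1 : n1%:R <= n2%:R / c1 by rewrite ler_pdivlMr // mulrC.
  apply: (@le_lt_trans _ _ (kappa * (n2%:R / c1 * n2%:R))).
    by rewrite ler_pM2l // ler_pM2r.
  have -> : kappa * (n2%:R / c1 * n2%:R) = n2%:R ^+ 2 * kappa / c1 by ring.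
  rewrite ltr_pdivrMr //; apply: lt_le_trans h _.
  by rewrite le_eqVlt; apply/orP; left; apply/eqP; ring.
have SS : S <= S' by rewrite le_max lexx.
apply: (le_trans SS); apply: ltW; apply: lt_of_cube; first exact: ltW.
rewrite s3; apply: lt_le_trans e3 _.
by rewrite mulrC ler_pM2l // ler_peMr // ltW.
Qed.

End Scaling.

Section Probability.
Variables (r : R) (r0 : 0 < r) (n : nat * nat).

Let N := (n.1 + n.2)%N.
Let n1N : (n.1 <= N)%N. Proof. exact: leq_addr. Qed.
Let n2N : (n.2 <= N)%N. Proof. exact: leq_addl. Qed.

(** The union bound. *)
Lemma prob_union (I : finType) (A : set (seq (nat * nat))) (B : I -> set (seq (nat * nat))) :
  0 < \sum_(G \in Pi R n) weight r G ->
  (forall G, Pi R n G -> ~ A G -> exists i, B i G) ->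
  `|1 - prob r n A| <= \sum_i prob r n (B i).
Proof.
set D := \sum_(G \in _) _ => D0 AB.
have DE : D = \sum_(nu : {ffun prim N -> 'I_N.+1} | endpoint nu == n) mweight r nu.
  rewrite /D -[Pi R n]setIT (sum_weight r _ n1N n2N (leqnn N)).
  by apply: eq_bigl => nu; rewrite asboolT ?andbT.
have AE (C : set (seq (nat * nat))) : \sum_(G \in Pi R n `&` C) weight r G =
    \sum_(nu : {ffun prim N -> 'I_N.+1} | endpoint nu == n)
      (if `[< C (line (R := R) nu) >] then mweight r nu else 0).
  by rewrite (sum_weight r _ n1N n2N (leqnn N)) -big_mkcondr.
have W0 (nu : {ffun prim N -> 'I_N.+1}) : 0 <= mweight r nu by rewrite ltW // mweight_gt0.
have AD : \sum_(G \in Pi R n `&` A) weight r G <= D.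
  by rewrite AE DE; apply: ler_sum => nu _; case: ifP.
rewrite ger0_norm; last by rewrite subr_ge0 /prob ler_pdivrMr // mul1r.
rewrite /prob -/D -mulr_suml ler_pdivlMr // mulrBl mul1r divfK ?gt_eqF //.
rewrite lerBlDr AE DE; under [X in _ <= X + _]eq_bigr do rewrite AE.
rewrite exchange_big -big_split /=; apply: ler_sum => nu /eqP tn.
have s0 : 0 <= \sum_i (if `[< B i (line (R := R) nu) >] then mweight r nu else 0).
  by apply: sumr_ge0 => i _; case: ifP.
case: (boolP `[< A (line (R := R) nu) >]) => [_|/asboolPn nA]; first by rewrite lerDr.
have Pn : Pi R n (line (R := R) nu).
  by split; [exact: convex_line_line|rewrite last_line].
have [i Bi] := AB _ Pn nA.
rewrite addr0 (bigD1 i) //= asboolT // lerDl; apply: sumr_ge0 => j _.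
by case: ifP.
Qed.

End Probability.

Definition gstar1 t : R := (t ^+ 2 + 2 * t) / (1 + t) ^+ 2.
Definition gstar2 t : R := t ^+ 2 / (1 + t) ^+ 2.

Lemma upto_below kappa delta S s a b n t N (x : prim N) :
  scaling kappa delta S s a b n ->
  upto n t%:E x = below t a b x.
Proof.
move=> [[n1 n2] [s1 s2] _ [/andP[a0 _] /andP[b0 _]] _].
have n1R : 0 < n.1%:R :> R by rewrite ltr0n.
have n2R : 0 < n.2%:R :> R by rewrite ltr0n.
rewrite /upto /below /slope /nscale /scale /embed.
have := dir_neq0 x; case: (dir x) => i j ij /=.
rewrite mulf_eq0 invr_eq0 (gt_eqF n1R) orbF pnatr_eq0; case: eqP => i0.
  have j0 : (0 < j)%N by move: ij; rewrite i0; case: (j).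
  rewrite i0 mulr0 leNgt ltry /=; apply/esym/negbTE.
  by rewrite -ltNge mulr_gt0 // ltr0n.
have iR : 0 < i%:R :> R by rewrite ltr0n lt0n; apply/eqP.
have s0 : 0 < s by rewrite -s1 mulr_gt0.
rewrite lee_fin ler_pdivrMr ?divr_gt0 //.
have -> : a = s / n.1%:R by rewrite -s1 mulfK // gt_eqF.
have -> : b = s / n.2%:R by rewrite -s2 mulfK // gt_eqF.
have -> : s / n.2%:R * j%:R = s * (j%:R / n.2%:R) by ring.
have -> : t * (s / n.1%:R) * i%:R = s * (t * (i%:R / n.1%:R)) by ring.
by rewrite ler_pM2l.
Qed.

Section Deviation.
Variables (r c1 c2 : R) (r0 : 0 < r) (c10 : 0 < c1).
Variable kappa : R.
Hypothesis kappa0 : 0 < kappa.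
Hypothesis kappaU : sector_upper r kappa.
Hypothesis kappaL : offaxis_lower r kappa.

(** The scaled point of the line at t lies in a half plane with normal
    (a - 1, b - 1) that misses the point of the limit curve by lam. *)
Definition deviates t a b lam n : set (seq (nat * nat)) :=
  [set G | (a - 1) * (xi n G t%:E).1 + (b - 1) * (xi n G t%:E).2 <=
           (a - 1) * gstar1 t + (b - 1) * gstar2 t - lam].

(** The weight of the event is exp (s (3 - rho + o(1))), where rho > 0
    is the gap in the hypothesis, and the total weight is exp (s (3 - o(1))). *)
Lemma prob_deviates t a b lam e : 0 < t -> 0 < a -> 0 < b -> 0 < e ->
  (a - 1) * gstar1 t + (b - 1) * gstar2 t + t / (a * (a + b * t)) - t / (1 + t) < lam ->
  \forall n \near to_infty c1 c2, prob r n (deviates t a b lam n) <= e.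
Proof.
move=> t0 a0 b0 e0 hlam.
pose rho := lam - ((a - 1) * gstar1 t + (b - 1) * gstar2 t + t / (a * (a + b * t)) - t / (1 + t)).
have rho0 : 0 < rho by rewrite subr_gt0.
have rho4 : 0 < rho / 4 by rewrite divr_gt0.
have [d1 d10 H1] := sum_deviation_le r0 kappa0 kappaU t0 a0 b0 rho4.
have [d2 d20 [S H2]] := partition_function_ge r0 kappa0 kappaU kappaL rho4.
have dd0 : 0 < Num.min d1 d2 by rewrite lt_min d10.
apply: filterS (near_scaling (Num.max S (2 / (rho * e))) c2 kappa0 dd0 c10).
move=> n [s [a' [b' [nn ss ks [/andP[a'0 a'd] /andP[b'0 b'd]]]]]].
rewrite ge_max => /andP[sS se].
move: a'd b'd; rewrite !lt_min => /andP[a'd1 a'd2] /andP[b'd1 b'd2].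
have sc1 : scaling kappa d1 S s a' b' n by split=> //; rewrite a'0 b'0.
have sc2 : scaling kappa d2 S s a' b' n by split=> //; rewrite a'0 b'0.
have {}H2 := H2 _ _ _ _ sc2.
have N0 : (0 < n.1 + n.2)%N by case: nn => h _; rewrite addn_gt0 h.
have {}H1 := H1 _ _ _ _ _ sc1 (n.1 + n.2)%N (n.1 + n.2)%N
  ((a - 1) * gstar1 t + (b - 1) * gstar2 t - lam) N0.
rewrite /prob ler_pdivrMr; last by apply: lt_le_trans H2; exact: expR_gt0.
rewrite (sum_weight r _ (leq_addr _ _) (leq_addl _ _) (leqnn _)).
have EA (nu : {ffun prim (n.1 + n.2)%N -> 'I_(n.1 + n.2).+1}) :
    `[< deviates t a b lam n (line (R := R) nu) >] =
    ((a - 1) * ((part_below t a' b' nu).1%:R / n.1%:R) +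
      (b - 1) * ((part_below t a' b' nu).2%:R / n.2%:R) <=
      (a - 1) * gstar1 t + (b - 1) * gstar2 t - lam).
  case: nn => n1 n2; rewrite /deviates /= asboolb (xi_line n1 n2).
  by under eq_bigl do rewrite (upto_below t _ sc1).
under eq_bigl do rewrite EA.
apply: (le_trans H1); apply: (@le_trans _ _ (expR (s * (3 - rho / 4)) * e)); last first.
  by rewrite mulrC ler_pM2l.
have s0 : 0 < s by case: ss => <- _; rewrite mulr_gt0 // ltr0n; case: nn.
have -> : s * (2 + ((a - 1) * gstar1 t + (b - 1) * gstar2 t - lam) +
    (t / (a * (a + b * t)) + (1 + t)^-1 + rho / 4)) =
    s * (3 - rho / 4) + - (s * (rho / 2)).
  rewrite /rho; have -> : (1 + t)^-1 = 1 - t / (1 + t).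
    by field; rewrite gt_eqF // addr_gt0.
  by field; rewrite !gt_eqF ?addr_gt0 // mulr_gt0.
rewrite expRD ler_pM2l ?expR_gt0 // expRN -[e]invrK lef_pV2 ?posrE ?invr_gt0 ?expR_gt0 //.
apply: le_trans (expR_ge1Dx _).
have : 2 <= s * (rho * e) by rewrite -ler_pdivrMr ?mulr_gt0.
rewrite -[e^-1]mul1r ler_pdivrMr //; nra.
Qed.

End Deviation.

(** The point (gstar1 t, gstar2 t) is minus the gradient of
    t / (a (a + b t)) at (1, 1), so that the terms of first order cancel. *)
Lemma quadratic_gain_1 t d : 0 < t -> - (1 / 2) <= d ->
  (1 + d - 1) * gstar1 t + (1 - 1) * gstar2 t + t / ((1 + d) * (1 + d + 1 * t)) - t / (1 + t)
  <= 2 * d ^+ 2.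
Proof.
move=> t0 d1; have t1 : 0 < 1 + t by lra.
have d0 : 0 < 1 + d by lra.
have td : 0 < 1 + d + t by lra.
have -> : (1 + d - 1) * gstar1 t + (1 - 1) * gstar2 t + t / ((1 + d) * (1 + d + 1 * t)) - t / (1 + t)
  = d ^+ 2 * ((1 + d)^-1 - ((1 + t) ^+ 2 * (1 + d + t))^-1).
  by rewrite /gstar1 /gstar2 mul1r; field; rewrite !gt_eqF.
rewrite mulrC ler_wpM2r ?sqr_ge0 //.
have : 0 <= ((1 + t) ^+ 2 * (1 + d + t))^-1.
  by rewrite invr_ge0 mulr_ge0 ?exprn_ge0 // ltW.
have : (1 + d)^-1 <= 2 by rewrite -[_^-1]mul1r ler_pdivrMr //; lra.
lra.
Qed.

Lemma quadratic_gain_2 t d : 0 < t -> - (1 / 2) <= d ->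
  (1 - 1) * gstar1 t + (1 + d - 1) * gstar2 t + t / (1 * (1 + (1 + d) * t)) - t / (1 + t)
  <= 2 * d ^+ 2.
Proof.
move=> t0 d1; have t1 : 0 < 1 + t by lra.
have td : 0 < 1 + (1 + d) * t by nra.
have -> : (1 - 1) * gstar1 t + (1 + d - 1) * gstar2 t + t / (1 * (1 + (1 + d) * t)) - t / (1 + t)
  = d ^+ 2 * (t ^+ 3 / ((1 + t) ^+ 2 * (1 + (1 + d) * t))).
  by rewrite /gstar1 /gstar2 mul1r; field; rewrite !gt_eqF.
rewrite mulrC ler_wpM2r ?sqr_ge0 //.
rewrite ler_pdivrMr ?mulr_gt0 ?exprn_gt0 //.
have h : t / 2 <= 1 + (1 + d) * t by nra.
have : t ^+ 2 <= (1 + t) ^+ 2 by nra.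
have t2 : 0 <= t ^+ 2 by rewrite exprn_ge0 // ltW.
move=> h2; have : t ^+ 2 * (t / 2) <= (1 + t) ^+ 2 * (1 + (1 + d) * t).
  by apply: ler_pM => //; rewrite divr_ge0 // ltW.
rewrite [t ^+ 3]exprSr; lra.
Qed.

(** Between neighbouring grid points monotonicity confines X between its
    values there, while gam varies by at most 2 / m. *)
Lemma grid_bound (X gam : R -> R) (m : nat) (eta : R) : (0 < m)%N -> 0 <= eta ->
  (forall c c', 0 <= c -> c <= c' -> c' < 1 -> X c <= X c') ->
  (forall c, 0 <= c < 1 -> 0 <= X c <= 1) ->
  gam 0 = 0 -> gam 1 = 1 ->
  (forall c c', 0 <= c -> c <= c' -> c' <= 1 -> gam c <= gam c' <= gam c + 2 * (c' - c)) ->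
  (forall j, (0 < j < m)%N -> `|X (j%:R / m%:R) - gam (j%:R / m%:R)| <= eta) ->
  forall c, 0 <= c < 1 -> `|X c - gam c| <= eta + 2 / m%:R.
Proof.
move=> m0 eta0 Xmono X01 gam0 gam1 glip Xg c /andP[c0 c1].
have mR : 0 < m%:R :> R by rewrite ltr0n.
have mc0 : 0 <= m%:R * c by rewrite mulr_ge0.
pose j := Num.truncn (m%:R * c).
have /andP[j1 j2] := truncn_itv mc0; rewrite -/j in j1 j2.
have jm : (j < m)%N.
  by rewrite -(ltr_nat R); apply: le_lt_trans j1 _; rewrite -[ltRHS]mulr1 ltr_pM2l.
have lo : j%:R / m%:R <= c by rewrite ler_pdivrMr // mulrC.
have hi : c <= j.+1%:R / m%:R by rewrite ler_pdivlMr // mulrC ltW.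
have step : j.+1%:R / m%:R = j%:R / m%:R + 1 / m%:R :> R.
  by rewrite -mulrDl -[j.+1]addn1 natrD.
have hi2 : c <= j%:R / m%:R + 1 / m%:R by rewrite -step.
have j0 : 0 <= j%:R / m%:R :> R by rewrite divr_ge0.
have top : j.+1%:R / m%:R <= 1 :> R by rewrite ler_pdivrMr // mul1r ler_nat.
have /andP[x0 x1] : 0 <= X c <= 1 by apply: X01; rewrite c0.
have two : 2 / m%:R = 2 * (1 / m%:R) :> R by rewrite mul1r.
have lower : gam c - (eta + 2 / m%:R) <= X c.
  have /andP[_ h] := glip _ _ j0 lo (ltW c1).
  case: (posnP j) => [jz|jp].
    by rewrite jz !mul0r gam0 in h hi2; lra.
  have := Xg j; rewrite jp jm => /(_ isT); rewrite ler_norml => /andP[h1 _].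
  have := Xmono _ _ j0 lo c1; lra.
have upper : X c <= gam c + (eta + 2 / m%:R).
  have /andP[_ h] := glip _ _ c0 hi top.
  move: (jm); rewrite leq_eqVlt => /orP[/eqP E|jm'].
    by rewrite E divff ?gt_eqF // gam1 in h step; lra.
  have hi1 : j.+1%:R / m%:R < 1 :> R by rewrite ltr_pdivrMr // mul1r ltr_nat.
  have := Xg j.+1; rewrite jm' => /(_ isT); rewrite ler_norml => /andP[_ h1].
  have := Xmono _ _ c0 hi hi1; lra.
by rewrite ler_norml; apply/andP; split; lra.
Qed.

Lemma enorm_le (v : R * R) : enorm v <= `|v.1| + `|v.2|.
Proof.
rewrite /enorm -[leRHS]ger0_norm ?addr_ge0 // -sqrtr_sqr; apply: ler_wsqrtr.
rewrite -[v.1 ^+ 2]real_normK ?num_real // -[v.2 ^+ 2]real_normK ?num_real //.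
by have := normr_ge0 v.1; have := normr_ge0 v.2; nra.
Qed.

Section Distance.
Variables (N K : nat) (n : nat * nat) (n1 : (0 < n.1)%N) (n2 : (0 < n.2)%N).
Variables (nu : {ffun prim N -> 'I_K.+1}) (tn : endpoint nu = n).

Lemma xi_line_mono (t t' : \bar R) : (t <= t')%E ->
  ((xi n (line (R := R) nu) t).1 <= (xi n (line (R := R) nu) t').1) /\
  ((xi n (line (R := R) nu) t).2 <= (xi n (line (R := R) nu) t').2).
Proof.
move=> tt; rewrite !(xi_line n1 n2).
have [w ->] : exists w, \sum_(x | upto n t' x) dir x *+ nu x =
    \sum_(x | upto n t x) dir x *+ nu x + w.
  exists (\sum_(x | upto n t' x && ~~ upto n t x) dir x *+ nu x).
  rewrite [LHS](bigID (upto n t)); congr (_ + _); apply: eq_bigl => x.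
  apply/andP/idP => [[]//|h]; split=> //; exact: le_trans h tt.
rewrite nscaleD /nscale /scale /embed /=.
by split; rewrite lerDl divr_ge0.
Qed.

Lemma xi_line_pinfty : xi n (line (R := R) nu) +oo%E = (1, 1) :> R * R.
Proof.
rewrite (xi_line n1 n2).
have -> : \sum_(x | upto n (+oo%E : \bar R) x) dir x *+ nu x = n.
  by rewrite -[RHS]tn; apply: eq_bigl => x; rewrite /upto leey.
by rewrite /nscale /scale /embed /= !divff // pnatr_eq0 -lt0n.
Qed.

Lemma xi_line_ge0 (t : \bar R) :
  (0 <= (xi n (line (R := R) nu) t).1) /\ (0 <= (xi n (line (R := R) nu) t).2).
Proof.
by rewrite (xi_line n1 n2) /nscale /scale /embed /=; split; rewrite divr_ge0.
Qed.

(** In the parameter c = t / (1 + t) the limit curve is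
    (2 c - c^2, c^2), with 2-Lipschitz coordinates; the grid is c = j / m. *)
Lemma tangential_dist_le (m : nat) (eta : R) : (0 < m)%N -> 0 <= eta ->
  (forall j, (0 < j < m)%N -> let t := j%:R / (m - j)%:R in
    `|(xi n (line (R := R) nu) t%:E).1 - gstar1 t| <= eta /\
    `|(xi n (line (R := R) nu) t%:E).2 - gstar2 t| <= eta) ->
  (tangential_dist R n (line (R := R) nu) <= (2 * (eta + 2 / m%:R))%:E)%E.
Proof.
move=> m0 eta0 H; set L := line (R := R) nu in H *.
pose T (c : R) := c / (1 - c).
have mR : 0 < m%:R :> R by rewrite ltr0n.
have Tmono c c' : 0 <= c -> c <= c' -> c' < 1 -> T c <= T c'.
  move=> c0 cc c1; rewrite /T ler_pdivrMr ?subr_gt0; last exact: le_lt_trans c1.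
  by rewrite mulrAC ler_pdivlMr ?subr_gt0 //; nra.
have Tg c : c < 1 -> gstar1 (T c) = 2 * c - c ^+ 2 /\ gstar2 (T c) = c ^+ 2.
  move=> c1; have h : 1 - c != 0 by rewrite gt_eqF // subr_gt0.
  rewrite /gstar1 /gstar2 /T.
  have -> : 1 + c / (1 - c) = (1 - c)^-1 by field.
  by split; field.
have Tj j : (0 < j < m)%N -> T (j%:R / m%:R) = j%:R / (m - j)%:R.
  move=> /andP[j0 jm]; rewrite /T natrB ?(ltnW jm) //.
  have mj : m%:R - j%:R != 0 :> R by rewrite gt_eqF // subr_gt0 ltr_nat.
  have mR' : m%:R != 0 :> R by rewrite gt_eqF.
  by field; rewrite mj mR'.
have cj j : (0 < j < m)%N -> j%:R / m%:R < 1 :> R.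
  by move=> /andP[_ jm]; rewrite ltr_pdivrMr // mul1r ltr_nat.
have le1 (t : \bar R) : ((xi n L t).1 <= 1) /\ ((xi n L t).2 <= 1).
  by have := xi_line_mono (leey t); rewrite xi_line_pinfty.
have B1 c : 0 <= c < 1 -> `|(xi n L (T c)%:E).1 - (2 * c - c ^+ 2)| <= eta + 2 / m%:R.
  apply: (@grid_bound (fun c => (xi n L (T c)%:E).1) (fun c => 2 * c - c ^+ 2)) => //.
  - move=> c1 c2 h1 h2 h3; apply: (xi_line_mono _).1.
    by rewrite lee_fin; exact: Tmono.
  - by move=> c' _; rewrite (xi_line_ge0 _).1 (le1 _).1.
  - by rewrite mulr0 expr0n subr0.
  - by rewrite mulr1 expr1n; lra.
  - by move=> c1 c2 h1 h2 h3; apply/andP; split; nra.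
  - by move=> j hj; rewrite -(Tg _ (cj j hj)).1 Tj //; exact: (H j hj).1.
have B2 c : 0 <= c < 1 -> `|(xi n L (T c)%:E).2 - c ^+ 2| <= eta + 2 / m%:R.
  apply: (@grid_bound (fun c => (xi n L (T c)%:E).2) (fun c => c ^+ 2)) => //.
  - move=> c1 c2 h1 h2 h3; apply: (xi_line_mono _).2.
    by rewrite lee_fin; exact: Tmono.
  - by move=> c' _; rewrite (xi_line_ge0 _).2 (le1 _).2.
  - by rewrite expr0n.
  - by rewrite expr1n.
  - by move=> c1 c2 h1 h2 h3; apply/andP; split; nra.
  - by move=> j hj; rewrite -(Tg _ (cj j hj)).2 Tj //; exact: (H j hj).2.
have b0 : 0 <= eta + 2 / m%:R by rewrite addr_ge0 // divr_ge0.
apply: ge_ereal_sup => _ [t /= t0 <-]; rewrite lee_fin.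
apply: le_trans (enorm_le _) _.
case: t t0 => [t||] //= t0; last first.
  by rewrite xi_line_pinfty /= !subrr normr0 addr0 mulr_ge0.
rewrite lee_fin in t0; have t1 : 0 < 1 + t by lra.
pose c := t / (1 + t).
have c01 : 0 <= c < 1.
  apply/andP; split; first by rewrite /c divr_ge0 // ltW.
  by rewrite /c ltr_pdivrMr // mul1r; lra.
have TE : T c = t.
  by rewrite /T /c; field; rewrite gt_eqF //=; lra.
have := B1 c c01; have := B2 c c01; rewrite TE.
have -> : 2 * c - c ^+ 2 = (t ^+ 2 + 2 * t) / (1 + t) ^+ 2.
  by rewrite /c; field; rewrite gt_eqF.
have -> : c ^+ 2 = t ^+ 2 / (1 + t) ^+ 2 by rewrite /c expr_div_n.
lra.
Qed.

End Distance.

End Limit.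

Theorem theorem1p1 (R : realType) (r : R) (hr : 0 < r)
    (eps : R) (heps : 0 < eps)
    (c1 c2 : R) (hc1 : 0 < c1) (hc2 : c1 <= c2) :
  prob r n [set G | (tangential_dist R n G <= eps%:E)%E]
    @[n --> to_infty c1 c2] --> (1 : R).
Proof.
have [kappa kappa0 [kappaU kappaL]] := prod_zfac_asymp hr.
apply/cvgrPdist_le => e e0.
pose m := (Num.bound (8 / eps)).+1.
have m0 : 0 < m%:R :> R by rewrite ltr0n.
have m8 : 2 / m%:R <= eps / 4.
  have : 8 / eps < m%:R.
    apply: lt_le_trans (archi_boundP _) _; first by rewrite divr_ge0 // ltW.
    by rewrite ler_nat.
  rewrite ltr_pdivrMr // ler_pdivrMr //; lra.
pose eta := Num.min (eps / 4) 1.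
have eta0 : 0 < eta by rewrite lt_min divr_gt0 //= ltr01.
have etae : eta <= eps / 4 by rewrite ge_min lexx.
have eta1 : eta <= 1 by rewrite ge_min lexx orbT.
pose th := eta / 4.
(* A deviation is indexed by a grid point, a coordinate and a sign. *)
pose I := ('I_m * (bool * bool))%type.
pose ta (i : I) : R := i.1%:R / (m - i.1)%:R.
pose sg (i : I) : R := if i.2.2 then th else - th.
pose ca (i : I) : R := if i.2.1 then 1 + sg i else 1.
pose cb (i : I) : R := if i.2.1 then 1 else 1 + sg i.
pose B (n : nat * nat) (i : I) : set (seq (nat * nat)) :=
  if (0 < i.1)%N then deviates (ta i) (ca i) (cb i) (th * eta) n else set0.
have sgE i : (sg i) ^+ 2 = th ^+ 2 by rewrite /sg; case: ifP => _; rewrite ?sqrrN.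
have sgb i : - (1 / 2) <= sg i by rewrite /sg /th; case: ifP => _; lra.
pose e' := e / #|{: I}|.+1%:R.
have e'0 : 0 < e' by rewrite divr_gt0 // ltr0n.
have nearB : \forall n \near to_infty c1 c2, forall i : I, prob r n (B n i) <= e'.
  apply: filter_forall => i; case: (posnP i.1) => i0.
    by apply: nearW => n; rewrite /B i0 /prob setI0 fsbig_set0 mul0r ltW.
  have BE n : B n i = deviates (ta i) (ca i) (cb i) (th * eta) n by rewrite /B i0.
  suff : \forall n \near to_infty c1 c2,
      prob r n (deviates (ta i) (ca i) (cb i) (th * eta) n) <= e'.
    by apply: filterS => n; rewrite BE.
  have t0 : 0 < ta i by rewrite divr_gt0 ?ltr0n // subn_gt0.
  apply: (prob_deviates c2 hr hc1 kappa0 kappaU kappaL) => //.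
  - by rewrite /ca; case: ifP => // _; have := sgb i; lra.
  - by rewrite /cb; case: ifP => // _; have := sgb i; lra.
  have h : 2 * (sg i) ^+ 2 < th * eta by rewrite sgE /th; nra.
  apply: le_lt_trans h; rewrite /ca /cb; case: ifP => _.
    exact: quadratic_gain_1.
  exact: quadratic_gain_2.
have [d d0 [S HS]] := partition_function_ge hr kappa0 kappaU kappaL ltr01.
have nearS := near_scaling S c2 kappa0 d0 hc1.
apply: filterS2 nearB nearS => n nB [s [a [b sc]]].
have D0 := lt_le_trans (expR_gt0 _) (HS _ _ _ _ sc).
have [[n1 n2] _ _ _ _] := sc.
apply: (@le_trans _ _ (\sum_(i : I) prob r n (B n i))); last first.
  apply: (@le_trans _ _ (\sum_(i : I) e')); first by apply: ler_sum => i _.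
  rewrite sumr_const -mulr_natr /e' mulrAC ler_pdivrMr ?ltr0n //.
  by rewrite ler_pM2l // ler_nat.
apply: prob_union => // G GP; apply: contra_notP => noB.
have [nu GE] := line_surj (leq_addr n.2 n.1) (leq_addl n.1 n.2) (leqnn _) GP.
have tn : endpoint nu = n by rewrite -(@last_line R) -GE; case: GP.
rewrite /= GE.
apply: (@le_trans _ _ (2 * (eta + 2 / m%:R))%:E); last by rewrite lee_fin; lra.
apply: tangential_dist_le => // [|j /andP[j0 jm] t]; first exact: ltW.
have th0 : 0 < th by rewrite divr_gt0.
have nB' u v : ~ deviates t (ca (Ordinal jm, (u, v))) (cb (Ordinal jm, (u, v)))
    (th * eta) n (line (R := R) nu).
  move=> h; apply: noB; exists (Ordinal jm, (u, v)).
  by rewrite /B /= j0 GE.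
have := nB' true true; have := nB' true false.
have := nB' false true; have := nB' false false.
rewrite /deviates /ca /cb /sg /=.
move=> /negP; rewrite -ltNge => h1 /negP; rewrite -ltNge => h2.
move=> /negP; rewrite -ltNge => h3 /negP; rewrite -ltNge => h4.
rewrite !ler_norml; split; apply/andP; split.
- by rewrite -(ler_pM2l th0); lra.
- by rewrite -(ler_pM2l th0); lra.
- by rewrite -(ler_pM2l th0); lra.
- by rewrite -(ler_pM2l th0); lra.
Qed.
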